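(* Let $(X,\mu)$ be an atom-free standard probability space with a fixed isomorphism (mod 0) $\sigma_X:[0,1]\to X$. Let $w:X\times X\to[0,1]$ be a graphon and $f\in L^2(X)$. Let $\{(G_n,f_n)\}_{n\in\mathbb{N}}$ be a sequence of graph signals converging to the graphon signal $(w,f)$, and suppose that the graphs $G_n$ and the signals $f_n$ are labeled so that $(w_{G_n,X},f_n^X)$ converges in norm to $(w,f)$. For each $n$, let the nonzero eigenvalues $\{\lambda_i^n\}$ of the adjacency matrix of $G_n$ be indexed as described in the context, with corresponding orthonormal eigenvectors $\phi_i^n$. Then the graph Fourier transforms $\widehat{f_n}$ converge to the graphon Fourier transform $\widehat f$ in the following sense: for each nonzero eigenvalue $\mu_j$ of $T_w$, $$\sum_{i\in I_{\mu_j}}\widehat{f_n}(\phi_i^n)\,(\phi_i^n)^X\to\widehat f(\mu_j)\quad\text{in } L^2(X)\text{ as } n\to\infty.$$ Moreover, if $P^w_0(f)=\mathbf 0$, then $$\sum_{j\in\mathbb{Z}^*}\Big\|\sum_{i\in I_{\mu_j}}\widehat{f_n}(\phi_i^n)\,(\phi_i^n)^X-\widehat f(\mu_j)\Big\|_2^2\to0\quad\text{as } n\to\infty.$$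
   Context: $\mathbb{Z}^*=\mathbb{Z}\setminus\{0\}$; $L^2(X)$ is the complex Hilbert space. A graphon on $X$ is a measurable, a.e. symmetric function $w:X\times X\to[0,1]$; a graphon signal is a pair $(w,f)$ with $f\in L^2(X)$. The cut norm is $\|u\|_\Box=\sup_{S,T\subseteq X}|\int_{S\times T}u|$ over measurable $S,T$. $(w_n,f_n)\to(w,f)$ in norm means $\|w_n-w\|_\Box\to0$ and $\|f_n-f\|_2\to0$. That $\sigma_X$ is an isomorphism mod 0 means that there are null sets $A_1\subset[0,1]$, $A_2\subset X$ such that $\sigma_X:[0,1]\setminus A_1\to X\setminus A_2$ is a bijection that is measurable and measure-preserving, as is its inverse. Let $G$ be a (simple, finite) graph with vertices labeled $1,\dots,N$, with adjacency matrix $A$, and let $I_k=[\frac{k-1}{N},\frac kN)$. The graphon $w_{G,X}$ on $X$ equals $1$ on $\sigma_X(I_k)\times\sigma_X(I_l)$ if $k,l$ are adjacent, and $0$ otherwise (and on the remaining null set). A graph signal on $G$ is a vector $f\in\mathbb{C}^N$, and $f^X\in L^2(X)$ is defined by $f^X(s)=\sqrt N f(k)$ for $s\in\sigma_X(I_k)$, $1\le k\le N$. A sequence $(G_n,f_n)$ of graph signals converges to $(w,f)$ if there are labelings of the $G_n$ such that $(w_{G_n,X},f_n^X)\to(w,f)$ in norm. For an orthonormal eigenbasis $\{\phi_i\}$ of $A$, the graph Fourier transform of $f$ is $\widehat f(\phi_i)=\langle f,\phi_i\rangle_{\mathbb{C}^N}=\sum_k f(k)\overline{\phi_i(k)}$.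 Indexing convention: nonzero eigenvalues (repeated according to multiplicity) of a self-adjoint compact operator or matrix are indexed by elements of $\mathbb{Z}^*$ so that positive eigenvalues in decreasing order are $\lambda_1\ge\lambda_2\ge\cdots$ and negative ones are $\lambda_{-1}\le\lambda_{-2}\le\cdots$; each of the two sequences is padded with zeros if finite. In sums over $i\in I_{\mu_j}$ involving $\phi_i^n$, only those $i$ for which $\lambda_i^n$ is a nonzero eigenvalue of the adjacency matrix of $G_n$ contribute. For the graphon $w$: $T_w(\xi)(x)=\int_Xw(x,y)\xi(y)\,d\mu(y)$ on $L^2(X)$, with nonzero eigenvalues $\lambda_i(w)$, $i\in I_w=\{i\in\mathbb{Z}^*:\lambda_i(w)\ne0\}$, repeated according to multiplicity and indexed so that the positive ones in decreasing order are $\lambda_1(w)\ge\lambda_2(w)\ge\cdots$ and the negative ones are $\lambda_{-1}(w)\le\lambda_{-2}(w)\le\cdots$, each of the two sequences being padded with zeros if finite. $\{\mu_j\}_{j\in\mathbb{Z}^*}$ is the sequence of distinct nonzero eigenvalues of $T_w$ ordered in the same way and padded with zeros, and $I_{\mu_j}=\{i\in I_w:\lambda_i(w)=\mu_j\}$ (empty if $\mu_j=0$). The graphon Fourier transform of $(w,f)$ is $\widehat f(\mu_j)=P^w_{I_{\mu_j}}(f)$ for $\mu_j\neq0$, where $P^w_{I_{\mu_j}}$ is the orthogonal projection of $L^2(X)$ onto the $\mu_j$-eigenspace of $T_w$, and $\widehat f(0)=P^w_0(f)$, where $P^w_0$ is the orthogonal projection onto the null space of $T_w$. *)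

(* Defs.v *)
From HB Require Import structures.
From mathcomp Require Import all_boot all_order all_algebra.
From mathcomp Require Import all_classical all_reals all_analysis.
From mathcomp Require Export complex.

Set Implicit Arguments.
Unset Strict Implicit.
Unset Printing Implicit Defensive.

Import Order.TTheory GRing.Theory Num.Theory.
Import numFieldNormedType.Exports.

Local Open Scope classical_set_scope.
Local Open Scope complex_scope.
Local Open Scope ring_scope.

(* Elements of the complex space L^2(X) are represented by functions
   X -> R[i]; equality in L^2(X) is equality mu-almost everywhere. *)
Section complex_L2.
Context d (X : measurableType d) (R : realType) (mu : probability X R).
Implicit Types (f g p xi : X -> R[i]) (V : set (X -> R[i])).

Definition ceq f g : Prop := {ae mu, forall x, f x = g x}.

Definition L2norm f : \bar R := Lnorm mu 2%:E (fun x => (Normc.normc (f x))%:E).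

Definition L2 : set (X -> R[i]) :=
  [set f | [/\ measurable_fun setT (fun x => complex.Re (f x)),
               measurable_fun setT (fun x => complex.Im (f x))
             & (L2norm f < +oo)%E]].

Definition cintegral f : R[i] :=
  (\int[mu]_x complex.Re (f x)) +i* (\int[mu]_x complex.Im (f x)).

Definition L2dot f g : R[i] := cintegral (fun x => f x * (g x)^*).

(* The orthogonal projection onto a closed subspace V; it is determined
   up to a.e. equality. *)
Definition orthproj V f : X -> R[i] :=
  xget (cst 0) [set p | V p /\
    forall v, V v -> L2dot (fun x => f x - p x) v = 0].

Definition L2dim V (n : nat) : Prop :=
  exists b : 'I_n -> X -> R[i],
    [/\ forall k, V (b k),
        forall c : 'I_n -> R[i],
          ceq (fun x => \sum_(k < n) c k * b k x) (cst 0) -> forall k, c k = 0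
      & forall v, V v -> exists c : 'I_n -> R[i],
          ceq v (fun x => \sum_(k < n) c k * b k x)].

End complex_L2.

(* Isomorphism mod 0 from [0, 1] with Lebesgue measure to (X, mu); A1 and A2
   are the exceptional null sets.  The space [0, 1] carries the Lebesgue-
   measurable sets, while sigma^-1 is, as usual for a function with values in
   R, only required to pull back Borel sets to measurable sets.  This covers
   both complete X and standard Borel X.  The values of sigma outside
   `[0, 1] `\` A1 are irrelevant.
   An atom-free standard probability space is a probability space for which
   such an isomorphism exists. *)
Definition iso_mod0 (R : realType) d (X : measurableType d)
    (mu : probability X R) (sigma : R -> X) (A1 : set R) (A2 : set X) : Prop :=
  let D := `[0, 1]%classic `\` A1 in
  [/\ A1 `<=` `[0, 1]%classic /\ (@lebesgue_measure R).-negligible A1,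
      measurable A2 /\ mu A2 = 0%E,
      set_bij D (~` A2) sigma,
      forall B : set X, measurable B ->
        measurable_realfun.completed_algebra_gen (@lebesgue_measure R) (D `&` sigma @^-1` B) /\
        completed_lebesgue_measure (D `&` sigma @^-1` B) = mu B
    & forall C : set R, measurable C ->
        measurable (sigma @` (D `&` C)) /\
        mu (sigma @` (D `&` C)) = lebesgue_measure (`[0, 1]%classic `&` C)].

Section graphons.
Context d (X : measurableType d) (R : realType) (mu : probability X R).
Implicit Types (w u : X * X -> R) (f xi : X -> R[i]).

Definition graphon w : Prop :=
  [/\ measurable_fun setT w,
      forall p, 0 <= w p <= 1
    & {ae (mu \x mu)%E, forall p, w p = w (p.2, p.1)}].

Definition cutnorm u : \bar R :=
  ereal_sup [set `| \int[(mu \x mu)%E]_(p in ST.1 `*` ST.2) (u p)%:E |%E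
            | ST in [set ST : set X * set X | measurable ST.1 /\ measurable ST.2]].

Definition converges_in_norm (wn : nat -> X * X -> R) (fn : nat -> X -> R[i])
    w f : Prop :=
  ((cutnorm (fun p => wn n p - w p) @[n --> \oo] --> 0%E) /\
   (L2norm mu (fun s => fn n s - f s) @[n --> \oo] --> 0%E)).

Definition graphon_op w xi : X -> R[i] :=
  fun x => cintegral mu (fun y => (w (x, y))%:C * xi y).

(* For c = 0 this is the null space of T_w. *)
Definition op_eigenspace w (c : R) : set (X -> R[i]) :=
  [set xi | L2 mu xi /\ ceq mu (graphon_op w xi) (fun x => c%:C * xi x)].

Definition op_eigenvalue w (c : R) : Prop :=
  exists2 xi, op_eigenspace w c xi & ~ ceq mu xi (cst 0).

(* Both \hat f(mu_j) for mu_j != 0 and \hat f(0). *)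
Definition graphon_fourier w f (c : R) : X -> R[i] :=
  orthproj mu (op_eigenspace w c) f.

End graphons.

(* Families indexed by the nonzero integers are functions on int whose value
   at 0 is ignored. *)
Section enumerations.
Context (R : realType).
Implicit Types (lam nu : int -> R).

Definition Zstar : set int := [set i | i != 0].

Definition signed_order lam : Prop :=
  (forall i j : int, 0 < i -> i <= j -> 0 <= lam j <= lam i) /\
  (forall i j : int, i < 0 -> j <= i -> lam i <= lam j <= 0).

(* mult c n : the nonzero number c is an eigenvalue of multiplicity n
   (n = 0 meaning that it is not an eigenvalue).  The padding zeros need no
   clause, since every nonzero value of lam is an eigenvalue. *)
Definition enum_with_mult (mult : R -> nat -> Prop) lam : Prop :=
  signed_order lam /\
  forall c : R, c != 0 -> exists s : seq int,
    [/\ uniq s, forall i, (i \in s) = (i != 0) && (lam i == c)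
      & mult c (size s)].

Definition enum_distinct (ev : R -> Prop) nu : Prop :=
  [/\ signed_order nu,
      forall c : R, c != 0 -> (ev c <-> exists2 j, Zstar j & nu j = c)
    & forall i j, Zstar i -> Zstar j -> nu i != 0 -> nu i = nu j -> i = j].

Definition nonzero_index lam : set int := [set i | i != 0 /\ lam i != 0].

End enumerations.

Definition graphon_eigenvalues d (X : measurableType d) (R : realType)
    (mu : probability X R) (w : X * X -> R) (lam : int -> R) : Prop :=
  enum_with_mult (fun c => L2dim mu (op_eigenspace mu w c)) lam.

Definition graphon_distinct_eigenvalues d (X : measurableType d) (R : realType)
    (mu : probability X R) (w : X * X -> R) (nu : int -> R) : Prop :=
  enum_distinct (op_eigenvalue mu w) nu.

(* Simple graph with vertices labeled by 'I_N. *)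
Record sgraph (N : nat) := SGraph {
  adj : rel 'I_N;
  adj_sym : symmetric adj;
  adj_irr : irreflexive adj }.

Section graphs.
Context (R : realType) (N : nat).
Implicit Types (G : sgraph N) (f phi : 'rV[R[i]]_N) (lam : int -> R).

Definition adjmx G : 'M[R[i]]_N := \matrix_(k, l) (adj G k l)%:R.

(* Vectors are rows; since adjmx G is symmetric, left and right eigenvectors
   coincide. *)
Definition graph_eigenvalues G lam : Prop :=
  enum_with_mult (fun c m => m = \rank (eigenspace (adjmx G) c%:C)) lam.

Definition cdot f phi : R[i] := \sum_(k < N) f 0 k * (phi 0 k)^*.

Definition orthonormal_eigenvectors G lam (phi : int -> 'rV[R[i]]_N) : Prop :=
  (forall i, nonzero_index lam i ->
     phi i *m adjmx G = (lam i)%:C *: phi i) /\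
  (forall i j, nonzero_index lam i -> nonzero_index lam j ->
     cdot (phi i) (phi j) = (i == j)%:R).

Definition graph_fourier f phi : R[i] := cdot f phi.

Context (X : Type) (sigma : R -> X) (A1 : set R).

(* sigma(I_k), with k counted from 0; the exceptional null set A1, where sigma
   is arbitrary, is left out. *)
Definition block (k : 'I_N) : set X :=
  sigma @` (`[k%:R / N%:R, k.+1%:R / N%:R[%classic `\` A1).

Definition graph_graphon G : X * X -> R :=
  \1_[set p : X * X | exists k l : 'I_N,
        [/\ adj G k l, block k p.1 & block l p.2]].

(* f^X; at most one term is nonzero, as the blocks are disjoint. *)
Definition step_signal f : X -> R[i] :=
  fun s => \sum_(k < N) ((Num.sqrt N%:R)%:C * f 0 k) *+ (s \in block k).

(* The sum of \hat f(phi_i) phi_i^X over the i in I_c such that lamG i is a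
   nonzero eigenvalue of the graph, where I_c = {i | lam i = c} is the set of
   indices of the nonzero eigenvalue c of the graphon. *)
Definition fourier_component lam (c : R) (lamG : int -> R) f
    (phi : int -> 'rV[R[i]]_N) : X -> R[i] :=
  fun s => \sum_(i \in [set i | nonzero_index lam i /\ lam i = c] `&`
                       nonzero_index lamG)
             graph_fourier f (phi i) * step_signal (phi i) s.

End graphs.

(* Main.v *)
(* The adjacency matrix of G_n, divided by its size, acts on L^2(X) as the
   finite-rank operator T_n = sum_i (lambda_i / N) <., phi_i^X> phi_i^X, which
   is the integral operator of the step graphon.  Truncating functions shows
   that convergence in cut norm implies T_n -> T_w in operator norm.  Along an
   ultrafilter on the indices n, compactness of T_w makes every eigenvalue
   lambda_i / N converge and, when its limit is nonzero, also its eigenvector;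
   the limits are an orthonormal eigensystem of T_w whose orthogonal complement
   is annihilated by T_w, since |lambda_i / N| <= |i|^(-1/2) uniformly in n.
   Counting multiplicities identifies the limit eigenvalues with those of T_w
   index by index, so that the spectral projections converge along every
   ultrafilter, hence along n -> oo.  The sum over j follows from Parseval's
   identity, which holds for f when P_0 f = 0, and Bessel's inequality for f_n. *)
Require Import Defs.
From mathcomp Require Import all_boot all_order all_algebra.
From mathcomp Require Import all_classical all_reals all_analysis.
From mathcomp Require Import measurable_realfun.
From HB Require Import structures.
From mathcomp Require Import ring lra zify.

Import Order.TTheory GRing.Theory Num.Theory.
Import numFieldNormedType.Exports.

Set Implicit Arguments.
Unset Strict Implicit.

Local Open Scope classical_set_scope.
Local Open Scope complex_scope.
Local Open Scope ring_scope.

(** An eigenvector is determined only up to a phase, and up to a unitary when its eigenvalue is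
    multiple; the choice made for [G n] may turn with n, so single eigenvectors need not converge as
    n grows and only the spectral projections do. Ultrafilters provide limits for all indices at
    once, without diagonal subsequences; the limit vectors depend on the ultrafilter, but the
    projection they define does not, being characterised by an eigenspace of T_w. No spectral
    theorem for compact operators is invoked: the finite-dimensional one, for adjacency matrices, is
    carried to the limit. The bound |i|^(-1/2) is a Hilbert-Schmidt estimate: the squared entries of
    an adjacency matrix sum to at most N^2, and at least |i| eigenvalues are as large in modulus as
    lambda_i. It prevents mass from escaping to large indices. The spectral argument lives in an
    abstract complete space with a semidefinite form, where graphs and graphon enter only through
    [spectral_approx]; that record is then established for L^2(X). *)

Local Notation Re := complex.Re.
Local Notation Im := complex.Im.
Local Notation normc := Normc.normc.

(** * Modulus, real and imaginary part of complex numbers *)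

Section complex_modulus.
Context {R : realType}.
Implicit Types z y : R[i].

Lemma normc_ge0 z : 0 <= normc z.
Proof. by case: z => a b; exact: sqrtr_ge0. Qed.

Lemma sqr_normcE z : normc z ^+ 2 = Re z ^+ 2 + Im z ^+ 2.
Proof. by case: z => a b; rewrite /Normc.normc/= sqr_sqrtr// addr_ge0 ?sqr_ge0. Qed.

Lemma normc_conj z : normc z^* = normc z.
Proof. by case: z => a b /=; rewrite sqrrN. Qed.

Lemma cRe_conj z : Re z^* = Re z. Proof. by case: z. Qed.
Lemma cIm_conj z : Im z^* = - Im z. Proof. by case: z. Qed.

Lemma cReD z y : Re (z + y) = Re z + Re y. Proof. by case: z; case: y. Qed.
Lemma cImD z y : Im (z + y) = Im z + Im y. Proof. by case: z; case: y. Qed.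
Lemma cReN z : Re (- z) = - Re z. Proof. by case: z. Qed.
Lemma cImN z : Im (- z) = - Im z. Proof. by case: z. Qed.
Lemma cReM z y : Re (z * y) = Re z * Re y - Im z * Im y.
Proof. by case: z; case: y. Qed.
Lemma cImM z y : Im (z * y) = Re z * Im y + Im z * Re y.
Proof. by case: z; case: y. Qed.

Lemma cRe_sum I (r : seq I) (P : pred I) (F : I -> R[i]) :
  Re (\sum_(i <- r | P i) F i) = \sum_(i <- r | P i) Re (F i).
Proof. by elim/big_rec2 : _ => //= i x y _ <-; rewrite cReD. Qed.

Lemma complex_ext z y : Re z = Re y -> Im z = Im y -> z = y.
Proof. by case: z; case: y => ? ? ? ? /= -> ->. Qed.

Lemma normrRe_le z : `|Re z| <= normc z.
Proof.
rewrite -(ler_pXn2r (ltn0Sn 1)) ?nnegrE ?normc_ge0//.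
by rewrite sqr_normcE -normrX ger0_norm ?sqr_ge0// lerDl sqr_ge0.
Qed.

Lemma normrIm_le z : `|Im z| <= normc z.
Proof.
rewrite -(ler_pXn2r (ltn0Sn 1)) ?nnegrE ?normc_ge0//.
by rewrite sqr_normcE -normrX ger0_norm ?sqr_ge0// lerDr sqr_ge0.
Qed.

Lemma normcD_le z y : normc (z + y) <= normc z + normc y.
Proof. exact: (@le_normcD R z y). Qed.

Lemma normc_opp z : normc (- z) = normc z.
Proof. exact: (@normcN R z). Qed.

Lemma normcBC z y : normc (z - y) = normc (y - z).
Proof. by rewrite -normc_opp opprB. Qed.

Lemma normc_real (a : R) : normc a%:C = `|a|.
Proof. by rewrite /Normc.normc/= expr0n addr0 sqrtr_sqr. Qed.

Lemma mulcJ z : z * z^* = (normc z ^+ 2)%:C.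
Proof.
by apply: complex_ext; rewrite ?cReM ?cImM ?cRe_conj ?cIm_conj /= ?sqr_normcE; ring.
Qed.

Lemma normc_le_ReIm z : normc z <= `|Re z| + `|Im z|.
Proof.
rewrite -(ler_pXn2r (ltn0Sn 1)) ?nnegrE ?normc_ge0 ?addr_ge0//.
by rewrite sqr_normcE sqrrD !real_normK ?num_real// lerD2r lerDl mulrn_wge0 ?mulr_ge0.
Qed.

Lemma conjC_realC (a : R) : (a%:C)^* = a%:C :> R[i].
Proof. by apply: complex_ext; rewrite ?cRe_conj ?cIm_conj//= oppr0. Qed.

Lemma cconjM z y : (z * y)^* = z^* * y^*.
Proof. exact: rmorphM. Qed.

End complex_modulus.

(** * Real limits along filters and ultrafilters on the indices *)

Section filter_convergence.
Context {R : realType}.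

Lemma cvg0_le (F : set_system nat) {FF : Filter F} (a b : nat -> R) :
  (\forall n \near F, 0 <= a n <= b n) ->
  b n @[n --> F] --> 0 -> a n @[n --> F] --> 0.
Proof. by move=> ab; apply: (squeeze_cvgr ab); exact: cvg_cst. Qed.

Lemma cvg0_norm (F : set_system nat) {FF : Filter F} (a : nat -> R) :
  `|a n| @[n --> F] --> 0 <-> a n @[n --> F] --> 0.
Proof.
by split=> /cvgrPdist_lt h; apply/cvgrPdist_lt => e /h;
  apply: filterS => n; rewrite !sub0r !normrN ?normr_id.
Qed.

Lemma cvg0P (F : set_system nat) {FF : Filter F} (a : nat -> R) :
  (forall n, 0 <= a n) ->
  a n @[n --> F] --> 0 <->
  forall e, 0 < e -> \forall n \near F, a n <= e.
Proof.
move=> a0; split.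
  move=> /cvgrPdist_le h e /h; apply: filterS => n.
  by rewrite sub0r normrN ger0_norm.
move=> h; apply/cvgrPdist_le => e /h; apply: filterS => n.
by rewrite sub0r normrN ger0_norm.
Qed.

(** Compactness of [-M, M], applied to the image of [U] under [a], which is again an ultrafilter;
    this replaces the extraction of a convergent subsequence. *)
Lemma ultra_bounded_cvg (U : set_system nat) {UF : UltraFilter U}
    (a : nat -> R) (M : R) :
  (\forall n \near U, `|a n| <= M) -> exists l : R, a n @[n --> U] --> l.
Proof.
move=> aM.
have := @segment_compact R (- M) M; rewrite compact_ultra => cpt.
pose G : set_system R := [set A | U (a @^-1` A)].
have GU : UltraFilter G.
  split; first exact: (fmap_proper_filter a (ultra_proper (F:=U))).
  move=> H HP GH; rewrite eqEsubset; split=> // A HA.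
  have [//|UnA] := in_ultra_setVsetC (a @^-1` A) UF.
  have : H (A `&` ~` A) by apply: filterI => //; exact: GH.
  by move/filter_ex => [? []].
have [|l [_ Gl]] := cpt G GU; last by exists l.
by apply: (filterS _ aM) => n /=; rewrite in_itv/= ler_norml.
Qed.

(** If convergence failed by e, the set [B] of indices staying e away from l would meet every
    neighbourhood of infinity; the traces on [B] then generate a proper filter, and an ultrafilter
    refining it contradicts the hypothesis. *)
Lemma cvg_of_ultra (a : nat -> R) (l : R) :
  (forall U, UltraFilter U -> \oo `<=` U -> a n @[n --> U] --> l) ->
  a n @[n --> \oo] --> l.
Proof.
move=> h; apply/cvgrPdist_lt => e e0; apply: contrapT => hn.
pose B := [set n | e <= `|l - a n|].
pose G := filter_from (@nbhs nat (set_system nat) \oo) (fun A => A `&` B).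
have PG : ProperFilter G.
  apply: filter_from_proper.
    apply: filter_from_filter; first by exists setT; exact: filterT.
    move=> A A' hA hA'; exists (A `&` A'); first exact: filterI.
    by move=> n [[? ?] ?].
  move=> A hA; apply: contrapT => hAB; apply: hn.
  apply: filterS hA => n An; rewrite ltNge; apply/negP => eB.
  by apply: hAB; exists n.
have [U [UU GU]] := ultraFilterLemma PG.
have ooU : \oo `<=` U.
  by move=> A hA; apply: GU; exists A => //; exact: subIsetl.
have UB : U B by apply: GU; exists setT; [exact: filterT|exact: subIsetr].
have /cvgrPdist_lt/(_ e e0) hU := h U UU ooU.
have : U (B `&` [set n | `|l - a n| < e]) by exact: filterI.
by move=> /filter_ex [n []]; rewrite /B/= leNgt => /negP.
Qed.

End filter_convergence.

(** * Complex limits along filters *)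

Section complex_convergence.
Context {R : realType}.
Implicit Types (F : set_system nat) (z y : nat -> R[i]).

(** Stated through the modulus, so that every limit is a limit of real numbers. *)
Definition cvgc F z l := normc (z n - l) @[n --> F] --> (0 : R).

Lemma cvgc_cst F {FF : Filter F} l : cvgc F (fun=> l) l.
Proof. by rewrite /cvgc subrr Normc.normc0; exact: cvg_cst. Qed.

Lemma cvgcD F {FF : Filter F} z y l m :
  cvgc F z l -> cvgc F y m -> cvgc F (fun n => z n + y n) (l + m).
Proof.
move=> zl ym; apply: (@cvg0_le _ _ _ _ (fun n => normc (z n - l) + normc (y n - m))).
  apply: nearW => n; rewrite normc_ge0/=.
  by apply: le_trans (normcD_le _ _); rewrite opprD addrACA.
by rewrite -(addr0 0); exact: cvgD.
Qed.

Lemma cvgc_ReIm F {FF : Filter F} z l :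
  Re (z n) @[n --> F] --> Re l -> Im (z n) @[n --> F] --> Im l -> cvgc F z l.
Proof.
move=> hr hi; apply: (@cvg0_le _ _ _ _ (fun n => `|Re (z n) - Re l| + `|Im (z n) - Im l|)).
  apply: nearW => n; rewrite normc_ge0/=; apply: le_trans (normc_le_ReIm _) _.
  by rewrite !cReD !cImD !cReN !cImN.
have h (u : nat -> R) v : u n @[n --> F] --> v -> `|u n - v| @[n --> F] --> 0.
  by move=> uv; apply/cvg0_norm; rewrite -(subrr v); apply: cvgB => //; exact: cvg_cst.
by rewrite -(addr0 0); apply: cvgD; exact: h.
Qed.

Lemma cvgc_Re F (FF : Filter F) z l : cvgc F z l -> Re (z n) @[n --> F] --> Re l.
Proof.
move=> /cvgrPdist_le h; apply/cvgrPdist_le => e /h; apply: filterS => n.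
rewrite sub0r normrN ger0_norm ?normc_ge0// normcBC => zn.
by rewrite -cReN -cReD; exact: le_trans (normrRe_le _) zn.
Qed.

Lemma cvgc_Im F (FF : Filter F) z l : cvgc F z l -> Im (z n) @[n --> F] --> Im l.
Proof.
move=> /cvgrPdist_le h; apply/cvgrPdist_le => e /h; apply: filterS => n.
rewrite sub0r normrN ger0_norm ?normc_ge0// normcBC => zn.
by rewrite -cImN -cImD; exact: le_trans (normrIm_le _) zn.
Qed.

Lemma cvgcM F {FF : Filter F} z y l m :
  cvgc F z l -> cvgc F y m -> cvgc F (fun n => z n * y n) (l * m).
Proof.
move=> zl ym.
have [zr zi] := (cvgc_Re FF zl, cvgc_Im FF zl).
have [yr yi] := (cvgc_Re FF ym, cvgc_Im FF ym).
apply: cvgc_ReIm.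
  by rewrite cReM; under eq_fun do rewrite cReM; exact: (cvgB (cvgM zr yr) (cvgM zi yi)).
by rewrite cImM; under eq_fun do rewrite cImM; exact: (cvgD (cvgM zr yi) (cvgM zi yr)).
Qed.

Lemma cvgc_real F {FF : Filter F} (a : nat -> R) (l : R) :
  a n @[n --> F] --> l -> cvgc F (fun n => (a n)%:C) l%:C.
Proof. by move=> al; apply: cvgc_ReIm => //=; exact: cvg_cst. Qed.

Lemma cvgc_uniq F {FF : ProperFilter F} z l m : cvgc F z l -> cvgc F z m -> l = m.
Proof.
move=> zl zm; apply: complex_ext.
- exact: cvg_unique (cvgc_Re _ zl) (cvgc_Re _ zm).
- exact: cvg_unique (cvgc_Im _ zl) (cvgc_Im _ zm).
Qed.

Lemma ultra_bounded_cvgc U {UF : UltraFilter U} z (M : R) :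
  (\forall n \near U, normc (z n) <= M) -> exists l, cvgc U z l.
Proof.
move=> zM.
have [a ha] : exists a : R, Re (z n) @[n --> U] --> a.
  by apply: (@ultra_bounded_cvg _ _ _ _ M); apply: filterS zM => n;
    apply: le_trans; exact: normrRe_le.
have [b hb] : exists b : R, Im (z n) @[n --> U] --> b.
  by apply: (@ultra_bounded_cvg _ _ _ _ M); apply: filterS zM => n;
    apply: le_trans; exact: normrIm_le.
by exists (a +i* b); exact: cvgc_ReIm.
Qed.

End complex_convergence.

(* Only semidefinite: vectors of L^2(X) are functions, so a.e. equality is
   [nrm (x - y) = 0] rather than [x = y]. *)
Record semi_inner (R : realType) (V : lmodType R[i]) := SemiInner {
  dot :> V -> V -> R[i];
  dotDl : forall x y z, dot (x + y) z = dot x z + dot y z;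
  dotZl : forall a x y, dot (a *: x) y = a * dot x y;
  dotC : forall x y, dot y x = (dot x y)^*;
  dot_ge0 : forall x, 0 <= Re (dot x x) }.

(** * Geometry of a semidefinite inner product: Cauchy-Schwarz, Pythagoras, Bessel *)

Section semi_inner_product.
Context {R : realType} {V : lmodType R[i]} (D : semi_inner V).
Implicit Types (x y z : V) (a : R[i]).

Definition nrm x : R := Num.sqrt (Re (D x x)).

Lemma dotDr x y z : D x (y + z) = D x y + D x z.
Proof. by rewrite [LHS]dotC dotDl rmorphD [D x y]dotC [D x z]dotC. Qed.

Lemma dotZr a x y : D x (a *: y) = a^* * D x y.
Proof. by rewrite [LHS]dotC dotZl rmorphM [D x y]dotC. Qed.

Lemma dot0l x : D 0 x = 0.
Proof. by rewrite -(scale0r x) dotZl mul0r. Qed.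

Lemma dot0r x : D x 0 = 0.
Proof. by rewrite dotC dot0l rmorph0. Qed.

Lemma dotNl x y : D (- x) y = - D x y.
Proof. by rewrite -scaleN1r dotZl mulN1r. Qed.

Lemma dotNr x y : D x (- y) = - D x y.
Proof. by rewrite [LHS]dotC dotNl rmorphN [D x y]dotC. Qed.

Lemma dotBl x y z : D (x - y) z = D x z - D y z.
Proof. by rewrite dotDl dotNl. Qed.

Lemma dotBr x y z : D x (y - z) = D x y - D x z.
Proof. by rewrite dotDr dotNr. Qed.

Lemma dot_suml I (s : seq I) (P : pred I) (F : I -> V) y :
  D (\sum_(i <- s | P i) F i) y = \sum_(i <- s | P i) D (F i) y.
Proof.
by elim/big_rec2 : _ => [|i u v _ <-]; rewrite ?dot0l ?dotDl.
Qed.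

Lemma dot_sumr I (s : seq I) (P : pred I) (F : I -> V) y :
  D y (\sum_(i <- s | P i) F i) = \sum_(i <- s | P i) D y (F i).
Proof.
by elim/big_rec2 : _ => [|i u v _ <-]; rewrite ?dot0r ?dotDr.
Qed.

Lemma nrm_ge0 x : 0 <= nrm x. Proof. exact: sqrtr_ge0. Qed.

Lemma sqr_nrm x : nrm x ^+ 2 = Re (D x x).
Proof. by rewrite sqr_sqrtr// dot_ge0. Qed.

Lemma dotxx x : D x x = (nrm x ^+ 2)%:C.
Proof.
apply: complex_ext => /=; first by rewrite sqr_nrm.
have : Im (D x x) = - Im (D x x) by rewrite [in LHS]dotC cIm_conj.
lra.
Qed.

Lemma sqr_nrmD x y : nrm (x + y) ^+ 2 = nrm x ^+ 2 + nrm y ^+ 2 + 2 * Re (D x y).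
Proof.
rewrite !sqr_nrm dotDl !dotDr !cReD (dotC D x y) cRe_conj; ring.
Qed.

Lemma nrmZ a x : nrm (a *: x) = normc a * nrm x.
Proof.
apply/eqP; rewrite -(@eqrXn2 _ 2)// ?mulr_ge0 ?nrm_ge0 ?normc_ge0//.
rewrite exprMn 2!sqr_nrm dotZl dotZr mulrA mulcJ dotxx cReM /=.
by rewrite mul0r subr0.
Qed.

Lemma nrmN x : nrm (- x) = nrm x.
Proof. by rewrite /nrm dotNl dotNr opprK. Qed.

Lemma nrmBC x y : nrm (x - y) = nrm (y - x).
Proof. by rewrite -nrmN opprB. Qed.

Lemma nrm0 : nrm 0 = 0.
Proof. by rewrite /nrm dot0l /= sqrtr0. Qed.

Lemma sqr_nrmB x y : nrm (x - y) ^+ 2 = nrm x ^+ 2 + nrm y ^+ 2 - 2 * Re (D x y).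
Proof. by rewrite sqr_nrmD nrmN dotNr cReN mulrN. Qed.

(** The usual quadratic in a real t, the squared norm of x - t <x, y> y. As the form is only
    semidefinite, [nrm y = 0] does not force y = 0, and this case needs its own value of t. *)
Lemma cauchy_schwarz x y : normc (D x y) <= nrm x * nrm y.
Proof.
have [/eqP ->|n0] := boolP (normc (D x y) == 0).
  by rewrite mulr_ge0 ?nrm_ge0.
rewrite -(ler_pXn2r (ltn0Sn 1)) ?nnegrE ?mulr_ge0 ?nrm_ge0 ?normc_ge0// exprMn.
set c := normc (D x y) in n0 *.
have c0 : 0 < c by rewrite lt_neqAle eq_sym n0 normc_ge0.
have key t : 0 <= nrm x ^+ 2 - 2 * t * c ^+ 2 + t ^+ 2 * c ^+ 2 * nrm y ^+ 2.
  have := sqr_ge0 (nrm (x - (t%:C * D x y) *: y)).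
  rewrite sqr_nrmB nrmZ Normc.normcM normc_real dotZr cconjM conjC_realC.
  rewrite -[X in Re X]mulrA [(D x y)^* * _]mulrC mulcJ cReM /= -/c mul0r subr0.
  by rewrite !exprMn real_normK ?num_real// => h; apply: le_trans h _; lra.
have [y0|y0] := eqVneq (nrm y) 0.
  (* The quadratic is affine in t here, and this t gives it the value -1. *)
  have := key ((nrm x ^+ 2 + 1) / (2 * c ^+ 2)).
  rewrite y0 expr0n /= !mulr0 addr0.
  have -> : 2 * ((nrm x ^+ 2 + 1) / (2 * c ^+ 2)) * c ^+ 2 = nrm x ^+ 2 + 1.
    by field.
  lra.
have yp : 0 < nrm y ^+ 2 by rewrite exprn_gt0// lt_neqAle eq_sym y0 nrm_ge0.
(* The minimiser in t. *)
have := key (nrm y ^- 2).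
have -> : nrm x ^+ 2 - 2 * nrm y ^- 2 * c ^+ 2 + nrm y ^- 2 ^+ 2 * c ^+ 2 * nrm y ^+ 2
  = nrm x ^+ 2 - c ^+ 2 / nrm y ^+ 2 by field.
by rewrite subr_ge0 ler_pdivrMr.
Qed.

Lemma Re_dot_le x y : Re (D x y) <= nrm x * nrm y.
Proof.
by apply: le_trans (cauchy_schwarz x y); apply: le_trans (normrRe_le _); exact: ler_norm.
Qed.

Lemma nrmD x y : nrm (x + y) <= nrm x + nrm y.
Proof.
rewrite -(ler_pXn2r (ltn0Sn 1)) ?nnegrE ?addr_ge0 ?nrm_ge0//.
rewrite sqr_nrmD sqrrD; have := Re_dot_le x y; lra.
Qed.

Lemma nrmB x y z : nrm (x - z) <= nrm (x - y) + nrm (y - z).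
Proof. by apply: le_trans (nrmD _ _); rewrite addrA subrK. Qed.

Lemma nrm_le_dist x y : nrm x <= nrm y + nrm (x - y).
Proof. by have := nrmD y (x - y); rewrite addrC subrK. Qed.

Lemma nrm_dist x y : `|nrm x - nrm y| <= nrm (x - y).
Proof.
rewrite ler_norml; apply/andP; split.
- by have := nrm_le_dist y x; rewrite nrmBC; lra.
- by have := nrm_le_dist x y; lra.
Qed.

(** Null vectors are orthogonal to everything by Cauchy-Schwarz, so the form does not distinguish
    vectors at distance 0. *)
Lemma dot_nrm0l x y : nrm x = 0 -> D x y = 0.
Proof.
move=> x0; apply: Normc.eq0_normc; apply/eqP; rewrite eq_le normc_ge0 andbT.
by apply: le_trans (cauchy_schwarz _ _) _; rewrite x0 mul0r.
Qed.

Lemma dot_nrm0r x y : nrm y = 0 -> D x y = 0.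
Proof. by move=> y0; rewrite dotC dot_nrm0l// rmorph0. Qed.

(* The vectors x_j behave like the projections of f onto pairwise orthogonal
   subspaces. *)
Lemma sqr_nrm_sub_orthogonal_sum (I : eqType) (s : seq I) (x : I -> V) f :
  uniq s ->
  {in s &, forall i j, i != j -> D (x i) (x j) = 0} ->
  {in s, forall i, D f (x i) = D (x i) (x i)} ->
  nrm (f - \sum_(i <- s) x i) ^+ 2 = nrm f ^+ 2 - \sum_(i <- s) nrm (x i) ^+ 2.
Proof.
elim: s => [|i s IH]; first by rewrite !big_nil !subr0.
move=> /= /andP[is_ us] orth fx.
rewrite !big_cons opprD addrCA addrC sqr_nrmB IH//; last 2 first.
- by move=> j k js ks; apply: orth; rewrite inE ?js ?ks orbT.
- by move=> j js; apply: fx; rewrite inE js orbT.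
have si0 : D (\sum_(j <- s) x j) (x i) = 0.
  rewrite dot_suml big_seq_cond big1// => j /andP[js _].
  rewrite orth ?inE ?js ?eqxx ?orbT//.
  by apply: contraNneq is_ => <-.
rewrite dotBl si0 subr0 fx ?inE ?eqxx// dotxx /=; ring.
Qed.

Definition orthonormal_on (I : eqType) (s : seq I) (phi : I -> V) :=
  {in s &, forall i j, D (phi i) (phi j) = (i == j)%:R}.

Section orthonormal_family.
Context (I : eqType) (s : seq I) (phi : I -> V).
Hypotheses (us : uniq s) (on : orthonormal_on s phi).

Lemma dot_lincomb (c : I -> R[i]) i : i \in s ->
  D (\sum_(j <- s) c j *: phi j) (phi i) = c i.
Proof.
move=> is_; rewrite dot_suml (bigD1_seq i)//= dotZl on// eqxx mulr1.
rewrite big_seq_cond big1 ?addr0// => j /andP[js /negPf ji].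
by rewrite dotZl on// ji mulr0.
Qed.

Lemma sqr_nrm_sub_proj x :
  nrm (x - \sum_(i <- s) D x (phi i) *: phi i) ^+ 2 =
  nrm x ^+ 2 - \sum_(i <- s) normc (D x (phi i)) ^+ 2.
Proof.
rewrite sqr_nrm_sub_orthogonal_sum//.
- congr (_ - _); apply: eq_big_seq => i is_.
  by rewrite nrmZ exprMn [nrm _ ^+ 2]sqr_nrm on// eqxx /= mulr1.
- by move=> i j is_ js /negPf ij; rewrite dotZl dotZr on// ij !mulr0.
- by move=> i is_; rewrite dotZr dotZl dotZr on// eqxx mulr1 mulrC.
Qed.

Lemma bessel x : \sum_(i <- s) normc (D x (phi i)) ^+ 2 <= nrm x ^+ 2.
Proof. by rewrite -subr_ge0 -sqr_nrm_sub_proj sqr_ge0. Qed.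

Lemma sqr_nrm_lincomb (c : I -> R[i]) :
  nrm (\sum_(i <- s) c i *: phi i) ^+ 2 = \sum_(i <- s) normc (c i) ^+ 2.
Proof.
rewrite sqr_nrm dot_sumr cRe_sum; apply: eq_big_seq => i is_.
by rewrite dotZr dot_lincomb// mulrC mulcJ.
Qed.

Lemma dot_sub_proj x i : i \in s ->
  D (x - \sum_(j <- s) D x (phi j) *: phi j) (phi i) = 0.
Proof. by move=> is_; rewrite dotBl dot_lincomb// subrr. Qed.

Lemma nrm_orthonormal i : i \in s -> nrm (phi i) = 1.
Proof. by move=> is_; rewrite /nrm on// eqxx /= sqrtr1. Qed.

End orthonormal_family.

End semi_inner_product.

(** * Limits of vectors and completeness *)

Section vector_limits.
Context {R : realType} {V : lmodType R[i]} (D : semi_inner V).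
Implicit Types (F : set_system nat) (x y : nat -> V) (u v : V).

Definition cvgv F x u := nrm D (x n - u) @[n --> F] --> 0.

(* Rapidly Cauchy sequences suffice: the limit along an ultrafilter is built
   from approximations at scale 2 ^- k. *)
Definition sip_complete :=
  forall x, (forall k m, (k <= m)%N -> nrm D (x k - x m) <= 2 ^- k) ->
    exists u, cvgv \oo x u.

Lemma eq_cvgv F x y u : x =1 y -> cvgv F x u -> cvgv F y u.
Proof. by move=> /funext ->. Qed.

Lemma cvgv_cst F {FF : Filter F} u : cvgv F (fun=> u) u.
Proof. by rewrite /cvgv subrr nrm0; exact: cvg_cst. Qed.

Lemma cvgvD F {FF : Filter F} x y u v :
  cvgv F x u -> cvgv F y v -> cvgv F (fun n => x n + y n) (u + v).
Proof.
move=> xu yv; apply: (@cvg0_le _ _ _ _ (fun n => nrm D (x n - u) + nrm D (y n - v))).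
  apply: nearW => n; rewrite nrm_ge0/=.
  by apply: le_trans (nrmD _ _ _); rewrite opprD addrACA.
by rewrite -(addr0 0); exact: cvgD.
Qed.

Lemma cvgv_nrm F {FF : Filter F} x u :
  cvgv F x u -> nrm D (x n) @[n --> F] --> nrm D u.
Proof.
move=> /cvgrPdist_le h; apply/cvgrPdist_le => e /h; apply: filterS => n.
rewrite sub0r normrN ger0_norm ?nrm_ge0// nrmBC => xn.
exact: le_trans (nrm_dist _ _ _) xn.
Qed.

Lemma cvgv_dot F {FF : Filter F} x y u v :
  cvgv F x u -> cvgv F y v -> cvgc F (fun n => D (x n) (y n)) (D u v).
Proof.
move=> xu yv.
apply: (@cvg0_le _ _ _ _ (fun n =>
  nrm D (x n - u) * nrm D (y n) + nrm D u * nrm D (y n - v))).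
  apply: nearW => n; rewrite normc_ge0/=.
  have -> : D (x n) (y n) - D u v = D (x n - u) (y n) + D u (y n - v).
    by rewrite dotBl dotBr addrA subrK.
  by apply: le_trans (normcD_le _ _) _; apply: lerD; exact: cauchy_schwarz.
have -> : (0 : R) = 0 * nrm D v + nrm D u * 0 by rewrite mul0r mulr0 addr0.
apply: cvgD; apply: cvgM => //; first exact: cvgv_nrm.
exact: cvg_cst.
Qed.

Lemma cvgvZ F {FF : Filter F} (a : nat -> R[i]) l x u :
  cvgc F a l -> cvgv F x u -> cvgv F (fun n => a n *: x n) (l *: u).
Proof.
move=> al xu.
apply: (@cvg0_le _ _ _ _ (fun n =>
  normc (a n - l) * nrm D (x n) + normc l * nrm D (x n - u))).
  apply: nearW => n; rewrite nrm_ge0/=.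
  have -> : a n *: x n - l *: u = (a n - l) *: x n + l *: (x n - u).
    by rewrite scalerBl scalerBr addrA subrK.
  by apply: le_trans (nrmD _ _ _) _; rewrite !nrmZ.
have -> : (0 : R) = 0 * nrm D u + normc l * 0 by rewrite mul0r mulr0 addr0.
apply: cvgD; apply: cvgM => //; first exact: cvgv_nrm.
exact: cvg_cst.
Qed.

Lemma cvgv_sum F {FF : Filter F} I (s : seq I) (x : I -> nat -> V) (u : I -> V) :
  (forall i, cvgv F (x i) (u i)) ->
  cvgv F (fun n => \sum_(i <- s) x i n) (\sum_(i <- s) u i).
Proof.
move=> xu; elim: s => [|i s IH].
  by rewrite big_nil; apply: eq_cvgv (cvgv_cst 0) => n; rewrite big_nil.
by rewrite big_cons; apply: eq_cvgv (cvgvD (xu i) IH) => n; rewrite big_cons.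
Qed.

Lemma cvgv_uniq F {FF : ProperFilter F} x u v :
  cvgv F x u -> cvgv F x v -> nrm D (u - v) = 0.
Proof.
move=> xu xv; have : cvgv F (fun=> u - v) 0.
  apply: (@cvg0_le _ _ _ _ (fun n => nrm D (x n - u) + nrm D (x n - v))).
    apply: nearW => n; rewrite nrm_ge0/= subr0.
    by apply: le_trans (nrmB _ _ (x n) _) _; rewrite nrmBC.
  by rewrite -(addr0 0); exact: cvgD.
by rewrite /cvgv subr0 => h; apply: cvg_unique (cvg_cst _) h.
Qed.

Lemma cvgv_nrm0 F {FF : Filter F} x y u :
  nrm D (y n - x n) @[n --> F] --> 0 -> cvgv F x u -> cvgv F y u.
Proof.
move=> yx xu.
apply: (@cvg0_le _ _ _ _ (fun n => nrm D (y n - x n) + nrm D (x n - u))).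
  by apply: nearW => n; rewrite nrm_ge0/= nrmB.
by rewrite -(addr0 0); exact: cvgD.
Qed.

Lemma cvgvP F {FF : Filter F} x u :
  cvgv F x u <-> forall e, 0 < e -> \forall n \near F, nrm D (x n - u) <= e.
Proof. by apply: cvg0P => n; exact: nrm_ge0. Qed.

Lemma exists_expN2_lt (e : R) : 0 < e -> exists k, 2 ^- k < e.
Proof.
move=> e0; have := near_infty_natSinv_expn_lt (PosNum e0).
by move=> /filter_ex [k]; rewrite div1r => h; exists k.
Qed.

(** The hypothesis is total boundedness as seen by [U]: at every scale a single vector is close to
    [x n] for almost all n. Two such vectors are compared through a common [x n], so the
    approximations at scale 2 ^- k / 4 form a rapidly Cauchy sequence. *)
Lemma ultra_complete U {UU : UltraFilter U} x : sip_complete ->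
  (forall e, 0 < e -> exists u, \forall n \near U, nrm D (x n - u) <= e) ->
  exists u, cvgv U x u.
Proof.
move=> complete h.
have e4 k : 0 < 2 ^- k / 4 :> R by rewrite divr_gt0 ?invr_gt0 ?exprn_gt0.
have /choice [y hy] : forall k, exists u, \forall n \near U, nrm D (x n - u) <= 2 ^- k / 4.
  by move=> k; exact: h.
have yC k m : (k <= m)%N -> nrm D (y k - y m) <= 2 ^- k.
  move=> km; have [n [nk nm]] := filter_ex (filterI (hy k) (hy m)).
  apply: le_trans (nrmB _ _ (x n) _) _; rewrite nrmBC.
  have : 2 ^- m <= 2 ^- k :> R by rewrite lef_pV2 ?posrE ?exprn_gt0// ler_weXn2l ?ler1n.
  have := e4 k; lra.
have [u yu] := complete y yC.
have yk k : nrm D (y k - u) <= 2 ^- k.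
  apply/ler_addgt0Pr => e e0.
  have /cvgvP/(_ e e0) hyu := yu.
  have [m [km ym]] := filter_ex (filterI (nbhs_infty_ge k) hyu).
  by apply: le_trans (nrmB _ _ (y m) _) _; apply: lerD => //; exact: yC.
exists u; apply/cvgvP => e e0.
have [k ke] := exists_expN2_lt (divr_gt0 e0 (ltr0n _ 2)).
apply: filterS (hy k) => n nk; apply: le_trans (nrmB _ _ (y k) _) _.
have := yk k; have := e4 k; lra.
Qed.

End vector_limits.

(** * Finite exhaustion of the nonzero integers *)

(** [Negz m] is -(m + 1), so the two halves are 1, ..., k and -1, ..., -k. *)
Definition int_ball (k : nat) : seq int :=
  map Posz (iota 1 k) ++ map Negz (iota 0 k).

Lemma mem_int_ball k (i : int) : (i \in int_ball k) = (i != 0) && (absz i <= k)%N.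
Proof.
rewrite mem_cat; case: i => m.
  rewrite mem_map ?mem_iota; last by move=> ? ? [].
  rewrite [X in _ || X](_ : _ = false) ?orbF; last by apply/mapP => -[].
  by rewrite add1n ltnS; case: m.
rewrite [X in X || _](_ : _ = false) ?orFb; last by apply/mapP => -[].
by rewrite mem_map ?mem_iota//; move=> ? ? [].
Qed.

Lemma int_ball_uniq k : uniq (int_ball k).
Proof.
rewrite cat_uniq !map_inj_uniq ?iota_uniq/=; try by move=> ? ? [].
by rewrite andbT; apply/hasPn => _ /mapP[m _ ->]; apply/mapP => -[].
Qed.

(** * Limits, along an ultrafilter, of the eigensystems of finite-rank operators *)

Section spectral_limit.
Context {R : realType} {V : lmodType R[i]} (D : semi_inner V).
Context (T : V -> V) (la : nat -> int -> R) (phi : nat -> int -> V)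
  (s : nat -> seq int) (eps : nat -> R).

Definition finite_rank n x :=
  \sum_(i <- s n) ((la n i)%:C * D x (phi n i)) *: phi n i.

(** All that the spectral argument knows about graphs and graphon: operators given in diagonal form
    approximate [T] in operator norm, and [sa_bound] controls their eigenvalues uniformly in n. That
    [T] is self-adjoint and a contraction is derived from the approximation. *)
Record spectral_approx : Prop := SpectralApprox {
  sa_linear : linear T;
  sa_uniq : forall n, uniq (s n);
  sa_mem : forall n i, (i \in s n) = (i != 0) && (la n i != 0);
  sa_orthonormal : forall n, orthonormal_on D (s n) (phi n);
  sa_order : forall n, signed_order (la n);
  sa_bound : forall n (i : int), i != 0 -> la n i ^+ 2 * (absz i)%:R <= 1;
  sa_approx : forall n x, nrm D (T x - finite_rank n x) <= eps n * nrm D x;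
  sa_eps : eps n @[n --> \oo] --> 0 }.

(** An orthonormal eigensystem of [T] attached to [U]. The vector [psi i] carries information only
    where [l i != 0]; [sl_complete] is the spectral theorem for [T], since what is orthogonal to the
    system lies in the kernel. *)
Record spectral_limit (U : set_system nat) (l : int -> R) (psi : int -> V) : Prop :=
  SpectralLimit {
  sl_val : forall i, i != 0 -> la n i @[n --> U] --> l i;
  sl_vec : forall i, i != 0 -> l i != 0 -> cvgv D U (phi ^~ i) (psi i);
  sl_eigen : forall i, i != 0 -> l i != 0 ->
    nrm D (T (psi i) - (l i)%:C *: psi i) = 0;
  sl_orthonormal : forall i j, i != 0 -> l i != 0 -> j != 0 -> l j != 0 ->
    D (psi i) (psi j) = (i == j)%:R;
  sl_complete : forall h, (forall i, i != 0 -> l i != 0 -> D h (psi i) = 0) ->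
    nrm D (T h) = 0;
  sl_order : signed_order l;
  sl_bound : forall (i : int), i != 0 -> l i ^+ 2 * (absz i)%:R <= 1 }.

Hypothesis A : spectral_approx.

Lemma sa_sub x y : T (x - y) = T x - T y.
Proof. by rewrite addrC -scaleN1r (sa_linear A) scaleN1r addrC. Qed.

Lemma sa_scale a x : T (a *: x) = a *: T x.
Proof.
have T0 : T 0 = 0 by have := sa_sub 0 0; rewrite subrr subrr.
by rewrite -(addr0 (a *: x)) (sa_linear A) T0 addr0.
Qed.

Lemma sa_val_le1 n i : i != 0 -> `|la n i| <= 1.
Proof.
move=> i0; rewrite -(ler_pXn2r (ltn0Sn 1)) ?nnegrE// expr1n.
rewrite real_normK ?num_real//; apply: le_trans (sa_bound A n i0).
by rewrite ler_peMr ?sqr_ge0// ler1n absz_gt0.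
Qed.

Lemma sqr_nrm_finite_rank n x : nrm D (finite_rank n x) ^+ 2 =
  \sum_(i <- s n) la n i ^+ 2 * normc (D x (phi n i)) ^+ 2.
Proof.
rewrite /finite_rank (sqr_nrm_lincomb (sa_uniq A n) (@sa_orthonormal A n)).
by apply: eq_bigr => i _; rewrite Normc.normcM normc_real exprMn real_normK ?num_real.
Qed.

Lemma nrm_finite_rank_le n x : nrm D (finite_rank n x) <= nrm D x.
Proof.
rewrite -(ler_pXn2r (ltn0Sn 1)) ?nnegrE ?nrm_ge0// sqr_nrm_finite_rank.
apply: le_trans (bessel (sa_uniq A n) (@sa_orthonormal A n) x).
rewrite big_seq_cond [leRHS]big_seq_cond; apply: ler_sum => i /andP[+ _].
rewrite (sa_mem A) => /andP[i0 _]; rewrite ler_piMl ?sqr_ge0//.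
by rewrite -real_normK ?num_real// expr_le1// sa_val_le1.
Qed.

Lemma finite_rank_selfadjoint n x y :
  D (finite_rank n x) y = D x (finite_rank n y).
Proof.
rewrite dot_suml dot_sumr; apply: eq_bigr => i _.
rewrite dotZl dotZr cconjM conjC_realC -(dotC D y) mulrAC; ring.
Qed.

Lemma cvgv_finite_rank x : cvgv D \oo (finite_rank ^~ x) (T x).
Proof.
apply: (@cvg0_le _ _ _ _ (fun n => eps n * nrm D x)).
  by apply: nearW => n; rewrite nrm_ge0/= nrmBC; exact: sa_approx.
by rewrite -(mul0r (nrm D x)); apply: cvgM; [exact: sa_eps|exact: cvg_cst].
Qed.

(** Both sides are limits of the corresponding expressions for the finite-rank operators, where
    symmetry is visible from the real eigenvalues. *)
Lemma sa_selfadjoint x y : D (T x) y = D x (T y).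
Proof.
have h1 : cvgc \oo (fun n => D (finite_rank n x) y) (D (T x) y).
  by apply: cvgv_dot; [exact: cvgv_finite_rank|exact: cvgv_cst].
have h2 : cvgc \oo (fun n => D x (finite_rank n y)) (D x (T y)).
  by apply: cvgv_dot; [exact: cvgv_cst|exact: cvgv_finite_rank].
apply: cvgc_uniq h1 _; apply: cvg_trans h2; apply: near_eq_cvg.
by apply: nearW => n; rewrite finite_rank_selfadjoint.
Qed.

Lemma sa_nrm_le x : nrm D (T x) <= nrm D x.
Proof.
have h : nrm D (finite_rank n x) @[n --> \oo] --> nrm D (T x).
  by apply: cvgv_nrm; exact: cvgv_finite_rank.
apply: (ler_cvg_to h (cvg_cst (nrm D x))).
by apply: nearW => n; exact: nrm_finite_rank_le.
Qed.

Lemma sa_continuous (F : set_system nat) {FF : Filter F} x u :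
  cvgv D F x u -> cvgv D F (T \o x) (T u).
Proof.
move=> xu; apply: (cvg0_le _ xu); apply: nearW => n.
by rewrite nrm_ge0/= -sa_sub sa_nrm_le.
Qed.

Section along_ultrafilter.
Context (U : set_system nat) {UU : UltraFilter U} (ooU : \oo `<=` U).
Hypothesis complete : sip_complete D.

(** An operator-norm limit of finite-rank operators is compact. For a fixed m with [eps m] at most e
    / 2, the finitely many coefficients of [x n] are bounded, hence converge along [U], and so does
    [finite_rank m (x n)]; its limit stays within e of [T (x n)]. *)
Lemma sa_compact x : (\forall n \near U, nrm D (x n) <= 1) ->
  exists u, cvgv D U (T \o x) u.
Proof.
move=> x1; apply: ultra_complete => // e e0.
have e2 : 0 < e / 2 by rewrite divr_gt0.
have /cvgrPdist_le/(_ _ e2) he := sa_eps A.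
have [m hm] := filter_ex he.
have /choice [c hc] : forall i, exists c, i \in s m ->
    cvgc U (fun n => D (x n) (phi m i)) c.
  move=> i; case: (boolP (i \in s m)) => im; last by exists 0.
  have [c hc] : exists c, cvgc U (fun n => D (x n) (phi m i)) c.
    apply: (@ultra_bounded_cvgc _ _ _ _ 1); apply: filterS x1 => n xn.
    apply: le_trans (cauchy_schwarz _ _ _) _.
    by rewrite (nrm_orthonormal (@sa_orthonormal A m))// mulr1.
  by exists c.
pose u := \sum_(i <- s m) ((la m i)%:C * (if i \in s m then c i else 0)) *: phi m i.
exists u.
have Su : cvgv D U (fun n => finite_rank m (x n)) u.
  (* [cvgv_sum] asks for convergence at every index, whereas coefficients are controlled only on
     [s m]; the guard replaces the other terms by 0. *)
  have := @cvgv_sum _ _ D U _ _ (s m)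
    (fun i n => if i \in s m then ((la m i)%:C * D (x n) (phi m i)) *: phi m i else 0)
    (fun i => ((la m i)%:C * (if i \in s m then c i else 0)) *: phi m i).
  have -> : (fun n => \sum_(i <- s m)
    (if i \in s m then ((la m i)%:C * D (x n) (phi m i)) *: phi m i else 0)) =
    (fun n => finite_rank m (x n)).
    by apply/funext => n; apply: eq_big_seq => i ->.
  apply=> i; case: ifPn => im; last first.
    by rewrite mulr0 scale0r; exact: cvgv_cst.
  apply: cvgvZ; last exact: cvgv_cst.
  by apply: cvgcM; [exact: cvgc_cst|exact: hc].
have /cvgvP/(_ _ e2) Sue := Su.
apply: filterS (filterI Sue x1) => n [Sn xn] /=.
apply: le_trans (nrmB _ _ (finite_rank m (x n)) _) _.
rewrite (splitr e); apply: lerD => //.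
apply: le_trans (sa_approx A _ _) _.
have em : eps m <= e / 2.
  by move: hm; rewrite sub0r normrN => /(le_trans (ler_norm _)).
(* [sa_approx] puts no sign on [eps m]; a negative value makes the bound at most 0. *)
have [em0|em0] := leP 0 (eps m).
  by apply: le_trans em; rewrite ler_piMr.
by apply: le_trans (ltW e2); rewrite mulr_le0_ge0 ?nrm_ge0// ltW.
Qed.

Lemma sa_near_mem i l : i != 0 -> l != 0 -> la n i @[n --> U] --> l ->
  \forall n \near U, i \in s n.
Proof.
move=> i0 l0 /cvgrPdist_lt/(_ `|l|); rewrite normr_gt0 => /(_ l0).
apply: filterS => n; rewrite (sa_mem A) i0/=; apply: contraTneq => ->.
by rewrite subr0 ltxx.
Qed.

Lemma sa_approx_eigen n i : i \in s n ->
  nrm D (T (phi n i) - (la n i)%:C *: phi n i) <= eps n.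
Proof.
move=> ni; have := sa_approx A n (phi n i).
rewrite (nrm_orthonormal (@sa_orthonormal A n))// mulr1.
suff -> : finite_rank n (phi n i) = (la n i)%:C *: phi n i by [].
rewrite /finite_rank (bigD1_seq i)//= ?(sa_uniq A)// (sa_orthonormal A)// eqxx.
rewrite mulr1 big_seq_cond big1 ?addr0// => j /andP[nj ij].
by rewrite (sa_orthonormal A)// eq_sym (negPf ij) mulr0 scale0r.
Qed.

Lemma sa_cvg_eps : eps n @[n --> U] --> 0.
Proof. by apply: cvg_trans (sa_eps A) => B; exact: ooU. Qed.

Lemma sa_cvg_eigen i l : i != 0 -> l != 0 -> la n i @[n --> U] --> l ->
  nrm D (T (phi n i) - (la n i)%:C *: phi n i) @[n --> U] --> 0.
Proof.
move=> i0 l0 li; apply: (cvg0_le _ sa_cvg_eps).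
apply: filterS (sa_near_mem i0 l0 li) => n ni.
by rewrite nrm_ge0 sa_approx_eigen.
Qed.

(** By compactness [T (phi n i)] converges; it differs from [la n i] times [phi n i] by a vanishing
    error, and dividing by [la n i], whose limit is nonzero, recovers [phi n i]. *)
Lemma sa_cvg_vec i l : i != 0 -> l != 0 -> la n i @[n --> U] --> l ->
  exists u, cvgv D U (phi ^~ i) u.
Proof.
move=> i0 l0 li.
have ni := sa_near_mem i0 l0 li.
have [u hu] : exists u, cvgv D U (T \o phi ^~ i) u.
  apply: sa_compact; apply: filterS ni => n ni.
  by rewrite (nrm_orthonormal (@sa_orthonormal A n)).
exists ((l^-1)%:C *: u).
have lphi : cvgv D U (fun n => (la n i)%:C *: phi n i) u.
  apply: cvgv_nrm0 hu => /=.
  apply: cvg_trans (sa_cvg_eigen i0 l0 li); apply: near_eq_cvg.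
  by apply: nearW => n; rewrite nrmBC.
have lV : cvgv D U (fun n => ((la n i)^-1)%:C *: ((la n i)%:C *: phi n i)) (l^-1%:C *: u).
  by apply: cvgvZ => //; exact: (cvgc_real (cvgV l0 li)).
apply: cvgv_nrm0 lV; apply: (@cvg0_le _ _ _ _ (fun=> 0)); last exact: cvg_cst.
apply: filterS ni => n; rewrite (sa_mem A) => /andP[_ lai].
by rewrite nrm_ge0/= scalerA -rmorphM/= mulVf// rmorph1 scale1r subrr nrm0.
Qed.

(** Completeness is the only clause that is not a direct passage to the limit: for h orthogonal to
    all [psi i], the squared norm of [finite_rank n h] is a sum over eigenvalues whose terms vanish
    one by one and whose tail is small uniformly in n. *)
Lemma spectral_limit_exists : exists l psi, spectral_limit U l psi.
Proof.
have /choice [l hl] : forall i, exists l : R, i != 0 -> la n i @[n --> U] --> l.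
  move=> i; have [->|i0] := eqVneq i 0; first by exists 0.
  have [l hl] : exists l : R, la n i @[n --> U] --> l.
    apply: (@ultra_bounded_cvg _ _ _ _ 1); apply: nearW => n; exact: sa_val_le1.
  by exists l.
have /choice [psi hpsi] : forall i, exists u, i != 0 -> l i != 0 ->
    cvgv D U (phi ^~ i) u.
  move=> i; case: (boolP ((i != 0) && (l i != 0))) => [/andP[i0 l0]|ni].
    by have [u hu] := sa_cvg_vec i0 l0 (hl i i0); exists u.
  by exists 0 => i0 l0; rewrite i0 l0 in ni.
exists l, psi; split => //.
- move=> i i0 l0; have li := hl i i0.
  apply: (@cvgv_uniq _ _ D U _ (T \o phi ^~ i)).
    exact: (sa_continuous (hpsi i i0 l0)).
  apply: cvgv_nrm0 (sa_cvg_eigen i0 l0 li) _.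
  exact: (cvgvZ (cvgc_real li) (hpsi i i0 l0)).
- move=> i j i0 li0 j0 lj0.
  apply: cvgc_uniq (cvgv_dot (hpsi i i0 li0) (hpsi j j0 lj0)) _.
  apply: (@cvg0_le _ _ _ _ (fun=> 0)); last exact: cvg_cst.
  apply: filterS (filterI (sa_near_mem i0 li0 (hl i i0)) (sa_near_mem j0 lj0 (hl j j0))).
  by move=> n [ni nj]; rewrite normc_ge0/= (sa_orthonormal A)// subrr Normc.normc0.
- move=> h hperp.
  have Th : nrm D (finite_rank n h) @[n --> U] --> nrm D (T h).
    apply: cvg_trans (cvgv_nrm (cvgv_finite_rank h)) => B; exact: ooU.
  suff S0 : nrm D (finite_rank n h) ^+ 2 @[n --> U] --> 0.
    have : nrm D (T h) ^+ 2 = 0 by apply: cvg_unique (cvgM Th Th) S0.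
    by move/eqP; rewrite sqrf_eq0 => /eqP.
  apply/cvg0P => [n|e e0]; first exact: sqr_ge0.
  (* The summands of [sqr_nrm_finite_rank], extended by 0 so that the index set no longer depends on
     n. *)
  pose t n i := if i \in s n then la n i ^+ 2 * normc (D h (phi n i)) ^+ 2 else 0.
  have t0 n i : 0 <= t n i by rewrite /t; case: ifP => // _; rewrite mulr_ge0 ?sqr_ge0.
  have tU i : i != 0 -> t n i @[n --> U] --> 0.
    (* A term vanishes either because its eigenvalue tends to 0, or because its eigenvector tends to
       [psi i], which is orthogonal to h. *)
    move=> i0; have [li0|li0] := eqVneq (l i) 0.
      apply: (@cvg0_le _ _ _ _ (fun n => la n i ^+ 2 * nrm D h ^+ 2)).
        apply: nearW => n; rewrite t0 /t; case: ifP => ni; last by rewrite mulr_ge0 ?sqr_ge0.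
        rewrite ler_wpM2l ?sqr_ge0// ler_pXn2r ?nnegrE ?normc_ge0 ?nrm_ge0//.
        apply: le_trans (cauchy_schwarz _ _ _) _.
        by rewrite (nrm_orthonormal (@sa_orthonormal A n))// mulr1.
      rewrite -(mul0r (nrm D h ^+ 2)); apply: cvgM; last exact: cvg_cst.
      by have := hl i i0; rewrite li0 => li; rewrite -(mulr0 0); exact: cvgM.
    apply: (@cvg0_le _ _ _ _ (fun n => normc (D h (phi n i)) ^+ 2)).
      apply: nearW => n; rewrite t0 /t; case: ifP => _; last exact: sqr_ge0.
      by rewrite ler_piMl ?sqr_ge0// -real_normK ?num_real// expr_le1// sa_val_le1.
    have c0 : normc (D h (phi n i)) @[n --> U] --> 0.
      have : cvgc U (fun n => D h (phi n i)) 0.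
        rewrite -(hperp i i0 li0); apply: cvgv_dot; [exact: cvgv_cst|exact: hpsi].
      by apply: cvg_trans; apply: near_eq_cvg; apply: nearW => n; rewrite subr0.
    by rewrite -(mulr0 0); exact: (cvgM c0 c0).
  (* Indices beyond k have squared eigenvalue at most 1 / (k + 1) by [sa_bound], so Bessel's
     inequality bounds their contribution by nrm h ^ 2 / (k + 1); this k makes that at most e /
     2. *)
  pose k := Num.truncn (nrm D h ^+ 2 / (e / 2)).
  have hk : nrm D h ^+ 2 / k.+1%:R <= e / 2.
    rewrite ler_pdivrMr// mulrC -ler_pdivrMr ?divr_gt0//.
    exact/ltW/truncnS_gt.
  have tk : \sum_(i <- int_ball k) t n i @[n --> U] --> 0.
    have : forall i, i \in int_ball k -> i != 0.
      by move=> i; rewrite mem_int_ball => /andP[].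
    elim: (int_ball k) => [_|i r IH ir].
      under eq_fun do rewrite big_nil; exact: cvg_cst.
    have ti := tU i (ir i (mem_head _ _)).
    have tr : \sum_(j <- r) t n j @[n --> U] --> 0.
      by apply: IH => j jr; apply: ir; rewrite inE jr orbT.
    have : (t n i + \sum_(j <- r) t n j) @[n --> U] --> (0 : R).
      by rewrite -[X in _ --> X](addr0 0); exact: (cvgD ti tr).
    by apply: cvg_trans; apply: near_eq_cvg; apply: nearW => n; rewrite big_cons.
  have /cvgrPdist_le/(_ (e / 2)) := tk.
  rewrite divr_gt0// => /(_ isT); apply: filterS => n.
  rewrite sub0r normrN => /(le_trans (ler_norm _)) tn.
  rewrite sqr_nrm_finite_rank (bigID (fun i => absz i <= k)%N)/= (splitr e).
  apply: lerD.
    suff -> : \sum_(i <- s n | (absz i <= k)%N) la n i ^+ 2 * normc (D h (phi n i)) ^+ 2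
      = \sum_(i <- int_ball k) t n i by [].
    transitivity (\sum_(i <- int_ball k | i \in s n)
        la n i ^+ 2 * normc (D h (phi n i)) ^+ 2); last by rewrite big_mkcond.
    rewrite -big_filter -[RHS]big_filter; apply: perm_big.
    apply: uniq_perm; rewrite ?filter_uniq ?int_ball_uniq ?(sa_uniq A)// => i.
    by rewrite !mem_filter mem_int_ball (sa_mem A); case: (i != 0); rewrite /= ?andbF// andbC.
  apply: le_trans hk.
  apply: (@le_trans _ _ (\sum_(i <- s n | ~~ (absz i <= k)%N)
      normc (D h (phi n i)) ^+ 2 / k.+1%:R)).
    rewrite big_seq_cond [leRHS]big_seq_cond; apply: ler_sum => i /andP[+ ik].
    rewrite (sa_mem A) => /andP[i0 _]; rewrite mulrC ler_wpM2l ?sqr_ge0//.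
    rewrite -(ler_pM2r (_ : 0 < k.+1%:R)) ?ltr0n// mulVf ?pnatr_eq0//.
    apply: le_trans (sa_bound A n i0); rewrite ler_wpM2l ?sqr_ge0// ler_nat.
    by rewrite ltnNge.
  rewrite -mulr_suml ler_wpM2r ?invr_ge0 ?ler0n//.
  apply: le_trans (bessel (sa_uniq A n) (@sa_orthonormal A n) h).
  rewrite [leRHS](bigID (fun i => absz i <= k)%N)/= lerDr.
  by apply: sumr_ge0 => i _; exact: sqr_ge0.
- split=> i j i0 ij; have j0 : j != 0 by apply: contraTneq i0 => j0; move: ij; rewrite j0; lia.
    have ni0 : i != 0 by rewrite gt_eqF.
    apply/andP; split.
      apply: (ler_cvg_to (cvg_cst 0) (hl j j0)); apply: nearW => n.
      by have [/(_ i j i0 ij)/andP[]] := sa_order A n.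
    apply: (ler_cvg_to (hl j j0) (hl i ni0)); apply: nearW => n.
    by have [/(_ i j i0 ij)/andP[]] := sa_order A n.
  have ni0 : i != 0 by rewrite lt_eqF.
  apply/andP; split.
    apply: (ler_cvg_to (hl i ni0) (hl j j0)); apply: nearW => n.
    by have [_ /(_ i j i0 ij)/andP[]] := sa_order A n.
  apply: (ler_cvg_to (hl j j0) (cvg_cst 0)); apply: nearW => n.
  by have [_ /(_ i j i0 ij)/andP[]] := sa_order A n.
- move=> i i0.
  have h : la n i ^+ 2 * (absz i)%:R @[n --> U] --> l i ^+ 2 * (absz i)%:R.
    by apply: cvgM; [exact: (cvgM (hl i i0) (hl i i0))|exact: cvg_cst].
  by apply: (ler_cvg_to h (cvg_cst (1 : R))); apply: nearW => n; exact: sa_bound.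
Qed.

End along_ultrafilter.
End spectral_limit.

(** * Convergence of orthogonal decompositions, uniformly over finite sets of components *)

Section uniform_parseval.
Context {R : realType} {V : lmodType R[i]} (D : semi_inner V).
Context (x : nat -> int -> V) (p : int -> V) (fn : nat -> V) (f : V) (P : pred int).
Hypotheses (fnf : cvgv D \oo fn f)
  (xp : forall j, P j -> cvgv D \oo (x ^~ j) (p j))
  (x_orth : forall n i j, P i -> P j -> i != j -> D (x n i) (x n j) = 0)
  (x_proj : forall n j, P j -> D (fn n) (x n j) = D (x n j) (x n j))
  (p_orth : forall i j, P i -> P j -> i != j -> D (p i) (p j) = 0)
  (p_proj : forall j, P j -> D f (p j) = D (p j) (p j)).

(** Bessel's inequality for the components indexed by [F] together with those of [J] outside [F],
    after the part in [F] has been absorbed into the remainder. *)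
Let tail_le (y : int -> V) g (F J : seq int) :
  (forall i j, P i -> P j -> i != j -> D (y i) (y j) = 0) ->
  (forall j, P j -> D g (y j) = D (y j) (y j)) ->
  uniq F -> all P F -> uniq J -> all P J ->
  \sum_(j <- J | j \notin F) nrm D (y j) ^+ 2 <= nrm D (g - \sum_(j <- F) y j) ^+ 2.
Proof.
move=> yo yg uF PF uJ PJ; pose K := F ++ [seq j <- J | j \notin F].
have uK : uniq K.
  rewrite cat_uniq uF filter_uniq// andbT; apply/hasPn => j.
  by rewrite mem_filter => /andP[].
have PK j : j \in K -> P j.
  rewrite mem_cat mem_filter => /orP[jF|/andP[_ jJ]].
  - exact: (allP PF).
  - exact: (allP PJ).
have := sqr_ge0 (nrm D (g - \sum_(j <- K) y j)).
rewrite !sqr_nrm_sub_orthogonal_sum//; last 4 first.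
- by move=> i j iF jF; apply: yo; exact: (allP PF).
- by move=> i iF; apply: yg; exact: (allP PF).
- by move=> i j /PK Pi /PK Pj; exact: yo.
- by move=> i /PK; exact: yg.
by rewrite big_cat/= big_filter; lra.
Qed.

(** The terms with j in [F] converge one by one. The others are bounded by the remainders of [fn n]
    and [f] past [F], and the first remainder converges to the second, which is small. Since [J] is
    arbitrary and n does not depend on it, infinite sums are covered. *)
Lemma uniform_parseval :
  (forall e, 0 < e -> exists F : seq int,
     [/\ uniq F, all P F & nrm D (f - \sum_(j <- F) p j) ^+ 2 <= e]) ->
  forall e, 0 < e -> \forall n \near \oo, forall J : seq int, uniq J -> all P J ->
    \sum_(j <- J) nrm D (x n j - p j) ^+ 2 <= e.
Proof.
move=> small e e0.
(* The terms in [F] cost e / 8; the others cost 2 (2 e / 8) for [x] and 2 (e / 8) for [p], in all 7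
   e / 8. *)
have e8 : 0 < e / 8 by rewrite divr_gt0.
have [F [uF PF fF]] := small _ e8.
have A0 : \sum_(j <- F) nrm D (x n j - p j) ^+ 2 @[n --> \oo] --> 0.
  move: PF; elim: F {uF fF} => [_|j F IH /= /andP[Pj PF]].
    by under eq_fun do rewrite big_nil; exact: cvg_cst.
  have : nrm D (x n j - p j) ^+ 2 + \sum_(j <- F) nrm D (x n j - p j) ^+ 2
      @[n --> \oo] --> (0 : R).
    rewrite -[X in _ --> X](addr0 0); apply: cvgD; last exact: IH.
    by rewrite -[X in _ --> X](mulr0 0); exact: (cvgM (xp Pj) (xp Pj)).
  by apply: cvg_trans; apply: near_eq_cvg; apply: nearW => n; rewrite big_cons.
have Sx : cvgv D \oo (fun n => \sum_(j <- F) x n j) (\sum_(j <- F) p j).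
  move: PF; elim: F {uF fF A0} => [_|j F IH /= /andP[Pj PF]].
    by rewrite big_nil; apply: eq_cvgv (cvgv_cst D 0) => n; rewrite big_nil.
  rewrite big_cons; apply: eq_cvgv (cvgvD (xp Pj) (IH PF)) => n.
  by rewrite big_cons.
have Bx : nrm D (fn n - \sum_(j <- F) x n j) @[n --> \oo] -->
    nrm D (f - \sum_(j <- F) p j).
  apply: cvgv_nrm; apply: cvgvD => //.
  have : cvgv D \oo (fun n => -1 *: \sum_(j <- F) x n j) (-1 *: \sum_(j <- F) p j).
    by apply: cvgvZ => //; exact: cvgc_cst.
  by rewrite scaleN1r; apply: eq_cvgv => n; rewrite scaleN1r.
have /cvgrPdist_le/(_ _ e8) Bx2 : nrm D (fn n - \sum_(j <- F) x n j) ^+ 2 @[n --> \oo] -->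
    nrm D (f - \sum_(j <- F) p j) ^+ 2 by exact: (cvgM Bx Bx).
have /cvgrPdist_le/(_ _ e8) A1 := A0.
apply: filterS (filterI A1 Bx2) => n [An Bn] J uJ PJ.
have {}An : \sum_(j <- F) nrm D (x n j - p j) ^+ 2 <= e / 8.
  by apply: le_trans An; rewrite sub0r normrN; exact: ler_norm.
have {}Bn : nrm D (fn n - \sum_(j <- F) x n j) ^+ 2 <= e / 8 + e / 8.
  move: Bn; rewrite distrC => /(le_trans (ler_norm _)).
  by move: fF; lra.
rewrite (bigID (mem F))/=.
have h1 : \sum_(j <- J | j \in F) nrm D (x n j - p j) ^+ 2 <=
    \sum_(j <- F) nrm D (x n j - p j) ^+ 2.
  rewrite -big_filter [leRHS](bigID (mem J))/= -[X in X + _]big_filter.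
  rewrite (perm_big [seq j <- F | j \in J]); last first.
    by apply: uniq_perm; rewrite ?filter_uniq// => j; rewrite !mem_filter andbC.
  by rewrite lerDl; apply: sumr_ge0 => j _; exact: sqr_ge0.
have h2 : \sum_(j <- J | j \notin F) nrm D (x n j - p j) ^+ 2 <=
    2 * \sum_(j <- J | j \notin F) nrm D (x n j) ^+ 2 +
    2 * \sum_(j <- J | j \notin F) nrm D (p j) ^+ 2.
  rewrite !mulr_sumr -big_split/=; apply: ler_sum => j _.
  have := sqr_ge0 (nrm D (x n j + p j)).
  by rewrite sqr_nrmB sqr_nrmD; lra.
have h3 := tail_le (@x_orth n) (@x_proj n) uF PF uJ PJ.
have h4 := tail_le p_orth p_proj uF PF uJ PJ.
lra.
Qed.

End uniform_parseval.

(** * Dimension modulo null vectors *)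

Section dimension.
Context {R : realType} {V : lmodType R[i]} (D : semi_inner V).
Implicit Types (W : set V).

Definition sip_dim W (n : nat) : Prop :=
  exists b : 'I_n -> V,
    [/\ forall k, W (b k),
        forall c : 'I_n -> R[i],
          nrm D (\sum_(k < n) c k *: b k) = 0 -> forall k, c k = 0
      & forall v, W v -> exists c : 'I_n -> R[i],
          nrm D (v - \sum_(k < n) c k *: b k) = 0].

Lemma nrm0D x y : nrm D x = 0 -> nrm D y = 0 -> nrm D (x + y) = 0.
Proof.
move=> x0 y0; apply/eqP; rewrite eq_le nrm_ge0 andbT.
by apply: le_trans (nrmD _ _ _) _; rewrite x0 y0 addr0.
Qed.

Lemma nrm0_sum n (F : 'I_n -> V) : (forall k, nrm D (F k) = 0) ->
  nrm D (\sum_(k < n) F k) = 0.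
Proof.
move=> F0; elim/big_rec : _ => [|k y _ y0]; first exact: nrm0.
exact: nrm0D.
Qed.

(** Expand [b] in [b'] modulo null vectors, with an m by n coefficient matrix. If n < m, a nonzero
    row in its left kernel gives a combination of the [b k] of norm 0, against their
    independence. *)
Lemma sip_dim_le W m n : sip_dim W m -> sip_dim W n -> (m <= n)%N.
Proof.
move=> [b [Wb bfree _]] [b' [_ _ b'span]].
have /choice [M hM] : forall k, exists c : 'I_n -> R[i],
    nrm D (b k - \sum_(l < n) c l *: b' l) = 0 by move=> k; exact: b'span.
pose A := \matrix_(k < m, l < n) M k l.
rewrite leqNgt; apply/negP => nm.
have : kermx A != 0.
  rewrite kermx_eq0; apply/negP => /eqP rA.
  by have := rank_leq_col A; rewrite rA leqNgt nm.
move=> /rowV0Pn[v /sub_kermxP vA /negP]; apply; apply/eqP/rowP => k.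
rewrite mxE; apply: (bfree (v 0)) => {k}.
have -> : \sum_(k < m) v 0 k *: b k =
    \sum_(k < m) v 0 k *: (b k - \sum_(l < n) M k l *: b' l) +
    \sum_(k < m) v 0 k *: (\sum_(l < n) M k l *: b' l).
  by rewrite -big_split/=; apply: eq_bigr => k _; rewrite -scalerDr subrK.
apply: nrm0D.
  by apply: nrm0_sum => k; rewrite nrmZ hM mulr0.
have -> : \sum_(k < m) v 0 k *: (\sum_(l < n) M k l *: b' l) =
    \sum_(l < n) (v *m A) 0 l *: b' l.
  under eq_bigr do rewrite scaler_sumr.
  rewrite exchange_big/=; apply: eq_bigr => l _.
  rewrite mxE scaler_suml; apply: eq_bigr => k _.
  by rewrite mxE scalerA.
by rewrite vA big1 ?nrm0// => l _; rewrite mxE scale0r.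
Qed.

Lemma sip_dim_uniq W m n : sip_dim W m -> sip_dim W n -> m = n.
Proof. by move=> Wm Wn; apply/eqP; rewrite eqn_leq !(@sip_dim_le W). Qed.

Lemma sip_dim_orthonormal W (r : seq int) (psi : int -> V) :
  uniq r -> orthonormal_on D r psi -> (forall i, i \in r -> W (psi i)) ->
  (forall v, W v -> nrm D (v - \sum_(i <- r) D v (psi i) *: psi i) = 0) ->
  sip_dim W (size r).
Proof.
move=> ur on Wpsi span; exists (fun k => psi (nth 0 r k)).
have sumE (c : int -> R[i]) : \sum_(k < size r) c (nth 0 r k) *: psi (nth 0 r k) =
    \sum_(i <- r) c i *: psi i by rewrite (big_nth 0) big_mkord.
split.
- by move=> k; apply: Wpsi; exact: mem_nth.
- move=> c c0 k.
  (* [c] is indexed by positions in [r], the orthonormal sums by the elements of [r]; [c']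
     translates between the two. *)
  pose c' i := if insub (index i r) is Some k then c k else 0.
  have c'E (j : 'I_(size r)) : c' (nth 0 r j) = c j.
    by rewrite /c' index_uniq// insubT// => jr; congr c; exact: val_inj.
  have : nrm D (\sum_(i <- r) c' i *: psi i) ^+ 2 = 0.
    by rewrite -sumE; under eq_bigr do rewrite c'E; rewrite c0 expr0n.
  rewrite (sqr_nrm_lincomb ur on) => /eqP.
  rewrite psumr_eq0 => [/allP h|i _]; last exact: sqr_ge0.
  have := h (nth 0 r k) (mem_nth 0 (ltn_ord k)).
  by rewrite /= sqrf_eq0 c'E => /eqP/Normc.eq0_normc.
- by move=> v Wv; exists (fun k => D v (psi (nth 0 r k))); rewrite (sumE (fun i => D v (psi i))) span.
Qed.

End dimension.

(** * A signed ordering is determined by its multiplicities *)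

Section signed_order.
Context {R : realType}.
Implicit Types lam l : int -> R.

Definition same_multiplicities lam l := forall c : R, c != 0 -> exists s s' : seq int,
  [/\ uniq s, forall i, (i \in s) = (i != 0) && (lam i == c),
      uniq s', forall i, (i \in s') = (i != 0) && (l i == c) & size s = size s'].

Lemma same_multiplicitiesC lam l :
  same_multiplicities lam l -> same_multiplicities l lam.
Proof. by move=> h c /h [s [s' [? ? ? ? ?]]]; exists s', s. Qed.

(** Suppose l j < c with c = lam j. Then c > 0, and the indices where l takes the value c are
    positive and lie before j, where lam and l agree; together with j they give lam more indices of
    value c than l has. *)
Let order_gt_false lam l (j : int) :
  signed_order lam -> signed_order l -> same_multiplicities lam l ->
  0 < j -> (forall i, 0 < i -> i < j -> lam i = l i) -> lam j <= l j.
Proof.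
move=> olam ol h j0 ih; rewrite leNgt; apply/negP => lj.
have lj0 : 0 <= l j by have [/(_ j j j0 (lexx _))/andP[]] := ol.
have lam0 : lam j != 0 by rewrite gt_eqF// (le_lt_trans lj0).
have [s [s' [us ms us' ms' ss']]] := h _ lam0.
have : (size (j :: s') <= size s)%N.
  apply: uniq_leq_size; first by rewrite /= us' andbT ms' negb_and (lt_eqF lj) orbT.
  move=> i; rewrite inE => /orP[/eqP ->|]; first by rewrite ms eqxx andbT gt_eqF.
  rewrite ms' => /andP[i0 /eqP li].
  have ip : 0 < i.
    rewrite lt_neqAle eq_sym i0/= leNgt; apply/negP => ineg.
    have [_ /(_ i i ineg (lexx _))/andP[_]] := ol.
    by rewrite li leNgt (le_lt_trans lj0).
  have ij : i < j.
    rewrite ltNge; apply/negP => ji.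
    have [/(_ j i j0 ji)/andP[_]] := ol.
    by rewrite li leNgt lj.
  by rewrite ms i0 ih// li eqxx.
by rewrite ss' /= ltnn.
Qed.

Let signed_order_eq_pos lam l (j : int) :
  signed_order lam -> signed_order l -> same_multiplicities lam l ->
  0 < j -> lam j = l j.
Proof.
move=> olam ol h; case: j => // j.
elim/ltn_ind: j => j IH j0; apply/eqP; rewrite eq_le; apply/andP; split.
- by apply: order_gt_false => // -[i|i]//= i0 ij; exact: IH.
- apply: order_gt_false => //; first exact: same_multiplicitiesC.
  by move=> -[i|i]//= i0 ij; apply/esym; exact: IH.
Qed.

Lemma signed_order_eq lam l (j : int) :
  signed_order lam -> signed_order l -> same_multiplicities lam l ->
  j != 0 -> lam j = l j.
Proof.
move=> olam ol h; rewrite neq_lt => /orP[j0|]; last exact: signed_order_eq_pos.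
(* Negating both index and value exchanges the two halves of a signed order, so the case of positive
   indices applies. *)
pose opp (g : int -> R) i := - g (- i).
have oopp g : signed_order g -> signed_order (opp g).
  move=> [gp gn]; split => i k i0 ik; rewrite /opp.
  - by rewrite oppr_ge0 lerN2 andbC; apply: gn; rewrite ?oppr_lt0 ?lerN2.
  - by rewrite oppr_le0 lerN2 andbC; apply: gp; rewrite ?oppr_gt0 ?lerN2.
have hopp : same_multiplicities (opp lam) (opp l).
  move=> c c0; have [|s [s' [us ms us' ms' ss']]] := h (- c); first by rewrite oppr_eq0.
  exists (map -%R s), (map -%R s'); split.
  - by rewrite map_inj_uniq//; exact: oppr_inj.
  - by move=> i; rewrite -[i in LHS]opprK mem_map ?ms ?oppr_eq0 /opp ?eqr_oppLR//; exact: oppr_inj.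
  - by rewrite map_inj_uniq//; exact: oppr_inj.
  - by move=> i; rewrite -[i in LHS]opprK mem_map ?ms' ?oppr_eq0 /opp ?eqr_oppLR//; exact: oppr_inj.
  - by rewrite !size_map.
have := @signed_order_eq_pos (opp lam) (opp l) (- j) (oopp _ olam) (oopp _ ol) hopp.
by rewrite oppr_gt0 j0 /opp opprK => /(_ isT)/oppr_inj.
Qed.

End signed_order.

(** * Eigenspaces of the limit operator and the projections onto them *)

Section spectral_convergence.
Context {R : realType} {V : lmodType R[i]} (D : semi_inner V).
Context (T : V -> V) (la : nat -> int -> R) (phi : nat -> int -> V)
  (s : nat -> seq int) (eps : nat -> R).
Hypotheses (A : spectral_approx D T la phi s eps) (complete : sip_complete D).
Implicit Types (c : R) (v p f : V).

Definition eig c v := nrm D (T v - c%:C *: v) = 0.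

(** The projection is a relation rather than an operator: it determines p only up to a null vector.
    For c = 0 the subspace is the kernel. *)
Definition is_proj c f p := eig c p /\ forall v, eig c v -> D (f - p) v = 0.

Lemma eigD c u v : eig c u -> eig c v -> eig c (u + v).
Proof.
move=> hu hv; rewrite /eig -[u in T (u + v)]scale1r (sa_linear A) scale1r.
by rewrite scalerDr opprD addrACA; exact: nrm0D.
Qed.

Lemma eigZ c a v : eig c v -> eig c (a *: v).
Proof.
move=> hv; rewrite /eig (sa_scale A) scalerA mulrC -scalerA -scalerBr nrmZ.
by rewrite hv mulr0.
Qed.

Lemma eigB c u v : eig c u -> eig c v -> eig c (u - v).
Proof. by move=> hu hv; rewrite -scaleN1r; apply: eigD => //; exact: eigZ. Qed.

Lemma eig0 c : eig c 0.
Proof. by rewrite /eig -(scale0r 0) (sa_scale A) !scale0r scaler0 subrr nrm0. Qed.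

Lemma dot_eigl c v x : eig c v -> D (T v) x = c%:C * D v x.
Proof.
by move=> /(dot_nrm0l x)/eqP; rewrite dotBl dotZl subr_eq0 => /eqP.
Qed.

Lemma eig_orthogonal c c' u v : c != c' -> eig c u -> eig c' v -> D u v = 0.
Proof.
move=> cc' hu hv; have := sa_selfadjoint A u v.
rewrite (dot_eigl _ hu) [X in _ = X -> _]dotC (dot_eigl _ hv) cconjM conjC_realC -dotC.
move=> /eqP; rewrite -subr_eq0 -mulrBl mulf_eq0 -rmorphB/= => /orP[|/eqP//].
move=> /eqP/(congr1 (@complex.Re R))/= /eqP; rewrite subr_eq0.
by rewrite (negPf cc').
Qed.

Lemma is_proj_uniq c f p q : is_proj c f p -> is_proj c f q -> nrm D (p - q) = 0.
Proof.
move=> [ep fp] [eq fq]; have epq := eigB ep eq.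
have : D (p - q) (p - q) = 0.
  have e : p - q = (f - q) - (f - p) by rewrite opprB [RHS]addrC addrA subrK.
  by rewrite {1}e dotBl fp// fq// subrr.
by move=> /(congr1 (@complex.Re R)); rewrite -sqr_nrm => /eqP; rewrite sqrf_eq0 => /eqP.
Qed.

Lemma is_proj_self c f p : is_proj c f p -> D f p = D p p.
Proof. by move=> [ep fp]; apply/eqP; rewrite -subr_eq0 -dotBl fp. Qed.

Section limit.
Context (U : set_system nat) {UU : UltraFilter U} (ooU : \oo `<=` U).
Context (l : int -> R) (psi : int -> V).
Hypothesis SL : spectral_limit D T la phi U l psi.

(** [sl_bound] forces |i| <= c ^- 2 as soon as l i = c and i != 0, so for c != 0 this ball misses no
    index of the value c. *)
Definition level c : seq int := [seq i <- int_ball (Num.truncn (c ^- 2)) | l i == c].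

Lemma mem_level c i : c != 0 -> (i \in level c) = (i != 0) && (l i == c).
Proof.
move=> c0; rewrite mem_filter mem_int_ball.
have [lic|] := eqVneq (l i) c; rewrite ?andbF//= andbT.
have [//|i0 /=] := eqVneq i 0.
have := sl_bound SL i0; rewrite lic => h.
rewrite -ltnS -(ltr_nat R); apply: le_lt_trans (truncnS_gt _).
by rewrite -[leRHS]mul1r ler_pdivlMr ?exprn_even_gt0// mulrC.
Qed.

Lemma level_uniq c : uniq (level c).
Proof. by rewrite filter_uniq// int_ball_uniq. Qed.

Lemma level_neq0 c i : c != 0 -> i \in level c -> [/\ i != 0, l i != 0 & l i = c].
Proof. by move=> c0; rewrite mem_level// => /andP[i0 /eqP ->]. Qed.

Lemma level_orthonormal c : c != 0 -> orthonormal_on D (level c) psi.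
Proof.
move=> c0 i j /(level_neq0 c0)[i0 li _] /(level_neq0 c0)[j0 lj _].
exact: (sl_orthonormal SL).
Qed.

Lemma eig_psi i : i != 0 -> l i != 0 -> eig (l i) (psi i).
Proof. exact: (sl_eigen SL). Qed.

Lemma eig_level c i : c != 0 -> i \in level c -> eig c (psi i).
Proof. by move=> c0 /(level_neq0 c0)[i0 li <-]; exact: eig_psi. Qed.

Definition level_proj c v := \sum_(i <- level c) D v (psi i) *: psi i.

Lemma eig_level_proj c v : c != 0 -> eig c (level_proj c v).
Proof.
move=> c0; rewrite /level_proj big_seq_cond.
elim/big_rec : _ => [|i u]; first exact: eig0.
by rewrite andbT => /(eig_level c0) ei hu; apply: eigD => //; exact: eigZ.
Qed.

(** The remainder h is again in the c-eigenspace and orthogonal to every [psi i]: by construction on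
    the level of c, by orthogonality of eigenspaces elsewhere. Completeness gives T h = 0 up to norm
    0, so c h is null, and h with it. *)
Lemma level_proj_span c v : c != 0 -> eig c v -> nrm D (v - level_proj c v) = 0.
Proof.
move=> c0 ev; set h := v - _.
have eh : eig c h by apply: eigB => //; exact: eig_level_proj.
have Th : nrm D (T h) = 0.
  apply: (sl_complete SL) => i i0 li0.
  have [lic|lic] := eqVneq (l i) c.
    apply: (dot_sub_proj (level_uniq c) (level_orthonormal c0)).
    by rewrite mem_level// i0 lic eqxx.
  by apply: eig_orthogonal eh (eig_psi i0 li0); rewrite eq_sym.
have : nrm D (c%:C *: h) = 0.
  have -> : c%:C *: h = T h - (T h - c%:C *: h) by rewrite opprB addrC subrK.
  by apply: nrm0D => //; rewrite nrmN.
by rewrite nrmZ normc_real => /eqP; rewrite mulf_eq0 normr_eq0 (negPf c0) => /eqP.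
Qed.

Lemma level_is_proj c f : c != 0 -> is_proj c f (level_proj c f).
Proof.
move=> c0; split; first exact: eig_level_proj.
move=> v ev; have vv := level_proj_span c0 ev.
have -> : v = (v - level_proj c v) + level_proj c v by rewrite subrK.
rewrite dotDr (dot_nrm0r _ vv) add0r dot_sumr big_seq_cond big1// => i /andP[il _].
by rewrite dotZr (dot_sub_proj (level_uniq c) (level_orthonormal c0))// mulr0.
Qed.

Lemma level_dim c : c != 0 -> sip_dim D (eig c) (size (level c)).
Proof.
move=> c0; apply: (@sip_dim_orthonormal _ _ _ _ _ psi).
- exact: level_uniq.
- exact: level_orthonormal.
- by move=> i; exact: eig_level.
- by move=> v; exact: level_proj_span.
Qed.

(** Level sets of [l] have the size of the eigenspace dimension, and so do those of [lam]; being
    ordered alike, the two agree index by index. In particular [l] does not depend on [U]. *)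
Lemma enum_eq_limit lam : enum_with_mult (fun c => sip_dim D (eig c)) lam ->
  forall i, i != 0 -> lam i = l i.
Proof.
move=> [olam mlam] i; apply: signed_order_eq => //; first exact: (sl_order SL).
move=> c c0; have [r [ur mr dr]] := mlam c c0.
exists r, (level c); split => //.
- exact: level_uniq.
- by move=> j; exact: mem_level.
- exact: (sip_dim_uniq dr (level_dim c0)).
Qed.

Lemma ker_orthogonal v i : i != 0 -> l i != 0 -> eig 0 v -> D v (psi i) = 0.
Proof.
by move=> i0 li0 v0; apply: eig_orthogonal v0 (eig_psi i0 li0); rewrite eq_sym.
Qed.

Let g k f := \sum_(i <- int_ball k | l i != 0) D f (psi i) *: psi i.

Let gE k f : g k f = \sum_(i <- [seq i <- int_ball k | l i != 0]) D f (psi i) *: psi i.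
Proof. by rewrite big_filter. Qed.

Let ball_neq0 k i : i \in [seq i <- int_ball k | l i != 0] -> i != 0 /\ l i != 0.
Proof. by rewrite mem_filter mem_int_ball => /andP[-> /andP[->]]. Qed.

Let ball_on k : orthonormal_on D [seq i <- int_ball k | l i != 0] psi.
Proof.
by move=> i j /ball_neq0[i0 li] /ball_neq0[j0 lj]; exact: (sl_orthonormal SL).
Qed.

Let ball_uniq k : uniq [seq i <- int_ball k | l i != 0].
Proof. by rewrite filter_uniq// int_ball_uniq. Qed.

Let sqr_nrm_g k f : nrm D (f - g k f) ^+ 2 =
  nrm D f ^+ 2 - \sum_(i <- int_ball k | l i != 0) normc (D f (psi i)) ^+ 2.
Proof. by rewrite gE (sqr_nrm_sub_proj (ball_uniq k) (ball_on (k:=k))) big_filter. Qed.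

Let ball_sub k m : (k <= m)%N ->
  perm_eq (int_ball m) (int_ball k ++ [seq i <- int_ball m | (k < absz i)%N]).
Proof.
move=> km; apply: uniq_perm; first exact: int_ball_uniq.
  rewrite cat_uniq int_ball_uniq filter_uniq ?int_ball_uniq// andbT.
  by apply/hasPn => i; rewrite mem_filter => /andP[ki _]; apply/negP;
    rewrite /= mem_int_ball leqNgt ki andbF.
by move=> i; rewrite [RHS]mem_cat mem_filter !mem_int_ball; case: (i != 0); lia.
Qed.

(** The kernel component is what remains of f after its eigenvector expansion. The partial sums
    [g k f] are Cauchy since the Bessel sums [B k] are monotone and bounded; their limit is taken
    along [U], which serves here as an ultrafilter on the truncation levels k. *)
Lemma ker_proj_exists f : exists2 p, is_proj 0 f p &
  forall e, 0 < e -> exists k, nrm D (f - p - g k f) <= e.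
Proof.
pose B k := \sum_(i <- int_ball k | l i != 0) normc (D f (psi i)) ^+ 2.
have g_sub k m : (k <= m)%N -> nrm D (g m f - g k f) ^+ 2 = B m - B k.
  move=> km; have := ball_sub km; set r := [seq i <- _ | _] => pm.
  have -> : B m - B k = \sum_(i <- r | l i != 0) normc (D f (psi i)) ^+ 2.
    by rewrite [B m](perm_big _ pm) big_cat addrAC subrr add0r.
  have -> : g m f - g k f = \sum_(i <- r | l i != 0) D f (psi i) *: psi i.
    by rewrite [g m f](perm_big _ pm) big_cat addrAC subrr add0r.
  rewrite -big_filter sqr_nrm_lincomb ?big_filter ?filter_uniq ?int_ball_uniq//.
  move=> i j; rewrite !mem_filter !mem_int_ball.
  move=> /andP[li /andP[_ /andP[i0 _]]] /andP[lj /andP[_ /andP[j0 _]]].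
  exact: (sl_orthonormal SL).
have B_mono : {homo B : k m / (k <= m)%N >-> k <= m}.
  by move=> k m km; rewrite -subr_ge0 -g_sub// sqr_ge0.
have B_le k : B k <= nrm D f ^+ 2 by rewrite -subr_ge0 -sqr_nrm_g sqr_ge0.
have B_cvg : cvgn B.
  apply: nondecreasing_is_cvgn => //.
  by exists (nrm D f ^+ 2) => _ [k _ <-]; exact: B_le.
have [q gq] : exists q, cvgv D U (g ^~ f) q.
  apply: ultra_complete => // e e0.
  (* [B m] and [B K] each lie within e ^ 2 / 2 of the limit, and their difference is the squared
     distance of the two partial sums. *)
  have e2 : 0 < e ^+ 2 / 2 by rewrite divr_gt0// exprn_gt0.
  have /cvgrPdist_le/(_ _ e2) [K _ hK] := B_cvg.
  exists (g K f); apply: ooU; exists K => //= m Km.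
  rewrite -(ler_pXn2r (ltn0Sn 1)) ?nnegrE ?nrm_ge0 ?(ltW e0)// g_sub//.
  have := hK K (leqnn K); have := hK m Km; rewrite /= !ler_norml.
  move=> /andP[+ +] /andP[+ +]; lra.
exists (f - q); last first.
  move=> e e0; move/cvgvP: gq => /(_ e e0) /filter_ex [k hk]; exists k.
  by rewrite opprB [f + _]addrC subrK nrmBC.
split.
  rewrite /eig scale0r subr0; apply: (sl_complete SL) => i i0 li0.
  (* From k = |i| on, [g k f] contains the term of [psi i], so that f - g k f is orthogonal to
     it. *)
  have gi : \forall k \near U, D (f - g k f) (psi i) = 0.
    apply: ooU; exists (absz i) => //= k ik; rewrite gE.
    apply: (dot_sub_proj (ball_uniq k) (ball_on (k:=k))).
    by rewrite mem_filter mem_int_ball li0 i0.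
  have h : cvgc U (fun k => D (f - g k f) (psi i)) (D (f - q) (psi i)).
    apply: cvgv_dot (cvgv_cst _ _); apply: cvgvD; first exact: cvgv_cst.
    have : cvgv D U (fun k => -1 *: g k f) (-1 *: q).
      by apply: cvgvZ => //; exact: cvgc_cst.
    by rewrite scaleN1r; apply: eq_cvgv => k; rewrite scaleN1r.
  apply: cvgc_uniq h _; apply: (@cvg0_le _ _ _ _ (fun=> 0)); last exact: cvg_cst.
  by apply: filterS gi => k ->; rewrite subrr Normc.normc0 lexx.
(* A kernel vector is orthogonal to all [psi i], hence to each [g k f] and to their limit q. *)
move=> v v0; rewrite opprB addrC subrK.
have h : cvgc U (fun k => D (g k f) v) (D q v).
  by apply: cvgv_dot => //; exact: cvgv_cst.
apply: cvgc_uniq h _; apply: (@cvg0_le _ _ _ _ (fun=> 0)); last exact: cvg_cst.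
apply: nearW => k; rewrite gE dot_suml big_seq_cond big1 ?subrr ?Normc.normc0 ?lexx//.
move=> i /andP[/ball_neq0[i0 li0] _].
by rewrite dotZl [D (psi i) v]dotC (ker_orthogonal i0 li0 v0) conjC0 mulr0.
Qed.

End limit.
End spectral_convergence.

(** * Convergence of the spectral components, singly and in sum *)

Section spectral_components.
Context {R : realType} {V : lmodType R[i]} (D : semi_inner V).
Context (T : V -> V) (la : nat -> int -> R) (phi : nat -> int -> V)
  (s : nat -> seq int) (eps : nat -> R).
Hypotheses (A : spectral_approx D T la phi s eps) (complete : sip_complete D).
Context (lam : int -> R).
Hypothesis hlam : enum_with_mult (fun c => sip_dim D (eig D T c)) lam.
Local Notation is_proj := (is_proj D T).

Definition component (lv : seq int) n f :=
  \sum_(i <- lv | i \in s n) D f (phi n i) *: phi n i.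

Lemma ultra_infty_exists :
  exists U : set_system nat, UltraFilter U /\ (\oo : set_system nat) `<=` U.
Proof. exact: ultraFilterLemma. Qed.

Lemma is_proj_exists c f : exists p, is_proj c f p.
Proof.
have [U [UU ooU]] := ultra_infty_exists.
have [l [psi SL]] := spectral_limit_exists A ooU complete.
have [->|c0] := eqVneq c 0.
- by have [p hp _] := ker_proj_exists A complete ooU SL f; exists p.
- by exists (level_proj D l psi c f); exact: (level_is_proj A SL).
Qed.

(** Along each ultrafilter the limit is [level_proj], built from vectors [psi] that depend on the
    ultrafilter. It is nevertheless a projection onto the c-eigenspace, so it is at distance 0 from
    p, and the limit is the same for all ultrafilters. *)
Lemma component_cvg (c : R) lv (fn : nat -> V) f p : c != 0 -> uniq lv ->
  (forall i, (i \in lv) = (i != 0) && (lam i == c)) ->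
  cvgv D \oo fn f -> is_proj c f p ->
  cvgv D \oo (fun n => component lv n (fn n)) p.
Proof.
move=> c0 ulv mlv fnf hp; apply: cvg_of_ultra => U UU ooU.
have [l [psi SL]] := spectral_limit_exists A ooU complete.
have lamE := enum_eq_limit A SL hlam.
have lv_level : perm_eq lv (level l c).
  apply: uniq_perm => //; first exact: level_uniq.
  move=> i; rewrite mlv (mem_level SL)//.
  by case: eqVneq => //= i0; rewrite lamE.
have fnU : cvgv D U fn f by apply: cvg_trans fnf => B; exact: ooU.
have h : cvgv D U (fun n => component lv n (fn n)) (level_proj D l psi c f).
  (* The outer guard makes every summand converge, as [cvgv_sum] demands; the inner one comes from
     [component] and is satisfied for almost all n, because the limit eigenvalue is nonzero. *)
  have : cvgv D U (fun n => \sum_(i <- lv) if i \in lv then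
      (if i \in s n then D (fn n) (phi n i) *: phi n i else 0) else 0)
    (\sum_(i <- lv) if i \in lv then D f (psi i) *: psi i else 0).
    apply: (@cvgv_sum _ _ D U _ _ lv (fun i n => if i \in lv then
      (if i \in s n then D (fn n) (phi n i) *: phi n i else 0) else 0)
      (fun i => if i \in lv then D f (psi i) *: psi i else 0)) => i.
    case: ifPn => [ilv|_]; last exact: cvgv_cst.
    move: ilv; rewrite mlv => /andP[i0 /eqP lic].
    have li0 : l i != 0 by rewrite -lamE// lic.
    have hi : cvgv D U (fun n => D (fn n) (phi n i) *: phi n i) (D f (psi i) *: psi i).
      by apply: cvgvZ; [apply: cvgv_dot => //|]; exact: (sl_vec SL).
    apply: cvgv_nrm0 hi; apply: (@cvg0_le _ _ _ _ (fun=> 0)); last exact: cvg_cst.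
    apply: filterS (sa_near_mem A i0 li0 (sl_val SL i0)) => n ->.
    by rewrite subrr nrm0 lexx.
  rewrite /level_proj -(perm_big _ lv_level)/=.
  have -> : \sum_(i <- lv) (if i \in lv then D f (psi i) *: psi i else 0) =
     \sum_(i <- lv) D f (psi i) *: psi i by apply: eq_big_seq => i ->.
  apply: eq_cvgv => n; rewrite /component [RHS]big_mkcond/=.
  by apply: eq_big_seq => i ->.
have e0 := is_proj_uniq A hp (level_is_proj A SL f c0).
apply: (@cvg0_le _ _ _ _ (fun n => nrm D (component lv n (fn n) - level_proj D l psi c f))) => //.
apply: nearW => n; rewrite nrm_ge0/=; apply: le_trans (nrmB _ _ (level_proj D l psi c f) _) _.
by rewrite [X in _ + X]nrmBC e0 addr0.
Qed.

Context (nu : int -> R) (lv : int -> seq int).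
Hypotheses
  (hnu : enum_distinct (fun c => exists2 v, eig D T c v & nrm D v <> 0) nu)
  (ulv : forall j, uniq (lv j))
  (mlv : forall j, j != 0 -> nu j != 0 ->
     forall i, (i \in lv j) = (i != 0) && (lam i == nu j)).

Let P (j : int) := (j != 0) && (nu j != 0).

Let nu_inj i j : P i -> P j -> i != j -> nu i != nu j.
Proof.
move=> /andP[i0 ni] /andP[j0 nj]; apply: contraNneq => /[dup] e.
by have [_ _ inj] := hnu; move/(inj i j i0 j0 ni) => ->.
Qed.

Let comp_on n j : orthonormal_on D [seq i <- lv j | i \in s n] (phi n).
Proof.
move=> i i'; rewrite !mem_filter => /andP[si _] /andP[si' _].
exact: (sa_orthonormal A).
Qed.

Let compE n j f : component (lv j) n f =
  \sum_(i <- [seq i <- lv j | i \in s n]) D f (phi n i) *: phi n i.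
Proof. by rewrite big_filter. Qed.

Let comp_proj n j f : P j ->
  D f (component (lv j) n f) = D (component (lv j) n f) (component (lv j) n f).
Proof.
move=> Pj; apply/eqP; rewrite -subr_eq0 -dotBl !compE dot_sumr big_seq_cond big1//.
move=> i /andP[ij _]; rewrite dotZr (dot_sub_proj _ (@comp_on n j)) ?mulr0//.
by rewrite filter_uniq.
Qed.

Let comp_orth n i j f : P i -> P j -> i != j ->
  D (component (lv i) n f) (component (lv j) n f) = 0.
Proof.
move=> Pi Pj ij; rewrite !compE dot_suml big_seq_cond big1// => a /andP[ai _].
rewrite dot_sumr big_seq_cond big1// => b /andP[bj _].
move: ai bj; rewrite !mem_filter => /andP[sa ai] /andP[sb bj].
rewrite dotZl dotZr (sa_orthonormal A)//.
have /andP[i0 ni] := Pi; have /andP[j0 nj] := Pj.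
move: ai bj; rewrite !mlv// => /andP[_ /eqP la_] /andP[_ /eqP lb].
suff /negPf -> : a != b by rewrite !mulr0.
by apply: contraTneq (nu_inj Pi Pj ij) => ab; rewrite -la_ -lb ab eqxx.
Qed.

(** What [uniform_parseval] still needs is that finitely many projections exhaust f up to e. The
    kernel part of f is null, so a partial eigenvector expansion g is within sqrt e of f;
    subtracting the full projections for the eigenvalues met by g leaves a remainder r that is no
    longer than f - g. *)
Lemma components_uniform (fn : nat -> V) f (p : int -> V) p0 :
  cvgv D \oo fn f -> (forall j, j != 0 -> nu j != 0 -> is_proj (nu j) f (p j)) ->
  is_proj 0 f p0 -> nrm D p0 = 0 ->
  forall e, 0 < e -> \forall n \near \oo, forall J : seq int, uniq J ->
    all (fun j => (j != 0) && (nu j != 0)) J ->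
    \sum_(j <- J) nrm D (component (lv j) n (fn n) - p j) ^+ 2 <= e.
Proof.
move=> fnf hp hp0 p00.
have hpP j : P j -> is_proj (nu j) f (p j) by move=> /andP[]; exact: hp.
apply: (@uniform_parseval _ _ D (fun n j => component (lv j) n (fn n)) p fn f P fnf).
- move=> j Pj; have /andP[j0 nj] := Pj.
  exact: (@component_cvg (nu j) (lv j) fn f (p j) nj (ulv j) (mlv j0 nj) fnf (hpP j Pj)).
- by move=> n i j; exact: comp_orth.
- by move=> n j; exact: comp_proj.
- move=> i j Pi Pj ij; have [ei _] := hpP i Pi; have [ej _] := hpP j Pj.
  exact: (eig_orthogonal A (nu_inj Pi Pj ij)).
- by move=> j Pj; exact: (is_proj_self (hpP j Pj)).
move=> e e0.
have [U [UU ooU]] := ultra_infty_exists.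
have [l [psi SL]] := spectral_limit_exists A ooU complete.
have [q hq qk] := ker_proj_exists A complete ooU SL f.
have q0 : nrm D q = 0.
  have -> : q = p0 - (p0 - q) by rewrite opprB addrC subrK.
  by apply: nrm0D => //; rewrite nrmN; exact: (is_proj_uniq A hp0 hq).
have [k hk] := qk (Num.sqrt e) (ltac:(by rewrite sqrtr_gt0)).
set g := \sum_(i <- int_ball k | l i != 0) _ in hk.
have fg : nrm D (f - g) <= Num.sqrt e.
  apply: le_trans hk; have -> : f - g = (f - q - g) + q by rewrite addrAC subrK.
  by apply: le_trans (nrmD _ _ _) _; rewrite q0 addr0.
(* [jj i] is the position of [l i] among the distinct eigenvalues; it exists because [psi i] has
   norm 1 and is therefore a genuine eigenvector. *)
have /choice [jj hjj] : forall i, exists j, i != 0 -> l i != 0 -> P j /\ nu j = l i.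
  move=> i; case: (boolP ((i != 0) && (l i != 0))) => [/andP[i0 li0]|ni]; last first.
    by exists 0 => i0 li0; rewrite i0 li0 in ni.
  have [_ nuE _] := hnu.
  have [|j j0 nj] := (nuE (l i) li0).1.
    exists (psi i); first exact: (eig_psi SL).
    rewrite /nrm (sl_orthonormal SL)// eqxx /= sqrtr1.
    by apply/eqP; rewrite oner_eq0.
  by exists j => _ _; split => //; rewrite /P nj li0 andbT.
(* Several i may share an eigenvalue, whose projection has to be subtracted only once. *)
pose F := undup (map jj [seq i <- int_ball k | l i != 0]).
have FP j : j \in F -> P j.
  rewrite mem_undup => /mapP[a]; rewrite mem_filter mem_int_ball.
  by move=> /andP[la0 /andP[a0 _]] ->; have [] := hjj a a0 la0.
exists F; split; [exact: undup_uniq|exact/allP|].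
set r := f - _.
have rperp j v : j \in F -> eig D T (nu j) v -> D r v = 0.
  move=> jF ev; rewrite /r (bigD1_seq j)//= ?undup_uniq// opprD addrA dotBl.
  have [_ ->//] := hpP j (FP j jF).
  rewrite dot_suml big_seq_cond big1 ?subr0// => j' /andP[j'F j'j].
  have [ej' _] := hpP j' (FP j' j'F).
  exact: (eig_orthogonal A (nu_inj (FP _ j'F) (FP _ jF) j'j)).
have rg : D r g = 0.
  rewrite dot_sumr big_seq_cond big1// => i; rewrite mem_int_ball.
  move=> /andP[/andP[i0 ik] li0]; rewrite dotZr.
  have [Pj nj] := hjj i i0 li0.
  rewrite (rperp (jj i)) ?mulr0//; last by rewrite nj; exact: (eig_psi SL).
  by rewrite mem_undup; apply/mapP; exists i => //; rewrite mem_filter mem_int_ball li0 i0.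
(* r is orthogonal to g and to every p j with j in [F]; Cauchy-Schwarz then yields |r| <= |f -
   g|. *)
have rr : D r r = D r (f - g).
  rewrite [in LHS]/r dotBr [in RHS]dotBr rg; congr (_ - _).
  rewrite dot_sumr big_seq_cond big1// => j /andP[jF _].
  by apply: (rperp j) => //; have [] := hpP j (FP j jF).
have r2 : nrm D r ^+ 2 <= nrm D r * Num.sqrt e.
  rewrite sqr_nrm rr; apply: le_trans (Re_dot_le _ _ _) _.
  by rewrite ler_wpM2l ?nrm_ge0.
have [rz|rz] := eqVneq (nrm D r) 0; first by rewrite rz expr0n/= ltW.
have : nrm D r <= Num.sqrt e.
  by rewrite -(ler_pM2l (_ : 0 < nrm D r)) -?expr2// lt_neqAle eq_sym rz nrm_ge0.
by move=> h; rewrite -(sqr_sqrtr (ltW e0)) ler_pXn2r ?nnegrE ?nrm_ge0 ?sqrtr_ge0.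
Qed.

End spectral_components.

(** * L^2(X) as a module with a semidefinite inner product *)

Section complex_L2_space.
Context d (X : measurableType d) (R : realType) (mu : probability X R).
Implicit Types (f g h : X -> R[i]) (a b : X -> R).

Definition cmeas f := measurable_fun setT (fun x => Re (f x)) /\
  measurable_fun setT (fun x => Im (f x)).

Definition sqn f x : R := normc (f x) ^+ 2.

Lemma sqnE f x : sqn f x = Re (f x) ^+ 2 + Im (f x) ^+ 2.
Proof. exact: sqr_normcE. Qed.

Lemma sqn_ge0 f x : 0 <= sqn f x. Proof. exact: sqr_ge0. Qed.

Lemma measurable_sqn f : cmeas f -> measurable_fun setT (sqn f).
Proof.
move=> [mr mi]; rewrite (_ : sqn f = fun x => Re (f x) ^+ 2 + Im (f x) ^+ 2).
  by apply: measurable_funD; exact: measurable_funX.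
by apply/funext => x; exact: sqnE.
Qed.

Lemma integrable_le a b : measurable_fun setT a -> (forall x, `|a x| <= b x) ->
  mu.-integrable setT (EFin \o b) -> mu.-integrable setT (EFin \o a).
Proof.
move=> ma ab; apply: le_integrable => //; first exact/measurable_EFinP.
move=> x _ /=; rewrite lee_fin; apply: le_trans (ab x) _; exact: ler_norm.
Qed.

Lemma integrableDr a b : mu.-integrable setT (EFin \o a) ->
  mu.-integrable setT (EFin \o b) -> mu.-integrable setT (EFin \o (fun x => a x + b x)).
Proof. by move=> ia ib; have := integrableD measurableT ia ib. Qed.

Lemma integrableZr (k : R) a : mu.-integrable setT (EFin \o a) ->
  mu.-integrable setT (EFin \o (fun x => k * a x)).
Proof. by move=> ia; have := integrableZl measurableT k ia. Qed.

Lemma L2normE f : L2norm mu f = ((\int[mu]_x (sqn f x)%:E) `^ 2^-1)%E.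
Proof.
rewrite /L2norm unlock; congr (_ `^ _)%E; apply: eq_integral => x _ /=.
by rewrite ger0_norm ?normc_ge0// powR_mulrn ?normc_ge0.
Qed.

Lemma L2P f : L2 mu f <-> cmeas f /\ mu.-integrable setT (EFin \o sqn f).
Proof.
split=> [[mr mi]|[[mr mi] /integrableP[_ fi]]].
  rewrite L2normE => /lty_poweRy -/(_ _) fi; split=> //.
  apply/integrableP; split; first by apply/measurable_EFinP; exact: measurable_sqn.
  under eq_integral do rewrite /= ger0_norm ?sqn_ge0//.
  by apply: fi; rewrite invr_neq0.
split => //; rewrite L2normE; apply: poweR_lty.
by apply: le_lt_trans fi; under [leRHS]eq_integral do rewrite /= ger0_norm ?sqn_ge0//.
Qed.

Lemma L2_cmeas f : L2 mu f -> cmeas f. Proof. by move/L2P => []. Qed.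

Lemma L2_sqn f : L2 mu f -> mu.-integrable setT (EFin \o sqn f).
Proof. by move/L2P => []. Qed.

Lemma integrable_bound2 a f g : L2 mu f -> L2 mu g -> measurable_fun setT a ->
  (forall x, `|a x| <= sqn f x + sqn g x) -> mu.-integrable setT (EFin \o a).
Proof.
move=> /L2_sqn sf /L2_sqn sg ma h; apply: (integrable_le ma h).
exact: integrableDr.
Qed.

Lemma L2_lin (c : R[i]) f g : L2 mu f -> L2 mu g -> L2 mu (fun x => c * f x + g x).
Proof.
move=> Lf Lg; have [mfr mfi] := L2_cmeas Lf; have [mgr mgi] := L2_cmeas Lg.
have mfg : cmeas (fun x => c * f x + g x).
  split.
  - under eq_fun do rewrite cReD cReM.
    apply: measurable_funD => //; apply: measurable_funB; exact: measurable_funM.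
  - under eq_fun do rewrite cImD cImM.
    apply: measurable_funD => //; apply: measurable_funD; exact: measurable_funM.
apply/L2P; split => //.
have := integrableDr (integrableZr (2 * normc c ^+ 2) (L2_sqn Lf))
   (integrableZr 2 (L2_sqn Lg)).
apply: integrable_le; first exact: measurable_sqn.
move=> x; rewrite ger0_norm ?sqn_ge0// /sqn.
have h : normc (c * f x + g x) <= normc c * normc (f x) + normc (g x).
  by apply: le_trans (normcD_le _ _) _; rewrite Normc.normcM.
apply: (@le_trans _ _ ((normc c * normc (f x) + normc (g x)) ^+ 2)).
  by rewrite ler_pXn2r ?nnegrE ?addr_ge0 ?mulr_ge0 ?normc_ge0.
rewrite -mulrA -exprMn.
have := sqr_ge0 (normc c * normc (f x) - normc (g x)); lra.
Qed.

Lemma L2_0 : L2 mu (fun=> 0).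
Proof.
apply/L2P; split; first by split; exact: measurable_cst.
rewrite (_ : _ \o _ = cst 0%E); first exact: integrable0.
by apply/funext => x; rewrite /= /sqn Normc.normc0 expr0n.
Qed.

Definition L2pred : {pred X -> R[i]} := [pred f | `[< L2 mu f >]].

Lemma L2_submod_closed : GRing.submod_closed L2pred.
Proof.
split; first by apply/asboolP; exact: L2_0.
move=> c f g /asboolP Lf /asboolP Lg; apply/asboolP; exact: L2_lin.
Qed.

HB.instance Definition _ :=
  GRing.isSubmodClosed.Build R[i] (X -> R[i]) L2pred L2_submod_closed.

Record L2type := MkL2 { L2fun :> X -> R[i]; _ : L2fun \in L2pred }.

HB.instance Definition _ := [isSub for L2fun].
HB.instance Definition _ := [Choice of L2type by <:].
HB.instance Definition _ := [SubChoice_isSubLmodule of L2type by <:].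

Lemma L2typeP (f : L2type) : L2 mu f.
Proof. by case: f => f /= /asboolP. Qed.

Lemma mem_L2pred f : L2 mu f -> f \in L2pred.
Proof. by move=> Lf; exact/asboolP. Qed.

Definition toL2 f (Lf : L2 mu f) : L2type := MkL2 (mem_L2pred Lf).

Lemma L2funD (f g : L2type) x : (f + g) x = f x + g x. Proof. by []. Qed.
Lemma L2funB (f g : L2type) x : (f - g) x = f x - g x. Proof. by []. Qed.
Lemma L2funZ c (f : L2type) x : (c *: f) x = c * f x. Proof. by []. Qed.

Lemma L2fun_sum I (s : seq I) (P : pred I) (F : I -> L2type) x :
  (\sum_(i <- s | P i) F i) x = \sum_(i <- s | P i) F i x.
Proof. by elim/big_rec2 : _ => [|i u v _ <-]. Qed.

Definition cintegrable f := mu.-integrable setT (EFin \o (fun x => Re (f x))) /\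
  mu.-integrable setT (EFin \o (fun x => Im (f x))).

Lemma cintegralD f g : cintegrable f -> cintegrable g ->
  cintegral mu (fun x => f x + g x) = cintegral mu f + cintegral mu g.
Proof.
move=> [fr fi] [gr gi]; apply: complex_ext; rewrite ?cReD ?cImD /=.
- by under eq_Rintegral do rewrite cReD; rewrite RintegralD.
- by under eq_Rintegral do rewrite cImD; rewrite RintegralD.
Qed.

Lemma cintegralZ c f : cintegrable f ->
  cintegral mu (fun x => c * f x) = c * cintegral mu f.
Proof.
move=> [fr fi]; apply: complex_ext; rewrite ?cReM ?cImM /=.
- under eq_Rintegral do rewrite cReM.
  by rewrite RintegralB ?RintegralZl//; exact: integrableZr.
- under eq_Rintegral do rewrite cImM.
  by rewrite RintegralD ?RintegralZl//; exact: integrableZr.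
Qed.

Lemma cintegral_conj f : cintegrable f ->
  cintegral mu (fun x => (f x)^*) = (cintegral mu f)^*.
Proof.
move=> [fr fi]; apply: complex_ext; rewrite ?cRe_conj ?cIm_conj /=.
- by apply: eq_Rintegral => x _; rewrite cRe_conj.
- under eq_Rintegral do rewrite cIm_conj -mulN1r.
  by rewrite RintegralZl// mulN1r.
Qed.

Lemma cintegrable_mulJ f g : L2 mu f -> L2 mu g ->
  cintegrable (fun x => f x * (g x)^*).
Proof.
move=> Lf Lg; have [mfr mfi] := L2_cmeas Lf; have [mgr mgi] := L2_cmeas Lg.
have le_fg x (u : R) : `|u| <= normc (f x * (g x)^*) -> `|u| <= sqn f x + sqn g x.
  move=> /le_trans; apply; rewrite Normc.normcM normc_conj /sqn.
  have := normc_ge0 (f x); have := normc_ge0 (g x).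
  have := sqr_ge0 (normc (f x) - normc (g x)); nra.
split; apply: (integrable_bound2 Lf Lg).
- under eq_fun do rewrite cReM cRe_conj cIm_conj.
  apply: measurable_funB; apply: measurable_funM => //.
  exact: measurableT_comp.
- by move=> x; apply: le_fg; exact: normrRe_le.
- under eq_fun do rewrite cImM cRe_conj cIm_conj.
  apply: measurable_funD; apply: measurable_funM => //.
  exact: measurableT_comp.
- by move=> x; apply: le_fg; exact: normrIm_le.
Qed.

Lemma L2dot_sqn f : Re (L2dot mu f f) = \int[mu]_x sqn f x.
Proof. by apply: eq_Rintegral => x _; rewrite mulcJ. Qed.

Let dotD (f g h : L2type) : L2dot mu (f + g) h = L2dot mu f h + L2dot mu g h.
Proof.
rewrite /L2dot -cintegralD; try exact: cintegrable_mulJ (L2typeP _) (L2typeP _).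
by congr cintegral; apply/funext => x; rewrite L2funD mulrDl.
Qed.

Let dotZ c (f g : L2type) : L2dot mu (c *: f) g = c * L2dot mu f g.
Proof.
rewrite /L2dot -cintegralZ; last exact: cintegrable_mulJ (L2typeP _) (L2typeP _).
by congr cintegral; apply/funext => x; rewrite L2funZ mulrA.
Qed.

Let dotJ (f g : L2type) : L2dot mu g f = (L2dot mu f g)^*.
Proof.
rewrite /L2dot -cintegral_conj; last exact: cintegrable_mulJ (L2typeP _) (L2typeP _).
by congr cintegral; apply/funext => x; rewrite cconjM conjCK mulrC.
Qed.

Let dot_pos (f : L2type) : 0 <= Re (L2dot mu f f).
Proof. by rewrite L2dot_sqn; apply: Rintegral_ge0 => x _; exact: sqn_ge0. Qed.

Definition L2sip : semi_inner L2type := SemiInner dotD dotZ dotJ dot_pos.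

Lemma sqn_integralE (f : L2type) :
  (\int[mu]_x (sqn f x)%:E)%E = (nrm L2sip f ^+ 2)%:E.
Proof.
rewrite sqr_nrm [Re _]L2dot_sqn /Rintegral fineK//.
exact: (integrable_fin_num measurableT (L2_sqn (L2typeP f))).
Qed.

Lemma L2norm_nrm (f : L2type) : L2norm mu f = (nrm L2sip f)%:E.
Proof.
rewrite L2normE sqn_integralE poweR12_sqrt ?lee_fin ?sqr_ge0//=.
by rewrite sqrtr_sqr ger0_norm ?nrm_ge0.
Qed.

Lemma nrm0_ceq (f : L2type) : nrm L2sip f = 0 <-> ceq mu f (cst 0).
Proof.
have mf : measurable_fun setT (EFin \o sqn f).
  by apply/measurable_EFinP; apply: measurable_sqn; exact: L2_cmeas (L2typeP f).
split=> [f0|f0].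
  have : ae_eq mu setT (EFin \o sqn f) (cst 0%E).
    apply/(ae_eq_integral_abs mu measurableT mf).
    under eq_integral do rewrite /= ger0_norm ?sqn_ge0//.
    by rewrite sqn_integralE f0 expr0n.
  apply: filterS => x /(_ I) [] /eqP; rewrite sqrf_eq0 => /eqP.
  exact: Normc.eq0_normc.
apply/eqP; rewrite -sqrf_eq0 -eqe -sqn_integralE; apply/eqP.
rewrite (ge0_ae_eq_integral (g := cst 0%E))//; first by rewrite integral0.
- by move=> x _; rewrite lee_fin sqn_ge0.
- by apply: filterS f0 => x fx _; rewrite /= /sqn fx Normc.normc0 expr0n.
Qed.

End complex_L2_space.

(** * Completeness of L^2(X) *)

Section riesz_fischer.
Context d (X : measurableType d) (R : realType) (mu : probability X R).

(** Bounded variation makes the telescoping series of the increments absolutely convergent. *)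
Lemma bounded_variation_cvg (u : nat -> R) (M : R) :
  (forall n, \sum_(0 <= k < n) `|u k.+1 - u k| <= M) -> cvgn u.
Proof.
move=> uM.
have : cvgn (series (telescope u)).
  apply: normed_cvg; apply: nondecreasing_is_cvgn.
    apply/nondecreasing_seqP => n; rewrite /= !seriesEnat /= big_nat_recr//= lerDl.
    exact: normr_ge0.
  exists M => _ [n _ <-]; exact: uM.
move=> /cvg_ex[l]; rewrite telescopeK => ul; apply/cvg_ex; exists (l + u 0%N).
have : (u n - u 0%N) + u 0%N @[n --> \oo] --> l + u 0%N.
  by apply: cvgD; [exact: ul|exact: cvg_cst].
by apply: cvg_trans; apply: near_eq_cvg; apply: nearW => n; rewrite subrK.
Qed.

Lemma limn_einf_le (u : nat -> \bar R) (c : \bar R) :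
  (forall n, (u n <= c)%E) -> (limn_einf u <= c)%E.
Proof.
move=> uc; rewrite limn_einf_lim; apply: lime_le; first exact: is_cvg_einfs.
apply: nearW => n; apply: le_trans (uc n); apply: ereal_inf_lbound.
by exists n => //=.
Qed.

Lemma measurable_limn_einf (h : nat -> X -> \bar R) :
  (forall n, measurable_fun setT (h n)) ->
  measurable_fun setT (fun x => limn_einf (h ^~ x)).
Proof.
move=> mh; rewrite (_ : (fun x => _) =
    fun x => (- limn_esup (fun n => - h n x))%E); last first.
  by apply/funext => x; rewrite (limn_esupN (h ^~ x)) oppeK.
apply: measurableT_comp => //; apply: measurable_fun_limn_esup => n.
exact: measurableT_comp.
Qed.

Let sum_expN2 n : \sum_(0 <= k < n) 2 ^- k = 2 - 2 * 2 ^- n :> R.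
Proof.
elim: n => [|n IH]; first by rewrite big_geq// expr0 invr1; ring.
rewrite big_nat_recr//= IH exprS; field.
by rewrite expf_neq0.
Qed.

Section fast_cauchy.
Context (F : nat -> L2type mu).
Hypothesis F_cauchy : forall k m, (k <= m)%N -> nrm (L2sip mu) (F k - F m) <= 2 ^- k.

Let a k x : R := normc (F k.+1 x - F k x).

Let mF k : cmeas (F k). Proof. exact: L2_cmeas (L2typeP _). Qed.

Let ma k : measurable_fun setT (a k).
Proof.
have m2 := measurable_sqn (L2_cmeas (L2typeP (F k.+1 - F k))).
rewrite (_ : a k = fun x => Num.sqrt (sqn (F k.+1 - F k) x)).
  exact: (measurableT_comp (continuous_measurable_fun (@sqrt_continuous R)) m2).
by apply/funext => x; rewrite /sqn sqrtr_sqr ger0_norm ?normc_ge0.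
Qed.

(** Integrate the pointwise inequality a <= 2^k a^2 / 2 + 2^-k / 2, which expresses (2^k a - 1)^2 >=
    0. The squared L^2 distance is at most 4^-k, so each term contributes at most 2^-k / 2. *)
Let int_a k : (\int[mu]_x (a k x)%:E <= (2 ^- k)%:E)%E.
Proof.
have p0 : 0 < 2 ^- k :> R by rewrite invr_gt0 exprn_gt0.
have i2 := L2_sqn (L2typeP (F k.+1 - F k)).
have ic : mu.-integrable setT (EFin \o cst (2 ^- k : R)).
  exact: finite_measure_integrable_cst.
have iS := integrableDr (integrableZr (2 ^+ k / 2) i2) (integrableZr (1 / 2) ic).
apply: (@le_trans _ _ (\int[mu]_x (2 ^+ k / 2 * sqn (F k.+1 - F k) x
    + 1 / 2 * cst (2 ^- k) x)%:E)%E).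
  apply: ge0_le_integral => //.
  - by move=> x _; rewrite lee_fin normc_ge0.
  - exact/measurable_EFinP.
  - exact: measurable_int iS.
  - move=> x _; rewrite lee_fin /sqn L2funB -/(a k x).
    have := sqr_ge0 (2 ^+ k * a k x - 1).
    rewrite -(pmulr_rge0 _ (_ : 0 < 2 ^- k / 2)) ?divr_gt0//.
    have -> : 2 ^- k / 2 * (2 ^+ k * a k x - 1) ^+ 2 =
       2 ^+ k / 2 * a k x ^+ 2 + 1 / 2 * 2 ^- k - a k x.
      by field; rewrite expf_neq0.
    by rewrite subr_ge0.
have -> : (\int[mu]_x (2 ^+ k / 2 * sqn (F k.+1 - F k) x + 1 / 2 * cst (2 ^- k) x)%:E)%E =
    (\int[mu]_x (2 ^+ k / 2 * sqn (F k.+1 - F k) x + 1 / 2 * cst (2 ^- k) x))%:E.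
  rewrite /Rintegral fineK//; exact: (integrable_fin_num measurableT iS).
rewrite lee_fin RintegralD ?RintegralZl//; try exact: integrableZr.
have -> : \int[mu]_x sqn (F k.+1 - F k) x = nrm (L2sip mu) (F k - F k.+1) ^+ 2.
  by rewrite nrmBC sqr_nrm [RHS]L2dot_sqn.
have -> : \int[mu]_x cst (2 ^- k : R) x = 2 ^- k.
  rewrite Rintegral_cst//= -[RHS]mulr1; congr (_ * _).
  by rewrite -[RHS]/(fine 1%E); congr fine; exact: probability_setT.
have h := F_cauchy (leqnSn k).
have h2 : nrm (L2sip mu) (F k - F k.+1) ^+ 2 <= 2 ^- k ^+ 2.
  by rewrite ler_pXn2r ?nnegrE ?nrm_ge0 ?(ltW p0).
have h3 : 2 ^+ k / 2 * nrm (L2sip mu) (F k - F k.+1) ^+ 2 <= 2 ^+ k / 2 * 2 ^- k ^+ 2.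
  by rewrite ler_wpM2l ?divr_ge0 ?exprn_ge0.
apply: le_trans (lerD h3 (lexx _)) _.
rewrite le_eqVlt; apply/orP; left; apply/eqP; field.
by rewrite expf_neq0.
Qed.

Let S x := (\sum_(0 <= k <oo) (a k x)%:E)%E.

Let iS : mu.-integrable setT S.
Proof.
have mS : measurable_fun setT S.
  apply: ge0_emeasurable_sum => [k x _ _|k _]; first by rewrite lee_fin normc_ge0.
  exact/measurable_EFinP.
have S0 x : (0 <= S x)%E by apply: nneseries_ge0 => k _ _; rewrite lee_fin normc_ge0.
apply/integrableP; split => //; under eq_integral do rewrite gee0_abs//.
rewrite integral_nneseries//; last 2 first.
- by move=> k; exact/measurable_EFinP.
- by move=> k x _; rewrite lee_fin normc_ge0.
apply: (@le_lt_trans _ _ 2%:E); last exact: ltry.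
apply: lime_le.
  apply: is_cvg_nneseries => k _ _; apply: integral_ge0 => x _.
  by rewrite lee_fin normc_ge0.
apply: nearW => n; apply: (@le_trans _ _ (\sum_(0 <= k < n) (2 ^- k)%:E)%E).
  by apply: lee_sum => k _; exact: int_a.
rewrite sumEFin lee_fin sum_expN2 gerBl mulr_ge0//.
Qed.

(** The pointwise limit, written with upper limits so that it is measurable on all of X, including
    the null set where the sequence may diverge. *)
Let g x : R[i] := fine (limn_esup (fun k => (Re (F k x))%:E)) +i*
                  fine (limn_esup (fun k => (Im (F k x))%:E)).

(** [S] is integrable, hence finite almost everywhere, and where it is finite the sequence has
    bounded variation. *)
Let good : {ae mu, forall x, cvgc \oo (F ^~ x) (g x)}.
Proof.
apply: filterS (integrable_ae measurableT iS) => x /(_ I) Sx.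
have bnd n : \sum_(0 <= k < n) a k x <= fine (S x).
  rewrite -lee_fin fineK// -sumEFin; apply: nneseries_lim_ge => k _ _.
  by rewrite lee_fin normc_ge0.
have cr : cvgn (fun k => Re (F k x)).
  apply: (bounded_variation_cvg (M := fine (S x))) => n; apply: le_trans (bnd n).
  by apply: ler_sum => k _; rewrite -cReN -cReD; exact: normrRe_le.
have ci : cvgn (fun k => Im (F k x)).
  apply: (bounded_variation_cvg (M := fine (S x))) => n; apply: le_trans (bnd n).
  by apply: ler_sum => k _; rewrite -cImN -cImD; exact: normrIm_le.
have esupE (u : nat -> R) : cvgn u -> u k @[k --> \oo] -->
    fine (limn_esup (fun k => (u k)%:E)).
  move=> /cvg_ex[l ul].
  have ul' : (u k)%:E @[k --> \oo] --> l%:E by apply: cvg_EFin => //; exact: nearW.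
  by have [_ ->] := cvg_limn_einf_sup ul'.
by apply: cvgc_ReIm; exact: esupE.
Qed.

Let mg : cmeas g.
Proof.
split; rewrite /g /=; apply: (@measurableT_comp _ _ _ _ _ _ fine) => //;
  apply: measurable_fun_limn_esup => k; apply/measurable_EFinP;
  by have [] := mF k.
Qed.

Let cmeasB (f h : X -> R[i]) : cmeas f -> cmeas h -> cmeas (fun x => f x - h x).
Proof.
move=> [fr fi] [hr hi]; split.
- by under eq_fun do rewrite cReD cReN; exact: measurable_funB.
- by under eq_fun do rewrite cImD cImN; exact: measurable_funB.
Qed.

Let sqn_cvg (z : nat -> R[i]) l : cvgc \oo z l ->
  normc (z n) ^+ 2 @[n --> \oo] --> normc l ^+ 2.
Proof.
move=> zl; rewrite sqr_normcE; under eq_fun do rewrite sqr_normcE.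
have zr : Re (z n) @[n --> \oo] --> Re l by exact: cvgc_Re.
have zi : Im (z n) @[n --> \oo] --> Im l by exact: cvgc_Im.
exact: (cvgD (cvgM zr zr) (cvgM zi zi)).
Qed.

(** Fatou's lemma for the squared distances of [F (m + k)] to [F k] as m grows. *)
Let int_g k : (\int[mu]_x (sqn (fun x => g x - F k x) x)%:E <= (2 ^- k ^+ 2)%:E)%E.
Proof.
pose h m x := (sqn (F (m + k)%N - F k) x)%:E.
have mh m : measurable_fun setT (h m).
  apply/measurable_EFinP; apply: measurable_sqn; exact: L2_cmeas (L2typeP _).
have -> : (\int[mu]_x (sqn (fun x => g x - F k x) x)%:E =
    \int[mu]_x limn_einf (h ^~ x))%E.
  apply: ge0_ae_eq_integral => //.
  - by apply/measurable_EFinP; apply: measurable_sqn; exact: cmeasB.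
  - exact: measurable_limn_einf.
  - by move=> x _; rewrite lee_fin sqn_ge0.
  - move=> x _; rewrite limn_einf_lim; apply: lime_ge; first exact: is_cvg_einfs.
    apply: nearW => n; apply: le_ereal_inf_tmp => _ [m _ <-].
    by rewrite lee_fin sqn_ge0.
  apply: filterS good => x Fg _.
  suff : h m x @[m --> \oo] --> (sqn (fun x => g x - F k x) x)%:E.
    by move=> /cvg_limn_einf_sup[-> _].
  have Fgk : cvgc \oo (fun m => F (m + k)%N x) (g x).
    by move: Fg; rewrite /cvgc -(cvg_shiftn k).
  have Fgk' : cvgc \oo (fun m => F (m + k)%N x - F k x) (g x - F k x).
    by apply: cvgcD => //; exact: cvgc_cst.
  by apply: cvg_EFin; [exact: nearW|exact: sqn_cvg Fgk'].
apply: le_trans (fatou mu measurableT mh _) _.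
  by move=> m x _; rewrite lee_fin sqn_ge0.
apply: limn_einf_le => m; rewrite sqn_integralE lee_fin.
by rewrite ler_pXn2r ?nnegrE ?nrm_ge0 ?invr_ge0 ?exprn_ge0// nrmBC F_cauchy// leq_addl.
Qed.

Let Lgk k : L2 mu (fun x => g x - F k x).
Proof.
apply/L2P; split; first exact: cmeasB.
apply/integrableP; split.
  by apply/measurable_EFinP; apply: measurable_sqn; exact: cmeasB.
under eq_integral do rewrite /= ger0_norm ?sqn_ge0//.
by apply: le_lt_trans (int_g k) _; exact: ltry.
Qed.

Let Lg : L2 mu g.
Proof.
have := L2_lin 1 (Lgk 0%N) (L2typeP (F 0%N)).
by under eq_fun do rewrite mul1r subrK.
Qed.

Lemma fast_cauchy_limit : exists u, cvgv (L2sip mu) \oo F u.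
Proof.
exists (toL2 Lg); apply/cvgvP => e e0.
have [K Ke] := exists_expN2_lt e0.
exists K => //= k Kk; rewrite nrmBC.
have h : nrm (L2sip mu) (toL2 Lg - F k) <= 2 ^- k.
  rewrite -(ler_pXn2r (ltn0Sn 1)) ?nnegrE ?nrm_ge0 ?invr_ge0 ?exprn_ge0//.
  by rewrite -lee_fin -sqn_integralE; exact: int_g.
apply: le_trans h (le_trans _ (ltW Ke)).
by rewrite lef_pV2 ?posrE ?exprn_gt0// ler_weXn2l ?ler1n.
Qed.

End fast_cauchy.

Lemma L2_complete : sip_complete (L2sip mu).
Proof. by move=> F; exact: fast_cauchy_limit. Qed.

End riesz_fischer.

(** * From the cut norm to bilinear forms in bounded functions *)

Section cut_norm_operator.
Context d (X : measurableType d) (R : realType) (mu : probability X R).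
Implicit Types (a b : X -> R) (u h : X * X -> R).

(** Real counterpart of [graphon_op]: a real kernel acts separately on real and imaginary parts. *)
Definition kernel_op u a x : R := \int[mu]_y (u (x, y) * a y).

Lemma integrable_bounded a (M : R) : measurable_fun setT a -> (forall x, `|a x| <= M) ->
  mu.-integrable setT (EFin \o a).
Proof.
move=> ma aM; apply: (integrable_le ma aM); exact: finite_measure_integrable_cst.
Qed.

Lemma integrable_prod_snd a : mu.-integrable setT (EFin \o a) ->
  (mu \x mu)%E.-integrable setT (EFin \o (fun p => a p.2)).
Proof.
move=> ia; apply/integrable12ltyP.
  apply/measurable_EFinP; apply: measurableT_comp => //.
  exact/measurable_EFinP/(measurable_int mu ia).
rewrite /= integral_cst//=; have /integrableP[_ /= fin_a] := ia.
by rewrite [X in (_ * X)%E](_ : _ = 1%E) ?mule1//; exact: probability_setT.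
Qed.

Lemma integrable_kernel u a : measurable_fun setT u -> (forall p, `|u p| <= 1) ->
  mu.-integrable setT (EFin \o a) ->
  (mu \x mu)%E.-integrable setT (EFin \o (fun p => u p * a p.2)).
Proof.
move=> mu_ u1 ia.
have ma : measurable_fun setT a by exact/measurable_EFinP/(measurable_int mu ia).
apply: le_integrable (integrable_prod_snd ia) => //.
  apply/measurable_EFinP; apply: measurable_funM => //.
  exact: measurableT_comp.
by move=> p _; rewrite /= lee_fin normrM ler_piMl.
Qed.

Lemma integrable_section u a x : measurable_fun setT u -> (forall p, `|u p| <= 1) ->
  mu.-integrable setT (EFin \o a) ->
  mu.-integrable setT (EFin \o (fun y => u (x, y) * a y)).
Proof.
move=> mu_ u1 ia.
have ma : measurable_fun setT a by exact/measurable_EFinP/(measurable_int mu ia).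
have mux : measurable_fun setT (fun y => u (x, y)) by exact: measurable_fun_pair2.
apply: le_integrable ia => //.
  by apply/measurable_EFinP; exact: measurable_funM.
by move=> p _; rewrite /= lee_fin normrM ler_piMl.
Qed.

Lemma integrable_normr a : mu.-integrable setT (EFin \o a) ->
  mu.-integrable setT (EFin \o (fun x => `|a x|)).
Proof. by move=> /integrable_norm. Qed.

Lemma measurable_kernel_op u a : measurable_fun setT u -> (forall p, `|u p| <= 1) ->
  mu.-integrable setT (EFin \o a) -> measurable_fun setT (kernel_op u a).
Proof.
move=> mu_ u1 ia; have := measurable_fubini_F (integrable_kernel mu_ u1 ia).
by move=> h; apply: (@measurableT_comp _ _ _ _ _ _ fine) => //.
Qed.

Lemma kernel_op_le u a x : measurable_fun setT u -> (forall p, `|u p| <= 1) ->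
  mu.-integrable setT (EFin \o a) -> `|kernel_op u a x| <= \int[mu]_y `|a y|.
Proof.
move=> mu_ u1 ia; have iua := integrable_section x mu_ u1 ia.
apply: le_trans (le_normr_Rintegral measurableT iua) _.
apply: le_Rintegral => //; [exact: integrable_normr|exact: integrable_normr|].
by move=> y _; rewrite normrM ler_piMl.
Qed.

Lemma RFubini h (M : R) : measurable_fun setT h -> (forall p, `|h p| <= M) ->
  [/\ \int[mu]_x \int[mu]_y h (x, y) = fine (\int[(mu \x mu)%E]_p (h p)%:E)%E,
      \int[mu]_y \int[mu]_x h (x, y) = fine (\int[(mu \x mu)%E]_p (h p)%:E)%E &
      (mu \x mu)%E.-integrable setT (EFin \o h)].
Proof.
move=> mh hM.
have ih : (mu \x mu)%E.-integrable setT (EFin \o h).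
  have ic : mu.-integrable setT (EFin \o (cst M : X -> R)).
    exact: finite_measure_integrable_cst.
  have := integrable_prod_snd ic; apply: le_integrable => //; first exact/measurable_EFinP.
  by move=> p _; rewrite /= lee_fin; apply: le_trans (hM p) _; exact: ler_norm.
split=> //.
- rewrite -integral12_prod_meas1// /Rintegral; congr fine; apply: eq_integral => x _.
  rewrite fineK//; apply: (integrable_fin_num measurableT).
  by apply: (integrable_bounded (M := M)) => //; exact: measurable_fun_pair2.
- rewrite -integral21_prod_meas1// /Rintegral; congr fine; apply: eq_integral => x _.
  rewrite fineK//; apply: (integrable_fin_num measurableT).
  by apply: (integrable_bounded (M := M)) => //; exact: measurable_fun_pair1.
Qed.

(** Replaces a bounded multiplier by indicators: the left side is at most M times the integral of
    |g|, and |g| is g on [S] and -g off [S]. *)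
Lemma RintegralM_indic_le g b (M : R) : mu.-integrable setT (EFin \o g) ->
  measurable_fun setT b -> (forall x, `|b x| <= M) ->
  let S := [set x | 0 <= g x] in
  measurable S /\ `|\int[mu]_x (b x * g x)| <=
    M * (`|\int[mu]_x (\1_S x * g x)| + `|\int[mu]_x (\1_(~` S) x * g x)|).
Proof.
move=> ig mb bM S.
have mg : measurable_fun setT g by exact/measurable_EFinP/(measurable_int mu ig).
have mS : measurable S.
  rewrite (_ : S = g @^-1` `[0, +oo[); first by rewrite -[X in measurable X]setTI; exact: mg.
  by apply/seteqP; split => x; rewrite /S /= in_itv/= andbT.
split=> //.
have iM (c : X -> R) K : measurable_fun setT c -> (forall x, `|c x| <= K) ->
    mu.-integrable setT (EFin \o (fun x => c x * g x)).
  move=> mc cK; have K0 x : 0 <= K := le_trans (normr_ge0 _) (cK x).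
  apply: (integrable_le (b := fun x => K * `|g x|)); first exact: measurable_funM.
    by move=> x; rewrite normrM ler_wpM2r.
  by apply: integrableZr; exact: integrable_normr.
have i1 A : measurable A -> mu.-integrable setT (EFin \o (fun x => \1_A x * g x)).
  move=> mA; apply: (iM _ 1); first exact: measurable_indic.
  by move=> x; rewrite indicE; case: (_ \in _); rewrite ?normr0 ?normr1.
apply: le_trans (le_normr_Rintegral measurableT (iM _ _ mb bM)) _.
apply: (@le_trans _ _ (\int[mu]_x (M * (\1_S x * g x - \1_(~` S) x * g x)))).
  have iB : mu.-integrable setT (EFin \o (fun x => \1_S x * g x - \1_(~` S) x * g x)).
    have := integrableDr (i1 _ mS) (integrableZr (-1) (i1 _ (measurableC mS))).
    by under eq_fun do rewrite mulN1r.
  apply: le_Rintegral => //; [exact: integrable_normr (iM _ _ mb bM)|exact: integrableZr|].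
  move=> x _; rewrite normrM.
  have -> : \1_S x * g x - \1_(~` S) x * g x = `|g x|.
    rewrite !indicE in_setC; case: (leP 0 (g x)) => gx.
      by rewrite mem_set//= mul1r mul0r subr0 ger0_norm.
    by rewrite memNset/= ?mul1r ?mul0r ?sub0r ?ltr0_norm//; apply/negP; rewrite -ltNge.
  by rewrite ler_wpM2r.
have M0 : 0 <= M by exact: le_trans (normr_ge0 _) (bM point).
rewrite RintegralZl//; last first.
  have := integrableDr (i1 _ mS) (integrableZr (-1) (i1 _ (measurableC mS))).
  by under eq_fun do rewrite mulN1r.
rewrite ler_wpM2l// RintegralB//; try exact: i1; last exact: i1 _ (measurableC mS).
by apply: le_trans (ler_norm _) (ler_normB _ _).
Qed.

Section cut_bound.
Context (u : X * X -> R) (k : R).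
Hypotheses (mu_ : measurable_fun setT u) (u1 : forall p, `|u p| <= 1).
Hypothesis cut : forall S T : set X, measurable S -> measurable T ->
  `|fine (\int[(mu \x mu)%E]_(p in S `*` T) (u p)%:E)%E| <= k.

Let indic_le1 A (x : X) : `|\1_A x : R| <= 1.
Proof. by rewrite indicE; case: (_ \in _); rewrite ?normr0 ?normr1. Qed.

Let swapE a b : measurable_fun setT a -> measurable_fun setT b ->
  (exists M, forall x, `|a x| <= M) -> (exists M, forall x, `|b x| <= M) ->
  \int[mu]_x (b x * kernel_op u a x) =
  \int[mu]_y (a y * \int[mu]_x (u (x, y) * b x)).
Proof.
move=> ma mb [M aM] [M' bM'].
pose h p := b p.1 * (u p * a p.2).
have mh : measurable_fun setT h.
  apply: measurable_funM; first exact: measurableT_comp.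
  by apply: measurable_funM => //; exact: measurableT_comp.
have hM p : `|h p| <= M' * (1 * M).
  by rewrite !normrM ler_pM// ?mulr_ge0// ler_pM.
have [h1 h2 _] := RFubini mh hM.
transitivity (\int[mu]_x \int[mu]_y h (x, y)).
  apply: eq_Rintegral => x _; rewrite -RintegralZl//.
  apply: integrable_section => //; exact: integrable_bounded aM.
rewrite h1 -h2; apply: eq_Rintegral => y _; rewrite -RintegralZl//.
  by apply: eq_Rintegral => x _; rewrite /h/=; ring.
apply: (integrable_bounded (M := 1 * M')).
  by apply: measurable_funM => //; exact: measurable_fun_pair1.
by move=> x; rewrite normrM ler_pM.
Qed.

Let indic_cut S T : measurable S -> measurable T ->
  `|\int[mu]_x (\1_S x * kernel_op u \1_T x)| <= k.
Proof.
move=> mS mT; pose h p := \1_S p.1 * (u p * \1_T p.2).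
have mh : measurable_fun setT h.
  apply: measurable_funM; first by apply: measurableT_comp => //; exact: measurable_indic.
  by apply: measurable_funM => //; apply: measurableT_comp => //; exact: measurable_indic.
have hM p : `|h p| <= 1 * (1 * 1).
  by rewrite !normrM ler_pM// ?mulr_ge0// ler_pM.
have [h1 _ _] := RFubini mh hM.
have -> : \int[mu]_x (\1_S x * kernel_op u \1_T x) = \int[mu]_x \int[mu]_y h (x, y).
  apply: eq_Rintegral => x _; rewrite -RintegralZl//.
  apply: integrable_section => //.
  by apply: (integrable_bounded (M := 1)) => //; exact: measurable_indic.
rewrite h1; have := cut mS mT; rewrite integral_mkcond.
congr (`|fine _| <= _); apply: eq_integral => -[x y] _; rewrite patchE /h /= !indicE.
rewrite in_setX/=; case: (x \in S); case: (y \in T) => /=;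
  by rewrite ?mul1r ?mulr1 ?mulr0 ?mul0r.
Qed.

(** Passing from bounded functions to sets, once for [a] and once for [b], costs a factor 2 each
    time, hence the 4. *)
Lemma bilinear_cut_le a b (M M' : R) : measurable_fun setT a -> measurable_fun setT b ->
  (forall x, `|a x| <= M) -> (forall x, `|b x| <= M') ->
  `|\int[mu]_x (b x * kernel_op u a x)| <= 4 * M * M' * k.
Proof.
move=> ma mb aM bM.
have M0 : 0 <= M by exact: le_trans (normr_ge0 _) (aM point).
have M'0 : 0 <= M' by exact: le_trans (normr_ge0 _) (bM point).
have half S : measurable S -> `|\int[mu]_x (\1_S x * kernel_op u a x)| <= 2 * M * k.
  move=> mS; have m1S := measurable_indic (R := R) (D := setT) mS.
  rewrite swapE//; [|by exists M|by exists 1].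
  pose g y := \int[mu]_x (u (x, y) * \1_S x).
  have mg : measurable_fun setT g.
    have ih := (RFubini (M := 1) (h := fun p => u p * \1_S p.1) _ _).
    have [||_ _ {}ih] := ih.
    - by apply: measurable_funM => //; exact: measurableT_comp.
    - by move=> p; rewrite normrM mulr_ile1.
    have := measurable_fubini_G ih.
    by move=> mG; apply: (@measurableT_comp _ _ _ _ _ _ fine) => //.
  have ig : mu.-integrable setT (EFin \o g).
    apply: (integrable_bounded (M := 1)) => // y.
    have iy : mu.-integrable setT (EFin \o (fun x => u (x, y) * \1_S x)).
      apply: (integrable_bounded (M := 1)).
        by apply: measurable_funM => //; exact: measurable_fun_pair1.
      by move=> x; rewrite normrM mulr_ile1.
    apply: le_trans (le_normr_Rintegral measurableT iy) _.
    have -> : (1 : R) = \int[mu]_x cst 1 x.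
      rewrite Rintegral_cst//= mul1r -[LHS]/(fine 1%E); congr fine.
      exact/esym/probability_setT.
    apply: le_Rintegral => //; [exact: integrable_normr|exact: finite_measure_integrable_cst|].
    by move=> x _; rewrite normrM mulr_ile1.
  have [mT] := RintegralM_indic_le ig ma aM; set T := [set x | _] in mT *.
  move=> /le_trans; apply; rewrite -mulrA [2 * _]mulrCA ler_wpM2l//.
  have cutE T' : measurable T' -> `|\int[mu]_y (\1_T' y * g y)| <= k.
    move=> mT'; have := indic_cut mS mT'; rewrite swapE//.
    - by exists 1.
    - by exists 1.
  have := cutE _ mT; have := cutE _ (measurableC mT); lra.
have ia : mu.-integrable setT (EFin \o a) by exact: integrable_bounded aM.
have mK := measurable_kernel_op mu_ u1 ia.
have iK : mu.-integrable setT (EFin \o kernel_op u a).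
  by apply: (integrable_bounded mK) => x; exact: kernel_op_le.
have [mS] := RintegralM_indic_le iK mb bM; set S := [set x | _] in mS *.
move=> /le_trans; apply.
have h1 := half _ mS; have h2 := half _ (measurableC mS).
have h3 := ler_wpM2l M'0 (lerD h1 h2); apply: le_trans h3 _.
by rewrite le_eqVlt; apply/orP; left; apply/eqP; ring.
Qed.

End cut_bound.
End cut_norm_operator.

(** * From the cut norm to the operator norm on L^2(X) *)

Section graphon_operator.
Context d (X : measurableType d) (R : realType) (mu : probability X R).
Implicit Types (a b : X -> R) (u w : X * X -> R).
Local Notation kernel_op := (kernel_op mu).

Lemma Rintegral_le_cst a (M : R) : mu.-integrable setT (EFin \o a) ->
  (forall x, a x <= M) -> \int[mu]_x a x <= M.
Proof.
move=> ia aM; have -> : M = \int[mu]_x cst M x.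
  rewrite Rintegral_cst//= -[LHS]mulr1; congr (_ * _).
  by rewrite -[LHS]/(fine 1%E); congr fine; exact/esym/probability_setT.
by apply: le_Rintegral => //; exact: finite_measure_integrable_cst.
Qed.

Lemma integrable_of_sqr a : measurable_fun setT a ->
  mu.-integrable setT (EFin \o (fun x => a x ^+ 2)) -> mu.-integrable setT (EFin \o a).
Proof.
move=> ma ia2; have ic : mu.-integrable setT (EFin \o (cst 1 : X -> R)).
  exact: finite_measure_integrable_cst.
apply: (integrable_le ma _ (integrableDr ic ia2)) => x /=.
have := sqr_ge0 (`|a x| - 1); rewrite sqrrB real_normK ?num_real//.
have := sqr_ge0 (a x); lra.
Qed.

Lemma sqr_integral_norm_le a : measurable_fun setT a ->
  mu.-integrable setT (EFin \o (fun x => a x ^+ 2)) ->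
  (\int[mu]_x `|a x|) ^+ 2 <= \int[mu]_x a x ^+ 2.
Proof.
move=> ma ia2; have ia := integrable_normr (integrable_of_sqr ma ia2).
set m := \int[mu]_x `|a x|.
have ic : mu.-integrable setT (EFin \o (cst (m ^+ 2) : X -> R)).
  exact: finite_measure_integrable_cst.
have i1 := integrableZr (- (2 * m)) ia.
have i2 := integrableDr ia2 i1.
have : 0 <= \int[mu]_x (a x ^+ 2 + - (2 * m) * `|a x| + cst (m ^+ 2) x).
  apply: Rintegral_ge0 => x _ /=; have := sqr_ge0 (`|a x| - m).
  by rewrite sqrrB real_normK ?num_real// => h; apply: le_trans h _; lra.
rewrite RintegralD// RintegralD// RintegralZl// -/m.
have -> : \int[mu]_x cst (m ^+ 2) x = m ^+ 2.
  rewrite Rintegral_cst//= -[RHS]mulr1; congr (_ * _).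
  by rewrite -[RHS]/(fine 1%E); congr fine; exact: probability_setT.
lra.
Qed.

Lemma kernel_opD u a b x : measurable_fun setT u -> (forall p, `|u p| <= 1) ->
  mu.-integrable setT (EFin \o a) -> mu.-integrable setT (EFin \o b) ->
  kernel_op u (fun x => a x + b x) x = kernel_op u a x + kernel_op u b x.
Proof.
move=> mu_ u1 ia ib; rewrite /kernel_op -RintegralD//; try exact: integrable_section.
by apply: eq_Rintegral => y _; rewrite mulrDr.
Qed.

Section sqr_bound.
Context (u : X * X -> R) (k : R).
Hypotheses (mu_ : measurable_fun setT u) (u1 : forall p, `|u p| <= 1).
Hypothesis cut : forall S T : set X, measurable S -> measurable T ->
  `|fine (\int[(mu \x mu)%E]_(p in S `*` T) (u p)%:E)%E| <= k.

(* Truncate a at height M ||a||: the cut norm controls the bounded part, and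
   the remainder has L^1-norm at most ||a|| / M. *)
Lemma sqr_kernel_op_le a (M : R) : 0 < M -> measurable_fun setT a ->
  mu.-integrable setT (EFin \o (fun x => a x ^+ 2)) ->
  \int[mu]_x (kernel_op u a x) ^+ 2 <= (4 * M * k + M^-1) * \int[mu]_x a x ^+ 2.
Proof.
move=> M0 ma ia2; have ia := integrable_of_sqr ma ia2.
set A2 := \int[mu]_x a x ^+ 2.
have A20 : 0 <= A2 by apply: Rintegral_ge0 => x _; exact: sqr_ge0.
pose A := Num.sqrt A2.
have AA : A ^+ 2 = A2 by rewrite sqr_sqrtr.
have A0 : 0 <= A by exact: sqrtr_ge0.
have mA : \int[mu]_x `|a x| <= A.
  rewrite -(ler_pXn2r (ltn0Sn 1)) ?nnegrE//; last first.
    by apply: Rintegral_ge0 => x _.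
  by rewrite AA; exact: sqr_integral_norm_le.
(* Pointwise |K a| <= ||a||_1 <= ||a||_2 = A, since the kernel is bounded by 1 and mu has mass 1. *)
have bA x : `|kernel_op u a x| <= A by exact: le_trans (kernel_op_le x mu_ u1 ia) mA.
have mK := measurable_kernel_op mu_ u1 ia.
have [A00|A00] := eqVneq A 0.
  rewrite -AA A00 expr0n/= mulr0; apply: Rintegral_le_cst => [|x].
    apply: (integrable_bounded mu (M := A ^+ 2)); first exact: measurable_funX.
    by move=> x; rewrite normrX ler_pXn2r ?nnegrE.
  by have := bA x; rewrite A00 normr_le0 => /eqP ->; rewrite expr0n.
have Ap : 0 < A by rewrite lt_neqAle eq_sym A00.
have MA : 0 < M * A by exact: mulr_gt0.
pose S := [set x | `|a x| <= M * A].
have mS : measurable S.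
  rewrite (_ : S = (fun x => `|a x|) @^-1` `]-oo, (M * A)]); last first.
    by apply/seteqP; split => x; rewrite /S /= in_itv.
  rewrite -[X in measurable X]setTI; apply: measurableT_comp => //.
pose a1 x := \1_S x * a x; pose a2 x := \1_(~` S) x * a x.
have ma1 : measurable_fun setT a1.
  by apply: measurable_funM => //; exact: measurable_indic.
have ma2 : measurable_fun setT a2.
  by apply: measurable_funM => //; apply: measurable_indic; exact: measurableC.
have a1M x : `|a1 x| <= M * A.
  rewrite /a1 indicE; have [xS|xS] := boolP (x \in S).
    by rewrite mul1r; move: xS; rewrite inE.
  by rewrite mul0r normr0 ltW.
(* Off [S] one has |a| > M A, hence |a| <= a^2 / (M A): the remainder is small in L^1. *)
have a2M x : `|a2 x| <= (M * A)^-1 * a x ^+ 2.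
  rewrite /a2 indicE in_setC; have [xS|xS] := boolP (x \in S).
    by rewrite mul0r normr0 mulr_ge0 ?sqr_ge0// invr_ge0 ltW.
  rewrite mul1r ler_pdivlMl//.
  have : M * A < `|a x| by rewrite ltNge; apply: contra xS => /mem_set.
  rewrite -(real_normK (num_real (a x))) expr2 => h.
  by rewrite ler_wpM2r// ltW.
have ia1 := integrable_bounded mu ma1 a1M.
have ia2' : mu.-integrable setT (EFin \o a2).
  exact: (integrable_le ma2 a2M (integrableZr _ ia2)).
have KE x : kernel_op u a x = kernel_op u a1 x + kernel_op u a2 x.
  rewrite -kernel_opD//; congr (kernel_op u _ x); apply/funext => y.
  by rewrite /a1 /a2 !indicE in_setC; case: (y \in S); rewrite /= ?mul1r ?mul0r ?addr0 ?add0r.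
have K2A x : `|kernel_op u a2 x| <= A / M.
  apply: le_trans (kernel_op_le x mu_ u1 ia2') _.
  apply: (@le_trans _ _ (\int[mu]_x ((M * A)^-1 * a x ^+ 2))).
    apply: le_Rintegral => //; [exact: integrable_normr|exact: integrableZr].
  rewrite RintegralZl// -/A2 -AA le_eqVlt; apply/orP; left; apply/eqP; field.
  by rewrite A00 gt_eqF.
have mK1 := measurable_kernel_op mu_ u1 ia1.
have mK2 := measurable_kernel_op mu_ u1 ia2'.
have i1 : mu.-integrable setT (EFin \o (fun x => kernel_op u a x * kernel_op u a1 x)).
  apply: (integrable_bounded mu (M := A * \int[mu]_y `|a1 y|)); first exact: measurable_funM.
  by move=> x; rewrite normrM ler_pM// kernel_op_le.
have i2 : mu.-integrable setT (EFin \o (fun x => kernel_op u a x * kernel_op u a2 x)).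
  apply: (integrable_bounded mu (M := A * (A / M))); first exact: measurable_funM.
  by move=> x; rewrite normrM ler_pM.
(* Only one factor K a is split. The part with [a1] is a bilinear form in functions bounded by M A
   and A, at most 4 M A^2 k; in the part with [a2] the factors are bounded pointwise by A and A /
   M. *)
have -> : \int[mu]_x (kernel_op u a x) ^+ 2 =
    \int[mu]_x (kernel_op u a x * kernel_op u a1 x) +
    \int[mu]_x (kernel_op u a x * kernel_op u a2 x).
  by rewrite -RintegralD//; apply: eq_Rintegral => x _; rewrite -mulrDr -KE expr2.
rewrite mulrDl; apply: lerD.
  apply: le_trans (ler_norm _) _.
  apply: le_trans (bilinear_cut_le mu_ u1 cut ma1 mK a1M bA) _.
  by rewrite le_eqVlt -AA; apply/orP; left; apply/eqP; ring.
apply: Rintegral_le_cst => // x.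
apply: le_trans (ler_norm _) _; rewrite normrM.
have -> : M^-1 * A2 = A * (A / M) by rewrite -AA; field; rewrite gt_eqF.
by rewrite ler_pM.
Qed.

End sqr_bound.

Lemma cutnorm_le u (k : R) S T : (cutnorm mu u <= k%:E)%E ->
  measurable S -> measurable T ->
  `|fine (\int[(mu \x mu)%E]_(p in S `*` T) (u p)%:E)%E| <= k.
Proof.
move=> uk mS mT; set z := integral _ _ _.
have : (`|z| <= k%:E)%E by apply: le_trans uk; apply: ereal_sup_ubound; exists (S, T).
by case: z => [r||]//=; rewrite lee_fin.
Qed.

(** Values in [-1, 1] rather than [0, 1], so that differences of graphons are included. *)
Definition kernel u := measurable_fun setT u /\ forall p, `|u p| <= 1.

Section L2_operator.
Context (u : X * X -> R) (ku : kernel u).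
Let mu_ := ku.1.
Let u1 := ku.2.
Implicit Types f g : L2type mu.

Lemma L2_ReIm f :
  [/\ measurable_fun setT (fun x => Re (f x)), measurable_fun setT (fun x => Im (f x)),
      mu.-integrable setT (EFin \o (fun x => Re (f x) ^+ 2)) &
      mu.-integrable setT (EFin \o (fun x => Im (f x) ^+ 2))].
Proof.
have [mr mi] := L2_cmeas (L2typeP f); split => //;
  apply: (integrable_le _ _ (L2_sqn (L2typeP f))); try exact: measurable_funX.
- by move=> x; rewrite ger0_norm ?sqr_ge0// sqnE lerDl sqr_ge0.
- by move=> x; rewrite ger0_norm ?sqr_ge0// sqnE lerDr sqr_ge0.
Qed.

Lemma graphon_opE f x : graphon_op mu u f x =
  kernel_op u (fun y => Re (f y)) x +i* kernel_op u (fun y => Im (f y)) x.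
Proof.
rewrite /graphon_op /cintegral; congr (_ +i* _); apply: eq_Rintegral => y _.
- by rewrite cReM /= mul0r subr0.
- by rewrite cImM /= mul0r addr0.
Qed.

Lemma graphon_op_L2 f : L2 mu (graphon_op mu u f).
Proof.
have [mr mi ir ii] := L2_ReIm f.
have ir1 := integrable_of_sqr mr ir; have ii1 := integrable_of_sqr mi ii.
have cm : cmeas (graphon_op mu u f).
  by split; under eq_fun do rewrite graphon_opE /=; exact: measurable_kernel_op.
apply/L2P; split => //.
pose a := \int[mu]_y `|Re (f y)|; pose b := \int[mu]_y `|Im (f y)|.
apply: (integrable_bounded mu (M := a ^+ 2 + b ^+ 2)); first exact: measurable_sqn.
move=> x; rewrite ger0_norm ?sqn_ge0// sqnE graphon_opE /=.
have k1 := kernel_op_le x mu_ u1 ir1; have k2 := kernel_op_le x mu_ u1 ii1.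
have a0 : 0 <= a by apply: Rintegral_ge0.
have b0 : 0 <= b by apply: Rintegral_ge0.
by apply: lerD; rewrite -[leLHS]real_normK ?num_real// ler_pXn2r ?nnegrE.
Qed.

Definition L2op f : L2type mu := toL2 (graphon_op_L2 f).

Lemma L2op_linear : linear L2op.
Proof.
move=> c f g; apply: val_inj; apply/funext => x.
change (graphon_op mu u (c *: f + g) x =
  c * graphon_op mu u f x + graphon_op mu u g x).
have ci (h : L2type mu) : cintegrable mu (fun y => (u (x, y))%:C * h y).
  have [mr mi ir ii] := L2_ReIm h.
  have ir1 := integrable_of_sqr mr ir; have ii1 := integrable_of_sqr mi ii.
  split.
  - rewrite (_ : (fun y => _) = (fun y => u (x, y) * Re (h y))).
      exact: integrable_section.
    by apply/funext => y; rewrite cReM /= mul0r subr0.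
  - rewrite (_ : (fun y => _) = (fun y => u (x, y) * Im (h y))).
      exact: integrable_section.
    by apply/funext => y; rewrite cImM /= mul0r addr0.
rewrite /graphon_op -cintegralZ// -cintegralD//.
  by congr cintegral; apply/funext => y; rewrite L2funD L2funZ mulrDr mulrCA.
rewrite (_ : (fun y => c * _) = (fun y => (u (x, y))%:C * (c *: f) y)); first exact: ci.
by apply/funext => y; rewrite L2funZ mulrCA.
Qed.

Lemma sqr_nrm_ReIm f : nrm (L2sip mu) f ^+ 2 =
  \int[mu]_x Re (f x) ^+ 2 + \int[mu]_x Im (f x) ^+ 2.
Proof.
have [mr mi ir ii] := L2_ReIm f.
rewrite sqr_nrm [LHS]L2dot_sqn -RintegralD//.
by apply: eq_Rintegral => x _; exact: sqnE.
Qed.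

(** M = 1 / sqrt k balances the two errors of [sqr_kernel_op_le]: 4 M k + 1 / M = 5 sqrt k. *)
Lemma nrm_L2op_le (k : R) f : 0 < k -> (cutnorm mu u <= k%:E)%E ->
  nrm (L2sip mu) (L2op f) <= Num.sqrt (5 * Num.sqrt k) * nrm (L2sip mu) f.
Proof.
move=> k0 uk; have sk : 0 < Num.sqrt k by rewrite sqrtr_gt0.
rewrite -(ler_pXn2r (ltn0Sn 1)) ?nnegrE ?mulr_ge0 ?nrm_ge0 ?sqrtr_ge0//.
rewrite exprMn !sqr_nrm_ReIm sqr_sqrtr ?mulr_ge0 ?sqrtr_ge0// mulrDr.
have [mr mi ir ii] := L2_ReIm f.
have cE : 5 * Num.sqrt k = 4 * (Num.sqrt k)^-1 * k + (Num.sqrt k)^-1^-1.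
  have kq : k = Num.sqrt k ^+ 2 by rewrite sqr_sqrtr// ltW.
  by rewrite invrK [X in _ * X + _]kq; field; rewrite gt_eqF.
rewrite cE; apply: lerD.
- under eq_Rintegral do rewrite [L2fun _ _]graphon_opE /=.
  apply: sqr_kernel_op_le => //; last by rewrite invr_gt0.
  by move=> S T; exact: cutnorm_le.
- under eq_Rintegral do rewrite [L2fun _ _]graphon_opE /=.
  apply: sqr_kernel_op_le => //; last by rewrite invr_gt0.
  by move=> S T; exact: cutnorm_le.
Qed.

End L2_operator.

Lemma L2op_sub (u v w : X * X -> R) (ku : kernel u) (kv : kernel v) (kw : kernel w) f :
  (forall p, w p = v p - u p) -> L2op kv f - L2op ku f = L2op kw f.
Proof.
move=> wE; apply: val_inj; apply/funext => x.
change (graphon_op mu v f x - graphon_op mu u f x = graphon_op mu w f x).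
rewrite !graphon_opE.
have [mr mi ir ii] := L2_ReIm f.
have ir1 := integrable_of_sqr mr ir; have ii1 := integrable_of_sqr mi ii.
have KB a : mu.-integrable setT (EFin \o a) ->
    kernel_op v a x - kernel_op u a x = kernel_op w a x.
  move=> ia; rewrite /kernel_op -RintegralB//.
  - by apply: eq_Rintegral => y _; rewrite wE mulrBl.
  - exact: integrable_section kv.1 kv.2 ia.
  - exact: integrable_section ku.1 ku.2 ia.
by apply: complex_ext => /=; rewrite KB.
Qed.

End graphon_operator.

(** * Spectral decomposition of an adjacency matrix and bounds on its eigenvalues *)

Section graph_spectrum.
Context (R : realType) (N : nat).
Implicit Types v w : 'rV[R[i]]_N.

Let cdotDl v w z : cdot (v + w) z = cdot v z + cdot w z.
Proof. by rewrite /cdot -big_split/=; apply: eq_bigr => k _; rewrite mxE mulrDl. Qed.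

Let cdotZl a v w : cdot (a *: v) w = a * cdot v w.
Proof. by rewrite /cdot mulr_sumr; apply: eq_bigr => k _; rewrite mxE mulrA. Qed.

Let cdotJ v w : cdot w v = (cdot v w)^*.
Proof.
rewrite /cdot rmorph_sum; apply: eq_bigr => k _.
by rewrite rmorphM/= conjCK mulrC.
Qed.

Let cdot_pos v : 0 <= Re (cdot v v).
Proof. by rewrite cRe_sum sumr_ge0// => k _; rewrite mulcJ /= sqr_ge0. Qed.

Definition cdot_sip : semi_inner 'rV[R[i]]_N := SemiInner cdotDl cdotZl cdotJ cdot_pos.

Lemma sqr_nrm_cdot v : nrm cdot_sip v ^+ 2 = \sum_(k < N) normc (v 0 k) ^+ 2.
Proof. by rewrite sqr_nrm cRe_sum; apply: eq_bigr => k _; rewrite mulcJ. Qed.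

Lemma cdot_delta v k : cdot v (delta_mx 0 k) = v 0 k.
Proof.
rewrite /cdot (bigD1 k)//= big1 => [|l lk]; rewrite mxE ?eqxx/=.
  by rewrite addr0 rmorph1 mulr1.
by rewrite (negPf lk) rmorph0 mulr0.
Qed.

Context (G : sgraph N) (lam : int -> R) (phi : int -> 'rV[R[i]]_N).
Hypotheses (hlam : graph_eigenvalues G lam) (hphi : orthonormal_eigenvectors G lam phi).
Local Notation A := (adjmx R G).

Lemma adjmxC k l : A l k = A k l.
Proof. by rewrite !mxE adj_sym. Qed.

Lemma adjmx_conj k l : (A k l)^* = A k l.
Proof. by rewrite mxE rmorph_nat. Qed.

Lemma row_mul_adjmx v k : (v *m A) 0 k = cdot v (row k A).
Proof.
rewrite mxE; apply: eq_bigr => l _.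
by rewrite [row k A 0 l]mxE adjmx_conj adjmxC.
Qed.

(** The |i| indices between 0 and i, with i included. They carry the sign of i, so their eigenvalues
    are at least as large in modulus as that of i. *)
Let seg (i : int) : seq int := if 0 < i then map Posz (iota 1 (absz i))
  else map Negz (iota 0 (absz i)).

Let seg_uniq i : uniq (seg i).
Proof. by rewrite /seg; case: ifP => _; rewrite map_inj_uniq ?iota_uniq// => ? ? []. Qed.

Let size_seg i : size (seg i) = absz i.
Proof. by rewrite /seg; case: ifP => _; rewrite size_map size_iota. Qed.

Let seg_le i j : i != 0 -> j \in seg i -> j != 0 /\ lam i ^+ 2 <= lam j ^+ 2.
Proof.
have [[op on] _] := hlam; rewrite /seg; case: ifP => i0 ni /mapP[m].
  rewrite mem_iota => /andP[m0 mi] ->; split; first by case: m m0 {mi}.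
  have mi' : m%:Z <= i by lia.
  have /andP[i1 i2] := op m%:Z i (ltac:(by lia)) mi'.
  by rewrite ler_pXn2r ?nnegrE// (le_trans i1).
rewrite mem_iota add0n => /andP[_ mi] ->; split=> //.
have mi' : i <= Negz m by lia.
have /andP[i1 i2] := on (Negz m) i (ltac:(by [])) mi'.
rewrite -[leLHS]sqrrN -[leRHS]sqrrN ler_pXn2r ?nnegrE ?oppr_ge0 ?lerN2//.
exact: le_trans i1 i2.
Qed.

Let seg_nonzero i j : nonzero_index lam i -> j \in seg i -> nonzero_index lam j.
Proof.
move=> [i0 li0] /(seg_le i0)[j0 lij]; split=> //.
apply: contraTneq lij => ->; rewrite expr0n/= -ltNge.
by rewrite exprn_even_gt0.
Qed.

Lemma nonzero_orthonormal (r : seq int) : (forall i, i \in r -> nonzero_index lam i) ->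
  orthonormal_on cdot_sip r phi.
Proof. by move=> hr i j /hr hi /hr hj; exact: hphi.2. Qed.

(** The |i| eigenvectors of [seg i] are orthonormal in dimension N. Their squared coordinates sum to
    |i| when grouped by eigenvector, and to at most N when grouped by coordinate, by Bessel's
    inequality for the standard basis. *)
Lemma nonzero_index_le i : nonzero_index lam i -> (absz i <= N)%N.
Proof.
move=> hi; have hr j := @seg_nonzero i j hi.
have on := nonzero_orthonormal hr.
have : \sum_(k < N) \sum_(j <- seg i)
    normc (cdot_sip (delta_mx 0 k) (phi j)) ^+ 2 <= \sum_(k < N) 1.
  apply: ler_sum => k _; apply: le_trans (bessel (seg_uniq i) on _) _.
  by rewrite sqr_nrm /= cdot_delta mxE !eqxx.
rewrite exchange_big/= (eq_big_seq (fun=> 1)) => [|j jr]; last first.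
  have := nrm_orthonormal on jr => /(congr1 (fun x => x ^+ 2)).
  rewrite sqr_nrm_cdot expr1n => <-; apply: eq_bigr => k _.
  by rewrite cdotJ normc_conj cdot_delta.
rewrite big_const_seq count_predT iter_addr addr0 size_seg.
by rewrite sumr_const card_ord ler_nat.
Qed.

(** The left side is at most the sum of lam j ^ 2 over [seg i]. Since lam j phi j = phi j A, this is
    the sum of squared coefficients of the rows of A; Bessel's inequality bounds it by the sum of
    the squared entries of A, at most N^2. *)
Lemma graph_eigenvalue_bound i : i != 0 -> lam i ^+ 2 * (absz i)%:R <= N%:R ^+ 2.
Proof.
move=> i0; have [li0|li0] := eqVneq (lam i) 0.
  by rewrite li0 expr0n mul0r sqr_ge0.
have hr j := @seg_nonzero i j (conj i0 li0).
have on := nonzero_orthonormal hr.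
apply: (@le_trans _ _ (\sum_(j <- seg i) lam j ^+ 2)).
  have -> : lam i ^+ 2 * (absz i)%:R = \sum_(j <- seg i) lam i ^+ 2.
    by rewrite big_const_seq count_predT iter_addr addr0 size_seg mulr_natr.
  rewrite big_seq_cond [leRHS]big_seq_cond.
  by apply: ler_sum => j /andP[/(seg_le i0)[]].
have -> : \sum_(j <- seg i) lam j ^+ 2 =
    \sum_(k < N) \sum_(j <- seg i) normc (cdot_sip (row k A) (phi j)) ^+ 2.
  rewrite exchange_big/=; apply: eq_big_seq => j jr.
  have := nrm_orthonormal on jr => /(congr1 (fun x => (`|lam j| * x) ^+ 2)).
  rewrite mulr1 real_normK ?num_real// => <-.
  rewrite -normc_real -nrmZ sqr_nrm_cdot; apply: eq_bigr => k _.
  by rewrite cdotJ normc_conj -row_mul_adjmx (hphi.1 _ (hr _ jr)).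
apply: (@le_trans _ _ (\sum_(k < N) N%:R)); last first.
  by rewrite sumr_const card_ord expr2 mulr_natr.
apply: ler_sum => k _; apply: le_trans (bessel (seg_uniq i) on _) _.
rewrite sqr_nrm_cdot; apply: (@le_trans _ _ (\sum_(l < N) 1)).
  apply: ler_sum => l _; rewrite !mxE; case: (adj G k l).
    by rewrite Normc.normc1 expr1n.
  by rewrite Normc.normc0 expr0n.
by rewrite sumr_const card_ord.
Qed.

Definition nonzero_seq : seq int := [seq i <- int_ball N | lam i != 0].

Lemma nonzero_seq_uniq : uniq nonzero_seq.
Proof. by rewrite filter_uniq// int_ball_uniq. Qed.

Lemma mem_nonzero_seq i : (i \in nonzero_seq) = (i != 0) && (lam i != 0).
Proof.
rewrite mem_filter mem_int_ball andbC; case: eqVneq => //= i0.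
case: eqVneq => [|li0]; rewrite ?andbF ?andbT//.
exact: nonzero_index_le.
Qed.

Lemma nonzero_seq_orthonormal : orthonormal_on cdot_sip nonzero_seq phi.
Proof.
by apply: nonzero_orthonormal => i; rewrite mem_nonzero_seq => /andP[].
Qed.

Let Q := spectralmx A.
Let dd := spectral_diag A.

Let A_herm : A \is hermsymmx.
Proof.
apply/is_hermitianmxP; rewrite expr0 scale1r; apply/matrixP => k l.
by rewrite !mxE rmorph_nat adj_sym.
Qed.

Let A_normal : A = invmx Q *m diag_mx dd *m Q.
Proof. exact/orthomx_spectralP/hermitian_normalmx. Qed.

Let row_Q k : row k Q *m A = dd 0 k *: row k Q.
Proof.
rewrite -row_mul [in Q *m A]A_normal !mulmxA mulmxV ?spectral_unit// mul1mx.
by rewrite mul_diag_mx; apply/rowP => j; rewrite !mxE.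
Qed.

(** The [phi i] with lam i = c are orthonormal, and by [hlam] their number is the rank of the
    c-eigenspace; hence they span it and e is a combination of them. *)
Let eigen_span (c : R) e w : c != 0 -> e *m A = c%:C *: e ->
  (forall i, i \in nonzero_seq -> cdot w (phi i) = 0) -> cdot w e = 0.
Proof.
move=> c0 eA wphi; have [_ /(_ c c0)[sc [usc msc rkE]]] := hlam.
have scP (j : 'I_(size sc)) : nonzero_index lam (nth 0 sc j) /\ lam (nth 0 sc j) = c.
  have := mem_nth 0 (ltn_ord j); rewrite msc => /andP[j0 /eqP lj].
  by split => //; split => //; rewrite lj.
pose F := \matrix_(j < size sc) phi (nth 0 sc j).
have Funit : F \is unitarymx.
  apply/unitarymxP/matrixP => j j'; rewrite !mxE.
  transitivity (cdot (phi (nth 0 sc j)) (phi (nth 0 sc j'))).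
    by apply: eq_bigr => k _; rewrite !mxE.
  rewrite hphi.2; [|exact: (scP j).1|exact: (scP j').1].
  by rewrite nth_uniq.
have FE : (F <= eigenspace A c%:C)%MS.
  apply/row_subP => j; apply/eigenspaceP; rewrite rowK.
  by rewrite (hphi.1 _ (scP j).1) (scP j).2.
have EF : (eigenspace A c%:C <= F)%MS.
  by rewrite -(mxrank_leqif_sup FE).2 mxrank_unitary// rkE.
have /submxP[B ->] : (e <= F)%MS by apply: submx_trans EF; exact/eigenspaceP.
rewrite mulmx_sum_row -[cdot _ _]/(cdot_sip _ _) dot_sumr big1// => j _.
rewrite dotZr rowK /= wphi ?mulr0// mem_nonzero_seq.
by have [[-> ->] _] := scP j.
Qed.

(** In the unitary diagonalisation of A, the coordinates of w are its inner products with the rows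
    of [Q], which are eigenvectors: the eigenvalue is 0, or [eigen_span] makes the coordinate 0. *)
Let annihilated w : (forall i, i \in nonzero_seq -> cdot w (phi i) = 0) -> w *m A = 0.
Proof.
move=> wphi; rewrite A_normal invmx_unitary ?spectral_unitarymx// !mulmxA.
rewrite [X in X *m Q](_ : _ = 0) ?mul0mx//; apply/rowP => k.
rewrite mul_mx_diag !mxE.
have -> : \sum_(j < N) w 0 j * (Q^T ^ Num.conj)%sesqui j k = cdot w (row k Q).
  by apply: eq_bigr => j _; rewrite !mxE.
have [->|dk] := eqVneq (dd 0 k) 0; first by rewrite mulr0.
(* [lam] takes real values, so the diagonal entry must be known to be real; this is where A being
   Hermitian enters. *)
have /mxOverP/(_ 0 k)/complex_realP[c dc] := hermitian_spectral_diag_real A_herm.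
rewrite (@eigen_span c) ?mul0r//.
- by apply: contraNneq dk => c0; rewrite /dd dc c0.
- by rewrite row_Q /dd dc.
Qed.

Lemma adjmx_spectral v : v *m A =
  \sum_(i <- nonzero_seq) ((lam i)%:C * cdot v (phi i)) *: phi i.
Proof.
pose p := \sum_(i <- nonzero_seq) cdot v (phi i) *: phi i.
have : (v - p) *m A = 0.
  apply: annihilated => i is_.
  exact: (dot_sub_proj nonzero_seq_uniq nonzero_seq_orthonormal v is_).
rewrite mulmxBl => /eqP; rewrite subr_eq0 => /eqP ->.
rewrite mulmx_suml; apply: eq_big_seq => i; rewrite mem_nonzero_seq => /andP[i0 li0].
by rewrite -scalemxAl hphi.1// scalerA mulrC.
Qed.

End graph_spectrum.

(** * The embedding v -> v^X of graph signals into L^2(X) and the operator of a step graphon *)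

Section step_signals.
Context d (X : measurableType d) (R : realType) (mu : probability X R).
Context (sigma : R -> X) (A1 : set R) (A2 : set X).
Hypothesis hsigma : iso_mod0 mu sigma A1 A2.
Context (N : nat).
Local Notation D := (L2sip mu).
Local Notation block := (@block R N X sigma A1).
Local Notation step_signal := (@step_signal R N X sigma A1).

Let itv (k : 'I_N) : set R := `[k%:R / N%:R, k.+1%:R / N%:R[%classic.

Let N_gt0 (k : 'I_N) : 0 < N%:R :> R.
Proof. by rewrite ltr0n (leq_ltn_trans _ (ltn_ord k)). Qed.

Let itv01 k : itv k `<=` `[0, 1]%classic.
Proof.
move=> x; rewrite /itv /= !in_itv/= => /andP[kx xk]; apply/andP; split.
  by apply: le_trans kx; rewrite divr_ge0.
apply: le_trans (ltW xk) _; rewrite ler_pdivrMr ?N_gt0// mul1r ler_nat.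
exact: ltn_ord.
Qed.

(** Brings the block into the form in which the last clause of [iso_mod0] computes measures. *)
Let blockE k : block k = sigma @` ((`[0, 1]%classic `\` A1) `&` itv k).
Proof.
congr (_ @` _); apply/seteqP; split=> [x [xk xA]|x [[_ xA] xk]] //.
by split; [split => //; exact: (@itv01 k)|].
Qed.

Lemma measurable_block k : measurable (block k).
Proof.
have [_ _ _ _ h] := hsigma; rewrite blockE.
by apply: (h (itv k) _).1; exact: measurable_itv.
Qed.

Lemma mu_block k : mu (block k) = (N%:R^-1)%:E.
Proof.
have [_ _ _ _ h] := hsigma; rewrite blockE.
rewrite (h (itv k) _).2; last exact: measurable_itv.
rewrite (setIidr (@itv01 k)) lebesgue_measure_itv/= lte_fin.
rewrite ltr_pM2r ?invr_gt0 ?N_gt0// ltr_nat ltnSn -EFinB -mulrBl -natrB//.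
by rewrite subSnn mul1r.
Qed.

Lemma block_inj k l x : block k x -> block l x -> k = l.
Proof.
have [_ _ [_ inj _] _ _] := hsigma.
rewrite !blockE => -[t [tD tk] <-] [t' [tD' tl] e].
have {e} tt' : t' = t by apply: inj => //; rewrite ?inE.
move: tl; rewrite {}tt' => tl; move: tk tl; rewrite /itv /= !in_itv/=.
move=> /andP[k1 k2] /andP[l1 l2]; apply/val_inj/eqP; rewrite eqn_leq.
have N0 := N_gt0 k.
apply/andP; split; rewrite -ltnS -(ltr_nat R) -(ltr_pM2r (_ : 0 < N%:R^-1)) ?invr_gt0//.
- exact: le_lt_trans k1 l2.
- exact: le_lt_trans l1 k2.
Qed.

Definition block_ind (k : 'I_N) (x : X) : R[i] := (\1_(block k) x)%:C.

Lemma block_indM k l x : k != l -> block_ind k x * block_ind l x = 0.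
Proof.
rewrite /block_ind !indicE => kl; have [xk|xk] := boolP (x \in block k); last first.
  by rewrite mul0r.
have [xl|xl] := boolP (x \in block l); last by rewrite mulr0.
by move: kl; rewrite (block_inj (set_mem xk) (set_mem xl)) eqxx.
Qed.

Lemma sqn_block_ind k : sqn (block_ind k) = \1_(block k).
Proof.
apply/funext => x; rewrite /sqn normc_real indicE.
by case: (_ \in _); rewrite ?normr1 ?normr0 ?expr1n ?expr0n.
Qed.

Lemma L2_block_ind k : L2 mu (block_ind k).
Proof.
have m1 : measurable_fun setT (\1_(block k) : X -> R).
  by apply: measurable_indic; exact: measurable_block.
apply/L2P; split; first by split => //; exact: measurable_cst.
rewrite sqn_block_ind; apply: (integrable_bounded mu (M := 1)) => // x.
by rewrite indicE; case: (_ \in _); rewrite ?normr1 ?normr0.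
Qed.

Definition block_L2 k : L2type mu := toL2 (L2_block_ind k).

Lemma dot_block k l : D (block_L2 k) (block_L2 l) = (N%:R^-1 *+ (k == l))%:C.
Proof.
have [->|kl] := eqVneq k l.
  have e : (nrm D (block_L2 l) ^+ 2)%:E = (N%:R^-1)%:E :> \bar R.
    rewrite -sqn_integralE (_ : L2fun _ = block_ind l)// sqn_block_ind.
    rewrite integral_indic//; last exact: measurable_block.
    by rewrite setIT; exact: mu_block.
  by rewrite dotxx mulr1n; case: e => ->.
rewrite mulr0n; transitivity (cintegral mu (fun=> 0)).
  congr cintegral; apply/funext => x; rewrite conjC_realC.
  exact: block_indM.
by rewrite /cintegral /= Rintegral_cst// mul0r.
Qed.

Definition step_L2 (v : 'rV[R[i]]_N) : L2type mu :=
  \sum_(k < N) ((Num.sqrt N%:R)%:C * v 0 k) *: block_L2 k.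

Lemma step_L2E v x : step_L2 v x = step_signal v x.
Proof.
rewrite L2fun_sum; apply: eq_bigr => k _.
change ((Num.sqrt N%:R)%:C * v 0 k * block_ind k x =
  ((Num.sqrt N%:R)%:C * v 0 k) *+ (x \in block k)).
by rewrite /block_ind indicE; case: (x \in _); rewrite ?mulr1 ?mulr0.
Qed.

(** The row on the right is the adjoint of v -> v^X applied to f. *)
Lemma dot_step f v : D f (step_L2 v) =
  cdot (\row_l ((Num.sqrt N%:R)%:C * D f (block_L2 l))) v.
Proof.
rewrite dot_sumr; apply: eq_bigr => k _.
by rewrite dotZr cconjM conjC_realC mxE mulrAC.
Qed.

Lemma sqrtNM (k : 'I_N) : (Num.sqrt N%:R)%:C * (Num.sqrt N%:R)%:C = N%:R%:C :> R[i].
Proof. by rewrite -rmorphM/= -expr2 sqr_sqrtr. Qed.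

(** The factor sqrt N in v^X compensates the mass 1 / N of a block, so v -> v^X is an isometry:
    eigenvectors stay orthonormal and graph Fourier coefficients become inner products in L^2(X). *)
Lemma dot_step_step v w : D (step_L2 v) (step_L2 w) = cdot v w.
Proof.
rewrite dot_step; apply: eq_bigr => k _; rewrite mxE; congr (_ * _).
rewrite dot_suml (eq_bigr (fun l => if l == k then
    (Num.sqrt N%:R)%:C * v 0 k * (N%:R^-1)%:C else 0)) => [|l _]; last first.
  rewrite dotZl dot_block; case: eqVneq => [->|_]; first by rewrite mulr1n.
  by rewrite mulr0n mulr0.
rewrite -big_mkcond big_pred1_eq mulrA mulrA sqrtNM// mulrAC -rmorphM/=.
by rewrite divff ?rmorph1 ?mul1r// gt_eqF// (N_gt0 k).
Qed.

Lemma step_L2_lin c v w : step_L2 (c *: v + w) = c *: step_L2 v + step_L2 w.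
Proof.
rewrite /step_L2 scaler_sumr -big_split/=; apply: eq_bigr => k _.
by rewrite !mxE mulrDr scalerDl scalerA mulrCA.
Qed.

Lemma step_L2_sum (I : Type) (r : seq I) (c : I -> R[i]) (v : I -> 'rV[R[i]]_N) :
  step_L2 (\sum_(i <- r) c i *: v i) = \sum_(i <- r) c i *: step_L2 (v i).
Proof.
elim: r => [|i r IH]; last by rewrite !big_cons step_L2_lin IH.
by rewrite !big_nil /step_L2 big1// => k _; rewrite mxE mulr0 scale0r.
Qed.

Context (G : sgraph N).
Local Notation wG := (graph_graphon (R := R) sigma A1 G).

Lemma graph_graphonE x y : wG (x, y) =
  \sum_(k < N) \sum_(l < N) (adj G k l)%:R * (\1_(block k) x * \1_(block l) y).
Proof.
rewrite /graph_graphon indicE.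
have ind0 (z : X) k : ~ block k z -> \1_(block k) z = 0 :> R.
  by move=> kz; rewrite indicE memNset.
have ind1 (z : X) k : block k z -> \1_(block k) z = 1 :> R.
  by move=> kz; rewrite indicE mem_set.
have [[k xk]|nx] := pselect (exists k, block k x); last first.
  rewrite memNset => [|[k [l [_ /= xk _]]]]; last by apply: nx; exists k.
  rewrite big1// => k _; rewrite big1// => l _.
  by rewrite (ind0 x) ?mul0r ?mulr0// => xk; apply: nx; exists k.
rewrite (bigD1 k)//= [X in _ + X]big1 ?addr0; last first.
  move=> k' kk'; rewrite big1// => l _; rewrite (ind0 x) ?mul0r ?mulr0// => xk'.
  by move: kk'; rewrite (block_inj xk xk') eqxx.
have [[l yl]|ny] := pselect (exists l, block l y); last first.
  rewrite memNset => [|[k' [l [_ /= _ yl]]]]; last by apply: ny; exists l.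
  rewrite big1// => l _.
  by rewrite (ind0 y) ?mulr0// => yl; apply: ny; exists l.
rewrite (bigD1 l)//= [X in _ + X]big1 ?addr0; last first.
  move=> l' ll'; rewrite (ind0 y) ?mulr0// => yl'.
  by move: ll'; rewrite (block_inj yl yl') eqxx.
rewrite (ind1 x k xk) (ind1 y l yl) !mulr1; congr (_%:R); congr nat_of_bool.
apply/idP/idP => [/set_mem[k' [l' [/= akl xk' yl']]]|akl].
  by rewrite (block_inj xk xk') (block_inj yl yl').
by apply/mem_set; exists k, l.
Qed.

Lemma graph_kernel : kernel wG.
Proof.
split; last first.
  by move=> p; rewrite /graph_graphon indicE; case: (_ \in _); rewrite ?normr1 ?normr0.
rewrite (_ : graph_graphon _ _ _ = fun p => \sum_(k < N) \sum_(l < N)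
    (adj G k l)%:R * (\1_(block k) p.1 * \1_(block l) p.2)); last first.
  by apply/funext => -[x y]; exact: graph_graphonE.
apply: measurable_sum => k; apply: measurable_sum => l.
apply: measurable_funM => //; apply: measurable_funM;
  by apply: measurableT_comp => //; apply: measurable_indic; exact: measurable_block.
Qed.

Lemma cintegral_sum (I : Type) (r : seq I) (c : I -> R[i]) (g : I -> X -> R[i]) :
  (forall i, cintegrable mu (g i)) ->
  cintegrable mu (fun x => \sum_(i <- r) c i * g i x) /\
  cintegral mu (fun x => \sum_(i <- r) c i * g i x) =
  \sum_(i <- r) c i * cintegral mu (g i).
Proof.
move=> ig; elim: r => [|i r [IH1 IH2]].
  rewrite (_ : (fun x => _) = fun=> 0); last by apply/funext => x; rewrite big_nil.
  rewrite big_nil; split; first by split; exact: integrable0.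
  by rewrite /cintegral /= Rintegral_cst// mul0r.
have ic : cintegrable mu (fun x => c i * g i x).
  have [ir ii] := ig i; split.
  - have := integrableDr (integrableZr (Re (c i)) ir) (integrableZr (- Im (c i)) ii).
    by congr (_.-integrable _ _); apply/funext => x /=; rewrite cReM mulNr.
  - have := integrableDr (integrableZr (Re (c i)) ii) (integrableZr (Im (c i)) ir).
    by congr (_.-integrable _ _); apply/funext => x /=; rewrite cImM.
rewrite (_ : (fun x => _) = fun x => c i * g i x + \sum_(j <- r) c j * g j x); last first.
  by apply/funext => x; rewrite big_cons.
rewrite big_cons -IH2 -cintegralZ// -cintegralD//; split=> //.
have [[r1 i1] [r2 i2]] := (ic, IH1); split.
- have := integrableDr r1 r2.
  by congr (_.-integrable _ _); apply/funext => x /=; rewrite cReD.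
- have := integrableDr i1 i2.
  by congr (_.-integrable _ _); apply/funext => x /=; rewrite cImD.
Qed.

Lemma graph_L2opE (f : L2type mu) : L2op graph_kernel f =
  \sum_(k < N) (\sum_(l < N) (adj G k l)%:R * D f (block_L2 l)) *: block_L2 k.
Proof.
apply: val_inj; apply/funext => x.
change (graphon_op mu wG f x =
  (\sum_(k < N) (\sum_(l < N) (adj G k l)%:R * D f (block_L2 l)) *: block_L2 k) x).
rewrite L2fun_sum.
pose g (kl : 'I_N * 'I_N) y := f y * (block_ind kl.2 y)^*.
have ig kl : cintegrable mu (g kl).
  exact: cintegrable_mulJ (L2typeP f) (L2_block_ind kl.2).
pose c (kl : 'I_N * 'I_N) := (adj G kl.1 kl.2)%:R * block_ind kl.1 x.
transitivity (cintegral mu (fun y => \sum_(kl <- index_enum _) c kl * g kl y)).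
  congr cintegral; apply/funext => y; rewrite graph_graphonE pair_big/=.
  rewrite rmorph_sum mulr_suml; apply: eq_bigr => -[k l] _.
  rewrite /c /g /= !rmorphM/= rmorph_nat conjC_realC; ring.
rewrite (cintegral_sum _ _ ig).2 -(pair_big xpredT xpredT (fun k l => c (k, l) * cintegral mu (g (k, l))))/=.
apply: eq_bigr => k _.
change (\sum_(l < N) c (k, l) * cintegral mu (g (k, l)) =
  (\sum_(l < N) (adj G k l)%:R * D f (block_L2 l)) * block_ind k x).
by rewrite mulr_suml; apply: eq_bigr => l _; rewrite /c /= mulrAC.
Qed.

Context (lam : int -> R) (phi : int -> 'rV[R[i]]_N).
Hypotheses (hlam : graph_eigenvalues G lam) (hphi : orthonormal_eigenvectors G lam phi).

(** With J the isometry v -> v^X, the operator is 1 / N times the composite of the adjoint of J,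
    then A, then J, so the decomposition of A carries over with eigenvalues divided by N. *)
Lemma graph_L2op_spectral (f : L2type mu) : L2op graph_kernel f =
  \sum_(i <- nonzero_seq N lam)
    ((lam i / N%:R)%:C * D f (step_L2 (phi i))) *: step_L2 (phi i).
Proof.
rewrite graph_L2opE; pose v := \row_l ((Num.sqrt N%:R)%:C * D f (block_L2 l)).
transitivity ((N%:R^-1)%:C *: step_L2 (v *m adjmx R G)).
  rewrite scaler_sumr; apply: eq_bigr => k _; rewrite scalerA; congr (_ *: _).
  rewrite mxE !mulr_sumr; apply: eq_bigr => l _; rewrite !mxE adj_sym.
  rewrite [RHS](_ : _ = (N%:R^-1)%:C * ((Num.sqrt N%:R)%:C * (Num.sqrt N%:R)%:C) *
    ((adj G l k)%:R * D f (block_L2 l))); last by ring.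
  rewrite sqrtNM// -rmorphM/= mulVf ?rmorph1 ?mul1r//.
  by rewrite gt_eqF// (N_gt0 k).
rewrite (adjmx_spectral hlam hphi) step_L2_sum scaler_sumr; apply: eq_bigr => i _.
rewrite scalerA dot_step -/v; congr (_ *: _).
by rewrite mulrA -rmorphM/= [_^-1 * _]mulrC.
Qed.

End step_signals.

(** * The graphon instance and the convergence of Fourier transforms *)

Section fourier_convergence.
Context (R : realType) (d : measure_display)
  (X : measurableType d) (mu : probability X R)
  (sigma : R -> X) (A1 : set R) (A2 : set X)
  (hsigma : iso_mod0 mu sigma A1 A2)
  (w : X * X -> R) (hw : graphon mu w)
  (f : X -> R[i]) (hf : L2 mu f)
  (N : nat -> nat) (G : forall n, sgraph (N n))
  (fs : forall n, 'rV[R[i]]_(N n))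
  (hconv : converges_in_norm mu
     (fun n => graph_graphon sigma A1 (G n))
     (fun n => step_signal sigma A1 (fs n)) w f)
  (lam nu : int -> R)
  (hlam : graphon_eigenvalues mu w lam)
  (hnu : graphon_distinct_eigenvalues mu w nu)
  (lamG : nat -> int -> R) (phi : forall n, int -> 'rV[R[i]]_(N n))
  (hlamG : forall n, graph_eigenvalues (G n) (lamG n))
  (hphi : forall n, orthonormal_eigenvectors (G n) (lamG n) (phi n)).

Local Notation D := (L2sip mu).

Lemma cvge0P (a : nat -> \bar R) : (forall n, (0 <= a n)%E) ->
  (forall e, 0 < e -> \forall n \near \oo, (a n <= e%:E)%E) ->
  a n @[n --> \oo] --> 0%E.
Proof.
move=> a0 h; apply/fine_cvgP; split.
  apply: filterS (h 1 ltr01) => n an.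
  by rewrite fin_real// (lt_le_trans _ (a0 n))// (le_lt_trans an) ?ltry.
apply/cvg0P => [n|e e0]; first exact: fine_ge0.
apply: filterS (h e e0) => n; have := a0 n.
by rewrite /comp; case: (a n) => // r _; rewrite lee_fin.
Qed.

(** Serves to make the cut norm finite, so that [fine] loses nothing. *)
Lemma cutnorm_le1 (u : X * X -> R) : kernel u -> (cutnorm mu u <= 1)%E.
Proof.
move=> [mu_ u1]; apply: ge_ereal_sup => _ [[S T] /= [mS mT] <-].
have mST : measurable (S `*` T) by exact: measurableX.
have muST : measurable_fun (S `*` T) (EFin \o u).
  by apply: measurable_funTS; exact/measurable_EFinP.
apply: le_trans (le_abse_integral _ mST muST) _.
apply: (@le_trans _ _ (\int[(mu \x mu)%E]_(p in S `*` T) cst 1%E p)%E).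
  apply: ge0_le_integral => //.
  - exact: measurableT_comp.
  - by move=> p _; rewrite /= lee_fin.
rewrite integral_cst//= mul1e product_measure1E// -(mule1 1%E).
by apply: lee_pmul => //; exact: probability_le1.
Qed.

Lemma kernel_w : kernel w.
Proof.
by have [mw w01 _] := hw; split=> // p; have /andP[? ?] := w01 p; rewrite ger0_norm.
Qed.

Let kG n : kernel (graph_graphon sigma A1 (G n)) := graph_kernel hsigma (G n).

Let kB n : kernel (fun p => graph_graphon sigma A1 (G n) p - w p).
Proof.
have [[mg _] [mw _]] := (kG n, kernel_w).
split; first exact: measurable_funB.
move=> p; have [_ w01 _] := hw; have /andP[w0 w1] := w01 p.
have : 0 <= graph_graphon (R := R) sigma A1 (G n) p <= 1.
  by rewrite /graph_graphon indicE; case: (_ \in _); rewrite lexx ler01.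
by move=> /andP[g0 g1]; rewrite ler_norml; apply/andP; split; lra.
Qed.

Let cn n : R := fine (cutnorm mu (fun p => graph_graphon sigma A1 (G n) p - w p)).

Let cutnorm_ge0 (u : X * X -> R) : (0 <= cutnorm mu u)%E.
Proof.
apply: (@le_trans _ _ `|\int[(mu \x mu)%E]_(p in set0 `*` set0) (u p)%:E|%E) => //.
by apply: ereal_sup_ubound; exists (set0, set0) => //=.
Qed.

(** [nrm_L2op_le] asks for a positive bound, while the cut norm may vanish; adding the null sequence
    [harmonic] ensures positivity. *)
Let kk n : R := cn n + harmonic n.
Let eps n : R := Num.sqrt (5 * Num.sqrt (kk n)).

Let kk_gt0 n : 0 < kk n.
Proof. by rewrite ltr_wpDl ?fine_ge0 ?cutnorm_ge0// invr_gt0. Qed.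

Let cutnorm_kk n :
  (cutnorm mu (fun p => graph_graphon sigma A1 (G n) p - w p)%R <= (kk n)%:E)%E.
Proof.
apply: (@le_trans _ _ (cn n)%:E); last by rewrite lee_fin lerDl invr_ge0.
rewrite fineK// fin_real// (lt_le_trans _ (cutnorm_ge0 _))//=.
by apply: le_lt_trans (cutnorm_le1 (kB n)) _; exact: ltry.
Qed.

Let eps_cvg : eps n @[n --> \oo] --> 0.
Proof.
have c0 : cn n @[n --> \oo] --> (0 : R) by have [/fine_cvgP[_]] := hconv.
have k0 : kk n @[n --> \oo] --> (0 : R).
  by rewrite -(addr0 0); exact: (cvgD c0 (@cvg_harmonic R)).
have s0 : Num.sqrt (kk n) @[n --> \oo] --> (0 : R).
  by rewrite -[X in _ --> X]sqrtr0; exact: (continuous_cvg _ (@sqrt_continuous R 0) k0).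
have s5 : 5 * Num.sqrt (kk n) @[n --> \oo] --> (0 : R).
  by rewrite -[X in _ --> X](mulr0 5); exact: (cvgM (cvg_cst _) s0).
by rewrite -[X in _ --> X]sqrtr0; exact: (continuous_cvg _ (@sqrt_continuous R 0) s5).
Qed.

Let T : L2type mu -> L2type mu := L2op kernel_w.
Let la n i : R := lamG n i / (N n)%:R.
Let s n := nonzero_seq (N n) (lamG n).
Let step (n : nat) (v : 'rV[R[i]]_(N n)) : L2type mu := step_L2 hsigma v.
Let stphi n i := step (phi n i).

Let mem_s n i : (i \in s n) = (i != 0) && (la n i != 0).
Proof.
rewrite (mem_nonzero_seq (hlamG n) (hphi n)); case: eqVneq => //= i0.
rewrite /la mulf_eq0 invr_eq0 pnatr_eq0 negb_or.
(* Division by [N n = 0] would turn the eigenvalue into 0; a nonzero eigenvalue at index i gives |i|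
   <= N n, which excludes this. *)
case: eqVneq => //= li0; apply/esym; rewrite -lt0n.
have := nonzero_index_le (hlamG n) (hphi n) (conj i0 li0).
by apply: leq_trans; rewrite absz_gt0.
Qed.

Lemma graphon_spectral_approx : spectral_approx D T la stphi s eps.
Proof.
split.
- exact: L2op_linear.
- by move=> n; exact: nonzero_seq_uniq.
- exact: mem_s.
- move=> n i j; rewrite !mem_s => /andP[i0 li0] /andP[j0 lj0].
  rewrite dot_step_step (hphi n).2//.
  + by split=> //; apply: contraNneq li0; rewrite /la => ->; rewrite mul0r.
  + by split=> //; apply: contraNneq lj0; rewrite /la => ->; rewrite mul0r.
- move=> n; have [[op on] _] := hlamG n.
  have N0 : 0 <= (N n)%:R^-1 :> R by rewrite invr_ge0.
  split=> i j i0 ij; rewrite /la.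
  + have /andP[l0 lij] := op i j i0 ij.
    by rewrite mulr_ge0//= ler_wpM2r.
  + have /andP[lij l0] := on i j i0 ij.
    by rewrite mulr_le0_ge0// andbT ler_wpM2r.
- move=> n i i0; have h := graph_eigenvalue_bound (hlamG n) (hphi n) i0.
  have -> : la n i ^+ 2 * (absz i)%:R = lamG n i ^+ 2 * (absz i)%:R / (N n)%:R ^+ 2.
    by rewrite /la exprMn exprVn mulrAC.
  (* For an empty graph the quotient is 0, division by 0 being 0. *)
  have [N0|Nn] := posnP (N n); first by rewrite N0 expr0n invr0 mulr0.
  by rewrite ler_pdivrMr ?mul1r// exprn_gt0// ltr0n.
- move=> n x.
  have -> : finite_rank D la stphi s n x = L2op (kG n) x.
    by rewrite (graph_L2op_spectral hsigma (hlamG n) (hphi n)).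
  rewrite nrmBC (L2op_sub kernel_w (kG n) (kB n))//.
  exact: nrm_L2op_le.
- exact: eps_cvg.
Qed.

Lemma eig_op_eigenspace c (v : L2type mu) :
  eig D T c v <-> op_eigenspace mu w c v.
Proof.
rewrite /eig nrm0_ceq; split=> [h|[_ h]].
  split; first exact: L2typeP.
  apply: filterS h => x /eqP; rewrite L2funB L2funZ subr_eq0 => /eqP.
  by [].
apply: filterS h => x h; rewrite L2funB L2funZ.
by apply/eqP; rewrite subr_eq0; apply/eqP.
Qed.

Lemma L2dim_sip_dim c n : L2dim mu (op_eigenspace mu w c) n -> sip_dim D (eig D T c) n.
Proof.
move=> [b [Vb bfree bspan]].
have Lb k : L2 mu (b k) by have [] := Vb k.
have lcE (c' : 'I_n -> R[i]) x :
    (\sum_(k < n) c' k *: toL2 (Lb k)) x = \sum_(k < n) c' k * b k x.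
  by rewrite L2fun_sum; apply: eq_bigr.
exists (fun k => toL2 (Lb k)); split.
- by move=> k; apply/eig_op_eigenspace; exact: Vb.
- move=> c' /nrm0_ceq h; apply: bfree; apply: filterS h => x.
  by rewrite lcE.
- move=> v /eig_op_eigenspace/bspan[c' h]; exists c'; apply/nrm0_ceq.
  by apply: filterS h => x vx; rewrite L2funB lcE vx subrr.
Qed.

Lemma enum_sip_dim : enum_with_mult (fun c => sip_dim D (eig D T c)) lam.
Proof.
have [olam h] := hlam; split=> // c /h[r [ur mr dr]].
by exists r; split => //; exact: L2dim_sip_dim.
Qed.

Lemma enum_distinct_eig :
  enum_distinct (fun c => exists2 v, eig D T c v & nrm D v <> 0) nu.
Proof.
have [onu h inj] := hnu; split=> // c c0; rewrite -h//; split.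
- move=> [v /eig_op_eigenspace ev v0]; exists v => // h0.
  by apply: v0; exact/nrm0_ceq.
- move=> [v ev v0]; have Lv : L2 mu v by have [] := ev.
  exists (toL2 Lv); first exact/eig_op_eigenspace.
  by move=> /nrm0_ceq.
Qed.

Let F : L2type mu := toL2 hf.

(** [orthproj] is an [xget], which falls back on 0 when no function qualifies; existence of a
    projection, from [is_proj_exists], guarantees that the chosen function has the defining
    property. *)
Lemma graphon_fourier_is_proj c : exists p : L2type mu,
  [/\ is_proj D T c F p & L2fun p = graphon_fourier mu w f c].
Proof.
have [q [eq Fq]] := is_proj_exists graphon_spectral_approx (@L2_complete _ _ _ mu) c F.
pose P : set (X -> R[i]) := [set p | op_eigenspace mu w c p /\
  forall v, op_eigenspace mu w c v -> L2dot mu (fun x => f x - p x) v = 0].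
have : P (graphon_fourier mu w f c).
  apply: xgetPex.
  exists (L2fun q); split; first exact/eig_op_eigenspace.
  move=> v ev; have Lv : L2 mu v by have [] := ev.
  exact: (Fq (toL2 Lv) ((eig_op_eigenspace _ (toL2 Lv)).2 ev)).
move=> [ep fp]; have Lp : L2 mu (graphon_fourier mu w f c) by have [] := ep.
exists (toL2 Lp); split => //; split; first exact/eig_op_eigenspace.
by move=> v /eig_op_eigenspace ev; exact: fp.
Qed.

Let fsF : cvgv D \oo (fun n => step (fs n)) F.
Proof.
have [_ /fine_cvgP[_]] := hconv; apply: cvg_trans; apply: near_eq_cvg.
apply: nearW => n; rewrite /comp.
rewrite (_ : (fun x => _) = step (fs n) - F :> (X -> R[i])); last first.
  by apply/funext => x; rewrite L2funB step_L2E.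
by rewrite L2norm_nrm.
Qed.

(** The sum over a set of indices becomes a sum over a list, and the isometry v -> v^X identifies
    the coefficients. *)
Lemma fourier_componentE c lv n : c != 0 -> uniq lv ->
  (forall i, (i \in lv) = (i != 0) && (lam i == c)) ->
  fourier_component sigma A1 lam c (lamG n) (fs n) (phi n) =
  component D stphi s lv n (step (fs n)).
Proof.
move=> c0 ulv mlv; apply/funext => x.
rewrite /fourier_component /component L2fun_sum.
have mem_both i : (i \in [seq i <- lv | i \in s n]) <->
    ([set i | nonzero_index lam i /\ lam i = c] `&` nonzero_index (lamG n)) i.
  rewrite mem_filter mlv /s (mem_nonzero_seq (hlamG n) (hphi n)); split.
    move=> /andP[/andP[i0 li0] /andP[_ /eqP lic]].
    by split; split => //; split => //; rewrite lic.
  by move=> [[[i0 _] lic] [_ li0]]; rewrite i0 li0 lic eqxx.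
have setE : [set i | nonzero_index lam i /\ lam i = c] `&` nonzero_index (lamG n) =
    [set` [seq i <- lv | i \in s n]].
  by apply/seteqP; split => i /=; rewrite mem_both.
rewrite setE fsbig_finite//= -[RHS]big_filter.
rewrite (perm_big [seq i <- lv | i \in s n]); last first.
  apply: uniq_perm; rewrite ?finmap.fset_uniq ?filter_uniq// => i.
  rewrite in_fset_set; last by exact: finite_seq.
  by rewrite mem_setE.
apply: eq_bigr => i _; rewrite -(step_L2E hsigma).
by rewrite /graph_fourier -(dot_step_step hsigma).
Qed.

Let levels_exist : exists lv : int -> seq int, (forall j, uniq (lv j)) /\
  (forall j, j != 0 -> nu j != 0 ->
     forall i, (i \in lv j) = (i != 0) && (lam i == nu j)).
Proof.
have /choice[lv hlv] : forall j, exists r, uniq r /\ (nu j != 0 ->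
    forall i, (i \in r) = (i != 0) && (lam i == nu j)).
  move=> j; have [nj|nj] := eqVneq (nu j) 0.
    by exists [::]; split => //; rewrite eqxx.
  by have [_ /(_ _ nj)[r [ur mr _]]] := hlam; exists r.
by exists lv; split => j; have [] := hlv j.
Qed.

Lemma fourier_component_cvg j : Zstar j -> nu j != 0 ->
  L2norm mu (fun x =>
    fourier_component sigma A1 lam (nu j) (lamG n) (fs n) (phi n) x
    - graphon_fourier mu w f (nu j) x) @[n --> \oo] --> 0%E.
Proof.
move=> j0 nj; have [lv [ulv mlv]] := levels_exist.
have [p [hp pE]] := graphon_fourier_is_proj (nu j).
have := component_cvg graphon_spectral_approx (@L2_complete _ _ _ mu) enum_sip_dim
  nj (ulv j) (mlv j j0 nj) fsF hp.
rewrite /cvgv => h.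
have : (nrm D (component D stphi s (lv j) n (step (fs n)) - p))%:E @[n --> \oo] --> 0%E.
  by apply: cvg_EFin => //; exact: nearW.
apply: cvg_trans; apply: near_eq_cvg; apply: nearW => n.
by rewrite -L2norm_nrm (fourier_componentE n nj (ulv j) (mlv j j0 nj)) -pE.
Qed.

(** The infinite sum is a supremum over finite sets of indices, so the estimate of
    [components_uniform], valid for all finite J at once, bounds it. *)
Lemma fourier_component_sum_cvg :
  ceq mu (graphon_fourier mu w f 0) (cst 0) ->
  \esum_(j in Zstar)
    (L2norm mu (fun x =>
       (fourier_component sigma A1 lam (nu j) (lamG n) (fs n) (phi n) x
        - graphon_fourier mu w f (nu j) x)%R) ^+ 2)%E
    @[n --> \oo] --> 0%E.
Proof.
move=> ker0; have [lv [ulv mlv]] := levels_exist.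
have /choice[p hp] := fun j => graphon_fourier_is_proj (nu j).
have [p0 [hp0 p0E]] := graphon_fourier_is_proj 0.
have np0 : nrm D p0 = 0 by apply/nrm0_ceq; rewrite p0E.
pose x n j := component D stphi s (lv j) n (step (fs n)).
have termE n j : j != 0 ->
    (L2norm mu (fun x => (fourier_component sigma A1 lam (nu j) (lamG n) (fs n) (phi n) x
        - graphon_fourier mu w f (nu j) x)%R) ^+ 2)%E =
    (if nu j != 0 then nrm D (x n j - p j) ^+ 2 else 0)%:E.
  move=> j0; case: ifPn => [nj|/negPn/eqP nj].
    rewrite (fourier_componentE n nj (ulv j) (mlv j j0 nj)) -(hp j).2.
    by rewrite (_ : (fun y => _) = (x n j - p j : L2type mu))// L2norm_nrm.
  (* A padding index, nu j = 0: no i belongs to its index set, so the component is 0, and what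
     remains is the kernel projection, null by hypothesis. *)
  rewrite nj -p0E (_ : (fun y => _) = (- p0 : L2type mu)).
    by rewrite L2norm_nrm nrmN np0 expe2 mule0.
  apply/funext => y; rewrite /fourier_component.
  rewrite (_ : _ `&` _ = set0) ?fsbig_set0 ?sub0r//.
  by apply/seteqP; split => // i [[[_ li] lic] _]; rewrite lic eqxx in li.
apply: cvge0P => [n|e e0].
  by apply: esum_ge0 => j _; rewrite expe2 mule_ge0 ?Lnorm_ge0.
have hpj j : j != 0 -> nu j != 0 -> is_proj D T (nu j) F (p j) by move=> _ _; exact: (hp j).1.
have := components_uniform graphon_spectral_approx (@L2_complete _ _ _ mu) enum_sip_dim
  enum_distinct_eig ulv mlv fsF hpj hp0 np0 e0.
apply: filterS => n hn; apply: ge_ereal_sup => _ [B [finB BZ] <-].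
rewrite fsbig_finite//=; set r := finmap.enum_fset _.
have rZ j : j \in r -> j != 0.
  by rewrite /r in_fset_set// => /set_mem; exact: BZ.
rewrite (eq_big_seq (fun j => (if nu j != 0 then nrm D (x n j - p j) ^+ 2 else 0)%:E));
  last by move=> j /rZ j0; exact: termE.
rewrite sumEFin lee_fin -big_mkcond -big_filter; apply: hn.
  by rewrite filter_uniq// finmap.fset_uniq.
by apply/allP => j; rewrite mem_filter => /andP[-> /rZ ->].
Qed.

End fourier_convergence.

Unset Implicit Arguments.

Local Close Scope complex_scope.

Theorem corollary3p9 (R : realType) (d : measure_display)
    (X : measurableType d) (mu : probability X R)
    (sigma : R -> X) (A1 : set R) (A2 : set X)
    (hsigma : iso_mod0 mu sigma A1 A2)
    (w : X * X -> R) (hw : graphon mu w)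
    (f : X -> R[i]) (hf : L2 mu f)
    (N : nat -> nat) (G : forall n, sgraph (N n))
    (fs : forall n, 'rV[R[i]]_(N n))
    (hconv : converges_in_norm mu
       (fun n => graph_graphon sigma A1 (G n))
       (fun n => step_signal sigma A1 (fs n)) w f)
    (lam nu : int -> R)
    (hlam : graphon_eigenvalues mu w lam)
    (hnu : graphon_distinct_eigenvalues mu w nu)
    (lamG : nat -> int -> R) (phi : forall n, int -> 'rV[R[i]]_(N n))
    (hlamG : forall n, graph_eigenvalues (G n) (lamG n))
    (hphi : forall n, orthonormal_eigenvectors (G n) (lamG n) (phi n)) :
  (forall j, Zstar j -> nu j != 0 ->
     L2norm mu (fun s =>
         fourier_component sigma A1 lam (nu j) (lamG n) (fs n) (phi n) s
         - graphon_fourier mu w f (nu j) s)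
       @[n --> \oo] --> 0%E) /\
  (ceq mu (graphon_fourier mu w f 0) (cst 0) ->
     \esum_(j in Zstar)
        (L2norm mu (fun s =>
           (fourier_component sigma A1 lam (nu j) (lamG n) (fs n) (phi n) s
            - graphon_fourier mu w f (nu j) s)%R) ^+ 2)%E
       @[n --> \oo] --> 0%E).
Proof.
split=> [j j0 nj|ker0].
- exact: (fourier_component_cvg hsigma hw hf hconv hlam hlamG hphi j0 nj).
- exact: (fourier_component_sum_cvg hsigma hw hf hconv hlam hnu hlamG hphi ker0).
Qed.
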